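(* Let $n\ge 1$ be an integer and let $L:Y^3_n\to\mathbb{R}$ be a smooth function such that $$D_uD_vD_wL=0\quad\text{for all directions } u,v,w\in \{0\}\times(\mathbb{R}^n)^{\otimes 3}\times(\mathbb{R}^n)^{\otimes 4}\times(\mathbb{R}^n)^{\otimes 3}\times(\mathbb{R}^n)^{\otimes 4}.$$ Suppose that, for every triple $(M^n,g,\nabla)$, where $M$ is a smooth $n$-manifold, $g$ is a Lorentz metric on $M$ and $\nabla$ is an affine connection on $TM$, there exists a function $f_{g,\nabla}\in C^\infty(M)$ such that $$L(g_{ij},g_{ij,k},g_{ij,kl},\Gamma_{ijk},\Gamma_{ijk,l})=f_{g,\nabla}$$ in all coordinates on $M$. Then there are constants $a,b,c\in\mathbb{R}$, a quadratic invariant $Q_g(D)=\mu^{IJ}(g_{ab})D_ID_J$, and an invariant divergence term $Bd_g(D)=\beta^{Ij}(g_{ab})D_{I;j}$ such that $$f_{g,\nabla}=a+bR_g+c|d\gamma|_g^2+Q_g(D)+Bd_g(D)$$ for all triples $(M,g,\nabla)$, where $D$ is the $(0,3)$-tensor field with components $D_{ijk}=\Gamma_{ijk}-\frac12(g_{jk,i}+g_{ik,j}-g_{ij,k})$ and $\gamma$ is the fully antisymmetric part of $D$.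
   Context: All indices run from $0$ to $n-1$, and repeated indices (including multi-indices) are summed. Capital letters $I,J$ denote multi-indices of length $3$, e.g. $D_I=D_{i_1i_2i_3}$. A comma denotes partial differentiation in the given coordinate chart. A semicolon denotes covariant differentiation with respect to the Levi-Civita connection of $g$. Domain: let $$W_n=\{(w_{ij},w_{ijk},w_{ijkl})\in(\mathbb{R}^n)^{\otimes 2}\times(\mathbb{R}^n)^{\otimes 3}\times(\mathbb{R}^n)^{\otimes 4} : \det(w_{ij})\ne 0\}$$ and $Y_n^3=W_n\times(\mathbb{R}^n)^{\otimes 3}\times(\mathbb{R}^n)^{\otimes 4}$. At each point of a coordinate chart, $(g_{ij},g_{ij,k},g_{ij,kl},\Gamma_{ijk},\Gamma_{ijk,l})$ is regarded as an element of $Y_n^3$. $D_u$ applied to a function on $Y^3_n$ denotes the directional derivative in the direction $u$ (not to be confused with the tensor field $D$). The third-derivative condition says that $L$ is a polynomial of degree at most $2$ in all variables other than $(w_{ij})$, with coefficients smooth functions of $(w_{ij})$. The connection $\nabla$ is arbitrary (not assumed torsion-free or metric-compatible), and $\Gamma_{ijk}=g(\nabla_{\partial_i}\partial_j,\partial_k)$ are its connection coefficients with the upper index lowered by $g$; thus $D$ is the difference tensor between $\nabla$ and the Levi-Civita connection of $g$, with index lowered. Its fully antisymmetric part is the $3$-form $\gamma_{i_1i_2i_3}=\frac{1}{3!}\sum_{\sigma\in S_3}\mathrm{sgn}(\sigma)D_{i_{\sigma(1)}i_{\sigma(2)}i_{\sigma(3)}}$, and $d\gamma$ is its exterior derivative.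 A Lorentz metric is a semi-Riemannian metric of signature $(-1,1,\dots,1)$. $R_g$ is the scalar curvature of $g$, the contraction with $g$ of the Ricci curvature $Ric_{ij}=dx^k(\nabla^g_{\partial_k}\nabla^g_{\partial_j}\partial_i-\nabla^g_{\partial_j}\nabla^g_{\partial_k}\partial_i)$, with $\nabla^g$ the Levi-Civita connection. $|\cdot|_g^2$ is the usual (possibly indefinite) squared norm on covariant $4$-tensors induced by $g$. A quadratic invariant $Q_g(D)=\mu^{IJ}(g_{ab})D_ID_J$ and an invariant divergence term $Bd_g(D)=\beta^{Ij}(g_{ab})D_{I;j}$ are expressions whose coefficients $\mu^{IJ},\beta^{Ij}$ are fixed smooth functions of the matrix of metric components $(g_{ab})$ (the same functions for every chart and every triple), and which are coordinate-invariant, i.e. for every Lorentz manifold $(M^n,g)$ and every $(0,3)$-tensor field $D$ they give the same function on $M$ in all coordinate charts; for the divergence term, the coefficients $\beta^{Ij}(g_{ab})$ form the components of a $(4,0)$-tensor field for every Lorentz manifold $(M^n,g)$. *)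

(* Defs.v *)
From mathcomp Require Import all_boot all_order all_algebra all_fingroup.
From mathcomp Require Import all_classical all_reals all_analysis.
Set Implicit Arguments.
Unset Strict Implicit.
Unset Printing Implicit Defensive.
Import Order.TTheory GRing.Theory Num.Theory.
Import numFieldNormedType.Exports.
Local Open Scope classical_set_scope.
Local Open Scope ring_scope.

(* V is always finite-dimensional below, and U open; then [Ck k U f] says that
   f is k times continuously differentiable on U. *)
Fixpoint Ck (R : realType) (V : normedModType R) (k : nat) (U : set V)
    (f : V -> R^o) : Prop :=
  match k with
  | 0%N => forall x, U x -> {for x, continuous f}
  | k'.+1 => (forall x, U x -> differentiable f x) /\
             (forall v, Ck k' U ('D_v f))
  end.

Definition smooth_on (R : realType) (V : normedModType R) (U : set V)
    (f : V -> R^o) : Prop := forall k, Ck k U f.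

Section Components.
Variables (R : realType) (n : nat).

Definition evec (i : 'I_n) : 'rV[R]_n := delta_mx 0 i.

(* Components of a rank r tensor (or of the coefficients of a connection) as
   functions of the coordinates; the multi-index i_1 ... i_r is an r-tuple. *)
Definition cfield (r : nat) := 'rV[R]_n -> r.-tuple 'I_n -> R^o.

Definition init_idx r (I : r.+1.-tuple 'I_n) : r.-tuple 'I_n :=
  [tuple tnth I (widen_ord (leqnSn r) s) | s < r].

Definition last_idx r (I : r.+1.-tuple 'I_n) : 'I_n := tnth I ord_max.

(* The comma: (partial T)_{i_1 ... i_r k} = T_{i_1 ... i_r , k}. *)
Definition partial r (T : cfield r) : cfield r.+1 :=
  fun u I => 'D_(evec (last_idx I)) (fun v => T v (init_idx I)) u.

Definition mx_of (T : cfield 2) (u : 'rV[R]_n) : 'M[R]_n :=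
  \matrix_(i, j) T u [tuple i; j].

Definition inv_metric (g : cfield 2) (u : 'rV[R]_n) : 'M[R]_n :=
  invmx (mx_of g u).

Definition lc_low (g : cfield 2) (u : 'rV[R]_n) (i j k : 'I_n) : R :=
  2^-1 * (partial g u [tuple j; k; i] + partial g u [tuple i; k; j]
          - partial g u [tuple i; j; k]).

(* The coefficient of d_m in the Levi-Civita derivative of d_j along d_i. *)
Definition lc (g : cfield 2) (u : 'rV[R]_n) (m i j : 'I_n) : R^o :=
  \sum_(l < n) inv_metric g u m l * lc_low g u i j l.

(* (cov_deriv g T)_{i_1 ... i_r j} = T_{i_1 ... i_r ; j}. *)
Definition cov_deriv (g : cfield 2) r (T : cfield r) : cfield r.+1 :=
  fun u K =>
    let I := init_idx K in
    partial T u K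
    - \sum_(s < r) \sum_(m < n) lc g u m (last_idx K) (tnth I s)
        * T u [tuple if t == s then m else tnth I t | t < r].

(* Ric_ij = dx^k (nabla_k nabla_j d_i - nabla_j nabla_k d_i). *)
Definition ricci (g : cfield 2) (u : 'rV[R]_n) (i j : 'I_n) : R :=
  \sum_(k < n)
    ('D_(evec k) (fun v => lc g v k j i) u
     - 'D_(evec j) (fun v => lc g v k k i) u
     + \sum_(m < n) (lc g u m j i * lc g u k k m
                     - lc g u m k i * lc g u k j m)).

Definition scalar_curv (g : cfield 2) (u : 'rV[R]_n) : R :=
  \sum_(i < n) \sum_(j < n) inv_metric g u i j * ricci g u i j.

Definition alternation r (T : cfield r) : cfield r :=
  fun u I => (r`!)%:R^-1 *
    \sum_(s : 'S_r) (-1) ^+ s * T u [tuple tnth I (s t) | t < r].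

(* (ext_deriv w)_{i_0 ... i_r}
     = sum_s (-1)^s d_{i_s} w_{i_0 ... (i_s omitted) ... i_r}. *)
Definition ext_deriv r (w : cfield r) : cfield r.+1 :=
  fun u I => \sum_(s < r.+1) (-1) ^+ s *
    'D_(evec (tnth I s)) (fun v => w v [tuple tnth I (lift s t) | t < r]) u.

Definition sqnorm (g : cfield 2) r (T : cfield r) (u : 'rV[R]_n) : R :=
  \sum_(I : r.-tuple 'I_n) \sum_(J : r.-tuple 'I_n)
    (\prod_(s < r) inv_metric g u (tnth I s) (tnth J s)) * T u I * T u J.

Definition minkowski : 'M[R]_n :=
  \matrix_(i, j) (if i == j then if val i == 0%N then -1 else 1 else 0).

(* A symmetric bilinear form of signature (-1, 1, ..., 1): the rows of P form
   an orthonormal basis. *)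
Definition lorentz_mx (G : 'M[R]_n) : Prop :=
  G^T = G /\ exists2 P, P \in unitmx & P *m G *m P^T = minkowski.

Definition tensor_space (r : nat) : normedModType R :=
  'rV[R]_#|{: r.-tuple 'I_n}|.

Definition to_tensor r (T : r.-tuple 'I_n -> R) : tensor_space r :=
  \row_k T (enum_val k).

(* The ambient vector space of Y_n^3; the factors are the slots of
   (g_ij, g_ij,k , g_ij,kl , Gamma_ijk , Gamma_ijk,l), in this order. *)
Definition jet_space : normedModType R :=
  ('M[R]_n * tensor_space 3 * tensor_space 4
   * tensor_space 3 * tensor_space 4)%type.

Definition jet_base (y : jet_space) : 'M[R]_n := y.1.1.1.1.

Definition Y3 : set jet_space := [set y | \det (jet_base y) != 0].

Definition jet (g : cfield 2) (Gam : cfield 3) (u : 'rV[R]_n) : jet_space :=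
  (mx_of g u, to_tensor (partial g u), to_tensor (partial (partial g) u),
   to_tensor (Gam u), to_tensor (partial Gam u)).

(* Coefficients mu^{IJ}(g_ab) and beta^{Ij}(g_ab); in the latter the 4-tuple
   is (I, j). *)
Definition quad_coef := 3.-tuple 'I_n -> 3.-tuple 'I_n -> 'M[R]_n -> R^o.
Definition div_coef := 4.-tuple 'I_n -> 'M[R]_n -> R^o.

Definition quad_expr (mu : quad_coef) (g : cfield 2) (D : cfield 3)
    (u : 'rV[R]_n) : R :=
  \sum_(I : 3.-tuple 'I_n) \sum_(J : 3.-tuple 'I_n)
    mu I J (mx_of g u) * D u I * D u J.

Definition div_expr (beta : div_coef) (g : cfield 2) (D : cfield 3)
    (u : 'rV[R]_n) : R :=
  \sum_(K : 4.-tuple 'I_n) beta K (mx_of g u) * cov_deriv g D u K.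

End Components.

Section Manifolds.
Variables (R : realType) (n : nat).

(* A homeomorphism from an open set of M onto an open set of R^n; the values of
   [cmap] and [cinv] outside these sets are irrelevant. *)
Record chart (M : topologicalType) := Chart {
  cdom : set M;
  cmap : M -> 'rV[R]_n;
  cinv : 'rV[R]_n -> M;
  cdom_open : open cdom;
  cimg_open : open (cmap @` cdom);
  cmapK : forall p, cdom p -> cinv (cmap p) = p;
  cmap_cont : forall p, cdom p -> {for p, continuous cmap};
  cinv_cont : forall u, (cmap @` cdom) u -> {for u, continuous cinv}
}.

Definition cimg (M : topologicalType) (x : chart M) : set 'rV[R]_n :=
  cmap x @` cdom x.

Definition transition (M : topologicalType) (x y : chart M) (i : 'I_n)
    (u : 'rV[R]_n) : R^o := cmap y (cinv x u) 0 i.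

Definition compatible (M : topologicalType) (x y : chart M) : Prop :=
  forall i, smooth_on (cmap x @` (cdom x `&` cdom y)) (transition x y i).

(* The atlas is maximal, so it consists of all the coordinates on M. *)
Record manifold := Manifold {
  carrier :> topologicalType;
  carrier_hausdorff : hausdorff_space carrier;
  carrier_second_countable : @second_countable carrier;
  atlas : set (chart carrier);
  atlas_cover : forall p, exists2 x, atlas x & cdom x p;
  atlas_compatible : forall x y, atlas x -> atlas y -> compatible x y;
  atlas_maximal : forall x,
    (forall y, atlas y -> compatible x y /\ compatible y x) -> atlas x
}.

(* jac x y p i a = d y^i / d x^a at p. *)
Definition jac (M : manifold) (x y : chart M) (p : M) (i a : 'I_n) : R :=
  'D_(evec R a) (transition x y i) (cmap x p).

Definition overlap (M : manifold) (x y : chart M) (p : M) : Prop :=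
  [/\ atlas x, atlas y, cdom x p & cdom y p].

(* Smooth (0,r)-tensor fields: components in each coordinate chart, with the
   transformation law. *)
Record tensor_field (r : nat) (M : manifold) := TensorField {
  tcomp :> chart M -> cfield R n r;
  tcomp_smooth : forall x I, atlas x -> smooth_on (cimg x) (fun u => tcomp x u I);
  tcomp_change : forall x y p J, overlap x y p ->
    tcomp x (cmap x p) J =
      \sum_(I : r.-tuple 'I_n)
        (\prod_(s < r) jac x y p (tnth I s) (tnth J s))
        * tcomp y (cmap y p) I
}.

Record lorentz_metric (M : manifold) := LorentzMetric {
  metric :> tensor_field 2 M;
  metric_lorentz : forall x u, atlas x -> cimg x u ->
    lorentz_mx (mx_of (metric x) u)
}.

(* coef x u k i j is the component along d_k of the covariant derivative of
   d_j in the direction d_i.  Expanding the same derivative in the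
   coordinates x and y, using d/dx^a = (dy^i/dx^a) d/dy^i and the Leibniz rule,
   gives the transformation law. *)
Record connection (M : manifold) := Connection {
  coef :> chart M -> 'rV[R]_n -> 'I_n -> 'I_n -> 'I_n -> R^o;
  coef_smooth : forall x k i j, atlas x ->
    smooth_on (cimg x) (fun u => coef x u k i j);
  coef_change : forall x y p k a b, overlap x y p ->
    \sum_(e < n) jac x y p k e * coef x (cmap x p) e a b =
      'D_(evec R a) ('D_(evec R b) (transition x y k)) (cmap x p)
      + \sum_(i < n) \sum_(j < n)
          jac x y p i a * jac x y p j b * coef y (cmap y p) k i j
}.

Definition smooth_fun (M : manifold) (f : M -> R) : Prop :=
  forall x, atlas x -> smooth_on (cimg x) (fun u => f (cinv x u)).

Section Fields.
Variables (M : manifold) (g : lorentz_metric M) (nabla : connection M).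
Variable x : chart M.

(* Gamma_ijk = g(nabla_{d_i} d_j, d_k). *)
Definition conn_low : cfield R n 3 := fun u I =>
  \sum_(m < n) nabla x u m (tnth I 0) (tnth I 1) * g x u [tuple m; tnth I 2].

Definition diff_tensor : cfield R n 3 := fun u I =>
  conn_low u I - lc_low (g x) u (tnth I 0) (tnth I 1) (tnth I 2).

Definition gamma_form : cfield R n 3 := alternation diff_tensor.

End Fields.

Definition represents (L : jet_space R n -> R) (M : manifold)
    (g : lorentz_metric M) (nabla : connection M) (f : M -> R) : Prop :=
  smooth_fun f /\
  forall x p, atlas x -> cdom x p ->
    L (jet (g x) (conn_low g nabla x) (cmap x p)) = f p.

Definition quadratic_invariant (mu : quad_coef R n) : Prop :=
  (forall I J, smooth_on [set w | \det w != 0] (mu I J)) /\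
  forall (M : manifold) (g : lorentz_metric M) (D : tensor_field 3 M) x y p,
    overlap x y p ->
    quad_expr mu (g x) (D x) (cmap x p) = quad_expr mu (g y) (D y) (cmap y p).

Definition invariant_divergence (beta : div_coef R n) : Prop :=
  [/\ forall K, smooth_on [set w | \det w != 0] (beta K),
      forall (M : manifold) (g : lorentz_metric M) x y p K, overlap x y p ->
        beta K (mx_of (g y) (cmap y p)) =
          \sum_(J : 4.-tuple 'I_n)
            (\prod_(s < 4) jac x y p (tnth K s) (tnth J s))
            * beta J (mx_of (g x) (cmap x p))
    & forall (M : manifold) (g : lorentz_metric M) (D : tensor_field 3 M) x y p,
        overlap x y p ->
        div_expr beta (g x) (D x) (cmap x p)
          = div_expr beta (g y) (D y) (cmap y p)].

End Manifolds.

(* Main.v *)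
(* Write [F G A B D E] for the value of [L] in terms of G = (g_ij), A = (g_ij,k),
   B = (g_ij,kl), D and E = (D_ijk,l); it has degree at most 2 in (A, B, D, E).
   Suitable metrics and tensor fields on R^n realise every value of these
   variables, and suitable charts realise every second and third derivative of a
   change of coordinates at a point.  Invariance under such changes shows that F
   depends only on G, on B - q(A) with q quadratic in A, up to a symmetrised part
   of it, on D, and on the covariant derivative E - A * D.  Comparing degrees, the
   quadratic part of F cannot involve B and annihilates A * D paired with E; the
   change of coordinates -1 excludes the terms odd in D.  So F is a function of G
   plus a linear form in B, a linear form in E, a quadratic form in D and a
   quadratic form in E.  Reflections and rotations of a plane fixing the Minkowski
   matrix leave for the form in B only the multiples of the scalar curvature.  The
   quadratic form in E depends only on the antisymmetric part of E, that is on
   d gamma, and is a multiple of its squared norm.  The linear form in E is Bd and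
   the quadratic form in D is Q. *)
From HB Require Import structures.
Require Import Defs.
From mathcomp Require Import all_boot all_order all_algebra all_fingroup.
From mathcomp Require Import all_classical all_reals all_analysis.
From mathcomp Require Import ring lra.
Import Order.TTheory GRing.Theory Num.Theory.
Import numFieldNormedType.Exports.
Local Open Scope classical_set_scope.
Local Open Scope ring_scope.
Set Implicit Arguments.
Unset Strict Implicit.
Unset Printing Implicit Defensive.

(** * Continuously differentiable functions *)

(** The hypothesis on [L] concerns metrics, connections and charts that exist globally, while the
    argument wants free jets at one point. Polynomial coordinate changes and metric perturbations
    are unbounded, so the coordinates in them are replaced by [e * sin (u_i / e)]. For small [e] the
    coordinate change is the identity plus a contraction, hence a global diffeomorphism, and the
    metric is a pointwise congruence of a constant one, hence Lorentz everywhere. The comparison of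
    degrees is a scaling argument: when [(A, B, D, E)] is multiplied by [t], both [q(A)] and [A * D]
    scale by [t ^ 2], so the coefficient of [t ^ 3] isolates the pairing of [(B, D, E)] with
    [(q(A), A * D)]. Invariants are computed at the Minkowski matrix and carried to other Lorentz
    matrices by orthonormal frames. The coefficients [mu] and [beta] are derivatives of [L] at jets
    whose derivative slots vanish, which makes them smooth on all invertible matrices. The chart
    independence of the divergence term is obtained from the part of [L] that is odd in [D]. *)

Section Differentiability.
Variables (R : realType) (V W : normedModType R).

(** Trades the little-o notation for explicit estimates, the form in which inverse maps are
    differentiated below. *)
Lemma differentiable_near0P (f : V -> W) x (l : {linear V -> W}) :
  continuous l ->
  (forall e : R, 0 < e -> \forall h \near 0,
     `|f (h + x) - f x - l h| <= e * `|h|) ->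
  differentiable f x /\ 'd f x = l :> (V -> W).
Proof.
move=> lc H.
have E : f \o shift x = cst (f x) + l +o_ 0 id.
  apply/eqaddoP => e e0; near=> h.
  rewrite !fctE /= opprD addrA.
  by near: h; exact: H.
have dl := diff_unique lc E.
by split=> //; apply/diff_locallyP; rewrite dl.
Unshelve. all: by end_near. Qed.

Lemma differentiable_near0 (f : V -> W) x : differentiable f x ->
  forall e : R, 0 < e -> \forall h \near 0,
     `|f (h + x) - f x - 'd f x h| <= e * `|h|.
Proof.
move=> /diff_locally /eqaddoP H e e0; near=> h.
have : `|((f \o shift x) - (cst (f x) + 'd f x)) h| <= e * `|id h|.
  by near: h; exact: H.
by rewrite !fctE /= opprD addrA.
Unshelve. all: by end_near. Qed.

Lemma near_eq_differentiable (f h : V -> W) x : {near x, f =1 h} ->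
  differentiable f x -> differentiable h x.
Proof.
move=> fh df.
have [] // := @differentiable_near0P h x ('d f x).
  exact: diff_continuous.
move=> e e0; have H := differentiable_near0 df e0.
have fh0 : \forall k \near 0, f (k + x) = h (k + x).
  have : \forall y \near x, f y = h y by exact: fh.
  by rewrite (near_shift 0) subr0.
near=> k; rewrite -(near fh0 k) // -(nbhs_singleton fh).
by near: k.
Unshelve. all: by end_near. Qed.

End Differentiability.

Section CkAlgebra.
Variables (R : realType) (V : normedModType R).
Implicit Types (f h : V -> R^o) (U : set V).

Lemma CkS k U f : Ck k.+1 U f -> Ck k U f.
Proof.
elim: k f => [|k IH] f [df Df].
  by move=> x /df /differentiable_continuous.
by split=> // v; apply: IH; exact: Df.
Qed.

Lemma Ck_eq k U f h : open U -> (forall x, U x -> f x = h x) ->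
  Ck k U f -> Ck k U h.
Proof.
move=> oU; elim: k f h => [|k IH] f h fh.
  move=> H x Ux; rewrite /prop_for /continuous_at -(fh x Ux).
  apply: cvg_trans (H x Ux).
  apply: near_eq_cvg; apply: filterS (open_nbhs_nbhs (conj oU Ux)) => y; exact: fh.
move=> [df Df]; split=> [x Ux|v].
  apply: near_eq_differentiable (df x Ux).
  by apply: filterS (open_nbhs_nbhs (conj oU Ux)) => y; exact: fh.
apply: IH (Df v) => x Ux; apply: near_eq_derive.
by apply: filterS (open_nbhs_nbhs (conj oU Ux)) => y; exact: fh.
Qed.

Lemma Ck_cst k U c : Ck k U (cst c).
Proof.
elim: k c => [|k IH] c; first by move=> x _; exact: cst_continuous.
split=> [x _|v]; first exact: differentiable_cst.
have -> : 'D_v (cst c : V -> R^o) = cst 0 by apply/funext => x; exact: derive_cst.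
exact: IH.
Qed.

Lemma Ck_sub k U U' f : U' `<=` U -> Ck k U f -> Ck k U' f.
Proof.
move=> sU; elim: k f => [|k IH] f; first by move=> H x /sU; exact: H.
by move=> [df Df]; split=> [x /sU|v]; [exact: df|apply: IH; exact: Df].
Qed.

Lemma CkD k U f h : open U -> Ck k U f -> Ck k U h ->
  Ck k U (fun x => f x + h x).
Proof.
move=> oU; elim: k f h => [|k IH] f h.
  by move=> Hf Hh x Ux; apply: cvgD; [exact: Hf|exact: Hh].
move=> [df Df] [dh Dh]; split=> [x Ux|v].
  exact: differentiableD (df _ Ux) (dh _ Ux).
apply: Ck_eq (IH _ _ (Df v) (Dh v)) => // x Ux.
by rewrite (@deriveD _ _ _ f h) //; apply: diff_derivable; first [exact: df|exact: dh].
Qed.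

Lemma CkM k U f h : open U -> Ck k U f -> Ck k U h ->
  Ck k U (fun x => f x * h x : R^o).
Proof.
move=> oU; elim: k f h => [|k IH] f h.
  by move=> Hf Hh x Ux; apply: cvgM; [exact: Hf|exact: Hh].
move=> Cf Ch; have [df Df] := Cf; have [dh Dh] := Ch; split=> [x Ux|v].
  exact: differentiableM (df _ Ux) (dh _ Ux).
apply: (@Ck_eq _ _ (fun x => f x * 'D_v h x + h x * 'D_v f x)) => //.
  move=> x Ux.
  have dfv : derivable f x v := diff_derivable (df _ Ux).
  have dhv : derivable h x v := diff_derivable (dh _ Ux).
  by rewrite (@deriveM _ _ f h x v dfv dhv).
by apply: CkD => //; apply: IH; first [exact: CkS Cf|exact: CkS Ch|exact: Df|exact: Dh].
Qed.

Lemma CkZ k U c f : open U -> Ck k U f -> Ck k U (fun x => c * f x : R^o).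
Proof. by move=> oU; apply: CkM => //; exact: Ck_cst. Qed.

Lemma CkN k U f : open U -> Ck k U f -> Ck k U (fun x => - f x : R^o).
Proof.
move=> oU Cf; apply: Ck_eq (CkZ (-1) oU Cf) => // x _; by rewrite mulN1r.
Qed.

Lemma CkB k U f h : open U -> Ck k U f -> Ck k U h ->
  Ck k U (fun x => f x - h x).
Proof. by move=> oU Cf Ch; apply: CkD => //; exact: CkN. Qed.

Lemma Ck_sum k U (I : Type) (r : seq I) (P : pred I) (F : I -> V -> R^o) :
  open U -> (forall i, P i -> Ck k U (F i)) ->
  Ck k U (fun x => \sum_(i <- r | P i) F i x).
Proof.
move=> oU H; elim: r => [|a r IH].
  by apply: Ck_eq (Ck_cst k U 0) => // x _; rewrite big_nil.
have [Pa|nPa] := boolP (P a); last first.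
  by apply: Ck_eq IH => // x _; rewrite big_cons (negbTE nPa).
by apply: Ck_eq (CkD oU (H a Pa) IH) => // x _; rewrite big_cons Pa.
Qed.

Lemma Ck_prod k U (I : Type) (r : seq I) (P : pred I) (F : I -> V -> R^o) :
  open U -> (forall i, P i -> Ck k U (F i)) ->
  Ck k U (fun x => \prod_(i <- r | P i) F i x : R^o).
Proof.
move=> oU H; elim: r => [|a r IH].
  by apply: Ck_eq (Ck_cst k U 1) => // x _; rewrite big_nil.
have [Pa|nPa] := boolP (P a); last first.
  by apply: Ck_eq IH => // x _; rewrite big_cons (negbTE nPa).
by apply: Ck_eq (CkM oU (H a Pa) IH) => // x _; rewrite big_cons Pa.
Qed.

Lemma CkV k U f : open U -> (forall x, U x -> f x != 0) -> Ck k U f ->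
  Ck k U (fun x => (f x)^-1 : R^o).
Proof.
move=> oU f0; elim: k => [|k IH].
  by move=> Hf x Ux; apply: cvgV; [exact: f0|exact: Hf].
move=> Cf; have [df Df] := Cf; split=> [x Ux|v].
  by apply: differentiableV; [exact: df|exact: f0].
apply: (@Ck_eq _ _ (fun x => - (((f x)^-1 * (f x)^-1) * 'D_v f x))) => //.
  move=> x Ux; rewrite deriveV; [|exact: f0|by apply: diff_derivable; exact: df].
  by rewrite /GRing.scale /= mulNr -exprVn expr2.
have CV := IH (CkS Cf).
by apply: CkN => //; apply: CkM => //; [exact: CkM|exact: Df].
Qed.

End CkAlgebra.

Section CkComp.
Variables (R : realType) (V : normedModType R).

(** The directional derivatives of [Phi] are constant, so those of [f \o Phi] are
    ['D_(l v) f \o Phi], again of the same form. This serves for maps into product spaces, where the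
    coordinate version [Ck_comp] does not apply. *)
Lemma Ck_comp_affine (W : normedModType R) k (U : set V) (U' : set W)
    (Phi : V -> W) (l : V -> W) (f : W -> R^o) : open U ->
  (forall u, U u -> U' (Phi u)) ->
  (forall u, U u -> differentiable Phi u) ->
  (forall u v, U u -> 'D_v Phi u = l v) ->
  Ck k U' f -> Ck k U (f \o Phi).
Proof.
move=> oU UU' dP DP; elim: k f => [|k IH] f.
  move=> Hf u Uu; apply: continuous_comp; last by apply: Hf; exact: UU'.
  exact: differentiable_continuous (dP _ Uu).
move=> [df Df]; split=> [u Uu|v].
  by apply: differentiable_comp; [exact: dP|apply: df; exact: UU'].
apply: Ck_eq (IH _ (Df (l v))) => // u Uu.
have d1 := dP u Uu; have d2 := df _ (UU' u Uu).
rewrite [RHS]deriveE; last exact: differentiable_comp.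
by rewrite diff_comp //= -(deriveE v d1) DP // deriveE.
Qed.

Variable m : nat.
Implicit Types (Phi : V -> 'rV[R]_m).

Lemma rV_coord_decomp Phi : Phi = \sum_i (fun u => Phi u 0 i *: delta_mx 0 i).
Proof. by apply/funext => u; rewrite fct_sumE [LHS]row_sum_delta. Qed.

Lemma rV_differentiable Phi u :
  (forall i, differentiable (fun u => Phi u 0 i : R^o) u) -> differentiable Phi u.
Proof.
move=> H; rewrite (rV_coord_decomp Phi).
by apply: differentiable_sum => i; apply: differentiableZl; exact: H.
Qed.

Lemma rV_continuous Phi u :
  (forall i, {for u, continuous (fun u => Phi u 0 i : R^o)}) ->
  {for u, continuous Phi}.
Proof.
move=> H; rewrite (rV_coord_decomp Phi).
elim/big_ind : _ => [|f h|i _]; first exact: cst_continuous.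
  exact: continuousD.
by apply: cvgZr_tmp; exact: H.
Qed.

Lemma rV_derive Phi u v i : differentiable Phi u ->
  ('D_v Phi u) 0 i = 'D_v (fun u => Phi u 0 i : R^o) u.
Proof. by move=> dP; rewrite derive_mx ?mxE //; exact: diff_derivable. Qed.

Lemma derive_comp_rV Phi (f : 'rV[R]_m -> R^o) u v :
  differentiable Phi u -> differentiable f (Phi u) ->
  'D_v (f \o Phi) u
    = \sum_i 'D_v (fun u => Phi u 0 i : R^o) u * 'D_(delta_mx 0 i) f (Phi u).
Proof.
move=> dP df; rewrite deriveE; last exact: differentiable_comp.
rewrite diff_comp //= -(deriveE v dP) (row_sum_delta ('D_v Phi u)) linear_sum /=.
apply: eq_bigr => i _; rewrite linearZ /= rV_derive //.
by rewrite (deriveE (delta_mx 0 i) df).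
Qed.

(** Induction on [k] through the coordinate chain rule, whose terms are products of derivatives of
    the components with partial derivatives of [f] composed with [Phi]. *)
Lemma Ck_comp k (U : set V) (U' : set 'rV[R]_m) Phi (f : 'rV[R]_m -> R^o) :
  open U -> (forall u, U u -> U' (Phi u)) ->
  (forall i, Ck k U (fun u => Phi u 0 i)) -> Ck k U' f -> Ck k U (f \o Phi).
Proof.
move=> oU UU'; elim: k f => [|k IH] f.
  move=> HP Hf u Uu; apply: continuous_comp; last by apply: Hf; exact: UU'.
  by apply: rV_continuous => i; exact: HP.
move=> HP [df Df].
have dP u : U u -> differentiable Phi u.
  by move=> Uu; apply: rV_differentiable => i; exact: (HP i).1.
split=> [u Uu|v].
  by apply: differentiable_comp; [exact: dP|apply: df; exact: UU'].
apply: (@Ck_eq _ _ _ _ (fun u => \sum_i 'D_v (fun u => Phi u 0 i : R^o) u *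
    ('D_(delta_mx 0 i) f \o Phi) u)) => //.
  by move=> u Uu; rewrite derive_comp_rV //; [exact: dP|apply: df; exact: UU'].
apply: Ck_sum => // i _; apply: CkM => //; first exact: (HP i).2.
by apply: IH; [move=> j; exact: CkS|exact: Df].
Qed.

End CkComp.

Section DeriveSums.
Variables (R : realType) (V : normedModType R).
Implicit Types (f g h : V -> R^o).

Lemma is_derive_fsum (I : Type) (r : seq I) (F : I -> V -> R^o) (dF : I -> R) x v :
  (forall i, is_derive x v (F i) (dF i)) ->
  is_derive x v (fun x => \sum_(i <- r) F i x) (\sum_(i <- r) dF i : R^o).
Proof.
move=> H; elim: r => [|a r IH].
  rewrite big_nil (_ : (fun _ => _) = cst 0); first exact: is_derive_cst.
  by apply/funext => y; rewrite big_nil.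
rewrite big_cons (_ : (fun _ => _) = F a + (fun x => \sum_(i <- r) F i x)).
  exact: is_deriveD.
by apply/funext => y; rewrite big_cons.
Qed.

Lemma is_derive_mul f h (df dh : R) x v :
  is_derive x v f df -> is_derive x v h dh ->
  is_derive x v (fun x => f x * h x : R^o) (df * h x + f x * dh).
Proof.
move=> Hf Hh; have := @is_deriveM _ _ f h x v df dh Hf Hh.
by rewrite addrC [h x *: df]mulrC.
Qed.

Lemma is_derive_near f h (df : R^o) x v : (\forall y \near x, f y = h y) ->
  is_derive x v f df -> is_derive x v h df.
Proof. exact: near_eq_is_derive. Qed.

Lemma is_derive_val f (df : R) x v : is_derive x v f df -> 'D_v f x = df.
Proof. by case. Qed.

Lemma is_derive_of_derivable f x v : derivable f x v -> is_derive x v f ('D_v f x).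
Proof. by move=> H; apply: DeriveDef. Qed.

Lemma is_derive_congr f h (df dh : R) x v : (forall y, f y = h y) -> df = dh ->
  is_derive x v f df -> is_derive x v h dh.
Proof. by move=> /funext -> ->. Qed.

End DeriveSums.

Lemma is_derive_quadratic (R : realType) (a b t : R) :
  is_derive t (1 : R) (fun s : R => s * a + 2^-1 * b * (s * s) : R^o) (a + b * t : R^o).
Proof.
have did : is_derive t (1 : R) (id : R -> R^o) (1 : R) by exact: is_derive_id.
apply: is_derive_congr (is_deriveD
  (is_derive_mul did (is_derive_cst (a : R^o) t (1 : R)))
  (is_derive_mul (is_derive_cst (2^-1 * b : R^o) t (1 : R)) (is_derive_mul did did))).
  by [].
by rewrite /cst /=; field.
Qed.

(** * Second differences, symmetry of second derivatives, Taylor expansion on lines *)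

Section LineDerivative.
Variables (R : realType) (V : normedModType R).

Lemma line_is_derive (f : V -> R^o) (y v : V) (t : R) :
  differentiable f (y + t *: v) ->
  is_derive t (1 : R) (fun s : R => f (y + s *: v) : R^o) ('D_v f (y + t *: v)).
Proof.
move=> df.
pose phi : R -> V := cst y + ( *:%R ^~ v).
have dphi : is_diff t phi (cst 0 + ( *:%R ^~ v)) by apply: is_diffD.
have dphi1 := @ex_diff _ _ _ _ _ _ _ dphi.
have dc : differentiable (f \o phi) t by apply: differentiable_comp.
apply: DeriveDef; first exact: diff_derivable.
rewrite (deriveE _ dc) diff_comp //= deriveE //.
rewrite [X in 'd f _ X](_ : _ = v) //.
by rewrite (@diff_val _ _ _ _ _ _ _ dphi) /= add0r scale1r.
Qed.

Lemma second_difference (f : V -> R^o) (x v w : V) :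
  (\forall y \near x, differentiable f y) -> differentiable ('D_v f) x ->
  forall e : R, 0 < e -> \forall h \near (0 : R)^'+,
    `|f (x + h *: v + h *: w) - f (x + h *: v) - f (x + h *: w) + f x
      - h ^+ 2 * 'D_w ('D_v f) x| <= e * h ^+ 2.
Proof.
move=> df dg e e0.
(* [h * M] bounds [t *: v + c *: w] for [t] and [c] in [[0, h]], and the summand 1 makes [M]
   positive. The tolerance [e / (2 * M)] leaves [e / 2 * h] for each of the two values of
   ['D_v f]. *)
pose M := `|v| + `|w| + 1.
have M0 : 0 < M by rewrite /M; have := normr_ge0 v; have := normr_ge0 w; lra.
have e'0 : 0 < e / (2 * M) by rewrite divr_gt0 // mulr_gt0.
have := differentiable_near0 dg e'0 => /nbhs_ballP[r /= r0 Hr].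
move: df => /nbhs_ballP[s /= s0 Hs].
near=> h.
have h0 : 0 < h by near: h; exact: nbhs_right_gt.
have hr : h * M < r.
  by rewrite -ltr_pdivlMr //; near: h; apply: nbhs_right_lt; rewrite divr_gt0.
have hs : h * M < s.
  by rewrite -ltr_pdivlMr //; near: h; apply: nbhs_right_lt; rewrite divr_gt0.
have small t c : 0 <= t <= h -> 0 <= c <= h -> `|t *: v + c *: w| <= h * M.
  move=> /andP[t0 th] /andP[c0 ch].
  apply: le_trans (ler_normD _ _) _; rewrite !normrZ !ger0_norm //.
  have A1 : t * `|v| <= h * `|v| by rewrite ler_wpM2r.
  have A2 : c * `|w| <= h * `|w| by rewrite ler_wpM2r.
  by rewrite /M; nra.
have dfs t c : 0 <= t <= h -> 0 <= c <= h ->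
    differentiable f (x + c *: w + t *: v).
  move=> t0 c0; apply: Hs; rewrite -ball_normE /= opprD addrA opprD addrA subrr sub0r.
  by rewrite -opprD normrN addrC; apply: le_lt_trans hs; exact: small.
have estg t c : 0 <= t <= h -> 0 <= c <= h ->
    `|'D_v f (x + c *: w + t *: v) - 'D_v f x - 'd ('D_v f) x (t *: v + c *: w)|
      <= e / (2 * M) * (h * M).
  move=> t0 c0; have sm := small t c t0 c0.
  have -> : x + c *: w + t *: v = t *: v + c *: w + x by rewrite addrC [x + _]addrC addrA.
  apply: le_trans (Hr _ _) _; last by rewrite ler_wpM2l // ltW.
  by rewrite -ball_normE /= sub0r normrN; apply: le_lt_trans hr.
have h00 : 0 <= h <= h by rewrite lexx ltW.
have z00 : 0 <= (0 : R) <= h by rewrite lexx ltW.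
pose F := (fun t : R => f (x + h *: w + t *: v) : R^o)
   - (fun t : R => f (x + 0 *: w + t *: v) : R^o).
pose dF t := 'D_v f (x + h *: w + t *: v) - 'D_v f (x + 0 *: w + t *: v).
have dFt t : 0 <= t <= h -> is_derive t (1 : R) F (dF t).
  by move=> t0; apply: is_deriveB; apply: line_is_derive; apply: dfs.
have [||c ch Hc] := @MVT R F dF 0 h h0.
- by move=> t; rewrite in_itv /= => /andP[t0 th]; apply: dFt; rewrite !ltW.
- apply: derivable_within_continuous => t; rewrite in_itv /= => t0.
  by have [] := dFt t t0.
have cc : 0 <= c <= h by move: ch; rewrite in_itv /= => /andP[? ?]; rewrite !ltW.
have -> : f (x + h *: v + h *: w) - f (x + h *: v) - f (x + h *: w) + f x = F h - F 0.
  rewrite /F !fctE !scale0r !addr0 [x + h *: v + _]addrAC; ring.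
rewrite Hc subr0 (deriveE w dg).
have := estg c h cc h00; have := estg c 0 cc z00.
have dl t t' : 'd ('D_v f) x (t *: v + t' *: w) =
    t * 'd ('D_v f) x v + t' * 'd ('D_v f) x w by rewrite linearD !linearZ.
rewrite !dl.
have -> : e / (2 * M) * (h * M) = e / 2 * h by field; lra.
rewrite /dF.
set a := 'D_v f (x + 0 *: w + _); set b := 'D_v f (x + h *: w + _).
set g := 'D_v f x; set p := 'd _ _ v; set q := 'd _ _ w => H1 H2.
have -> : (b - a) * h - h ^+ 2 * q = h * ((b - g - (c * p + h * q)) - (a - g - (c * p + 0 * q))).
  ring.
rewrite normrM gtr0_norm //.
have : `|b - g - (c * p + h * q) - (a - g - (c * p + 0 * q))| <= e * h.
  by apply: le_trans (ler_normB _ _) _; lra.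
by move=> H; rewrite expr2 mulrCA ler_pM2l.
Unshelve. all: by end_near. Qed.

(** Both iterated derivatives approximate the same second difference, which is symmetric in [v] and
    [w], up to [e / 2 * h ^+ 2]. *)
Lemma Schwarz (f : V -> R^o) (x v w : V) :
  (\forall y \near x, differentiable f y) ->
  differentiable ('D_v f) x -> differentiable ('D_w f) x ->
  'D_w ('D_v f) x = 'D_v ('D_w f) x.
Proof.
move=> df dv dw; apply/eqP; rewrite -subr_eq0 -normr_le0.
apply/ler_addgt0Pl => e e0; rewrite addr0.
have e20 : 0 < e / 2 by rewrite divr_gt0.
have H1 := second_difference w df dv e20; have H2 := second_difference v df dw e20.
have H0 : \forall h \near (0 : R)^'+, 0 < h by exact: nbhs_right_gt.
have [h [[K1 K2] h0]] := filter_ex (filterI (filterI H1 H2) H0).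
move: K2 K1; rewrite [x + h *: w + _]addrAC.
set A := f _; set B := f _; set C := f _; set D := f x.
set a := 'D_w _ _; set b := 'D_v _ _ => K1 K2.
rewrite -(ler_pM2r (exprn_gt0 2 h0)) -[h ^+ 2 in leLHS]gtr0_norm ?exprn_gt0 //.
rewrite -normrM.
have -> : (a - b) * h ^+ 2 = (A - B - C + D - h ^+ 2 * b) - (A - C - B + D - h ^+ 2 * a).
  ring.
apply: le_trans (ler_normB _ _) _; apply: le_trans (lerD K1 K2) _.
by rewrite -mulrDl -splitr.
Qed.

Lemma Ck2_Schwarz (U : set V) (f : V -> R^o) x v w : open U -> U x ->
  Ck 2 U f -> 'D_w ('D_v f) x = 'D_v ('D_w f) x.
Proof.
move=> oU Ux [df Df]; apply: Schwarz; [|exact: (Df v).1|exact: (Df w).1].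
by apply: filterS (open_nbhs_nbhs (conj oU Ux)) => y; exact: df.
Qed.

(* Taylor expansion along the line [y + t u], whose remainder vanishes. *)
Lemma line_quadratic (U : set V) (f : V -> R^o) (y u : V) :
  (forall t : R, U (y + t *: u)) -> Ck 3 U f ->
  (forall z, U z -> 'D_u ('D_u ('D_u f)) z = 0) ->
  f (y + u) = f y + 'D_u f y + 2^-1 * 'D_u ('D_u f) y.
Proof.
move=> Uy Cf f3.
have [d0 D0] := Cf; have [d1 D1] := D0 u; have [d2 D2] := D1 u.
pose h0 (t : R) := f (y + t *: u); pose h1 t := 'D_u f (y + t *: u).
pose h2 t := 'D_u ('D_u f) (y + t *: u).
have dh0 t : is_derive t (1 : R) (h0 : R -> R^o) (h1 t) by exact/line_is_derive/d0.
have dh1 t : is_derive t (1 : R) (h1 : R -> R^o) (h2 t) by exact/line_is_derive/d1.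
have dh2 t : is_derive t (1 : R) (h2 : R -> R^o) 0.
  by rewrite -(f3 _ (Uy t)); exact/line_is_derive/d2.
have cst2 t : h2 t = h2 0 by apply: (@is_derive_0_is_cst R h2).
have cst1 t : h1 t = h1 0 + t * h2 0.
  have K s : is_derive s (1 : R) (fun t => h1 t - t * h2 0 : R^o) 0.
    apply: is_derive_congr (is_deriveB (dh1 s) (is_derive_quadratic (h2 0) 0 s)).
      move=> z; rewrite fctE; congr (_ - _).
      by rewrite (mulr0 (2^-1 : R)) (mul0r (z * z)) addr0.
    by rewrite cst2 mul0r addr0 subrr.
  have := is_derive_0_is_cst t 0 K.
  by rewrite mul0r subr0 => <-; rewrite subrK.
pose P (t : R) : R := t * h1 0 + 2^-1 * h2 0 * (t * t).
have K s : is_derive s (1 : R) (fun t => h0 t - P t : R^o) 0.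
  apply: is_derive_congr (is_deriveB (dh0 s) (is_derive_quadratic (h1 0) (h2 0) s)) => //.
  by rewrite cst1 [s * _]mulrC subrr.
have := is_derive_0_is_cst 1 0 K.
rewrite /P /h0 /h1 /h2 !scale1r !scale0r !addr0 => E.
have {}E : f (y + u) - f y = 'D_u f y + 2^-1 * 'D_u ('D_u f) y.
  by move: E => /eqP; rewrite subr_eq => /eqP ->; ring.
by rewrite -addrA -E addrC subrK.
Qed.

End LineDerivative.

Section SmoothAlgebra.
Variables (R : realType) (V : normedModType R) (U : set V).
Hypothesis oU : open U.

Lemma smooth_cst (c : R) : smooth_on U (fun=> c : R^o).
Proof. by move=> k; exact: Ck_cst. Qed.

Lemma smooth_eq (f h : V -> R^o) : (forall x, U x -> f x = h x) ->
  smooth_on U f -> smooth_on U h.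
Proof. by move=> fh sf k; apply: Ck_eq (sf k). Qed.

Lemma smoothD (f h : V -> R^o) : smooth_on U f -> smooth_on U h ->
  smooth_on U (fun x => f x + h x).
Proof. by move=> sf sh k; apply: CkD. Qed.

Lemma smoothM (f h : V -> R^o) : smooth_on U f -> smooth_on U h ->
  smooth_on U (fun x => f x * h x : R^o).
Proof. by move=> sf sh k; apply: CkM. Qed.

Lemma smoothN (f : V -> R^o) : smooth_on U f -> smooth_on U (fun x => - f x : R^o).
Proof. by move=> sf k; apply: CkN. Qed.

Lemma smoothB (f h : V -> R^o) : smooth_on U f -> smooth_on U h ->
  smooth_on U (fun x => f x - h x).
Proof. by move=> sf sh k; apply: CkB. Qed.

Lemma smooth_sum (I : Type) (r : seq I) (P : pred I) (F : I -> V -> R^o) :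
  (forall i, P i -> smooth_on U (F i)) ->
  smooth_on U (fun x => \sum_(i <- r | P i) F i x).
Proof. by move=> H k; apply: Ck_sum => // i /H. Qed.

Lemma smooth_prod (I : Type) (r : seq I) (P : pred I) (F : I -> V -> R^o) :
  (forall i, P i -> smooth_on U (F i)) ->
  smooth_on U (fun x => \prod_(i <- r | P i) F i x : R^o).
Proof. by move=> H k; apply: Ck_prod => // i /H. Qed.

Lemma smooth_derive (f : V -> R^o) v : smooth_on U f -> smooth_on U ('D_v f).
Proof. by move=> sf k; have [_] := sf k.+1; apply. Qed.

Lemma smooth_differentiable (f : V -> R^o) x : smooth_on U f -> U x ->
  differentiable f x.
Proof. by move=> sf; exact: (sf 1%N).1. Qed.

Lemma smooth_derivable (f : V -> R^o) x v : smooth_on U f -> U x ->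
  derivable f x v.
Proof. by move=> sf Ux; apply/diff_derivable/smooth_differentiable. Qed.

Variable n : nat.

Lemma smooth_det (X : V -> 'M[R]_n) :
  (forall i j, smooth_on U (fun x => X x i j : R^o)) ->
  smooth_on U (fun x => \det (X x) : R^o).
Proof.
move=> sX; apply: smooth_sum => s _; apply: smoothM; first exact: smooth_cst.
by apply: smooth_prod => i _; exact: sX.
Qed.

End SmoothAlgebra.

Section SmoothInverse.
Variables (R : realType) (V : normedModType R) (U : set V) (n : nat).
Hypothesis oU : open U.

(** Cramer's rule: each entry is a cofactor divided by the determinant. *)
Lemma smooth_invmx (X : V -> 'M[R]_n) i j :
  (forall i j, smooth_on U (fun x => X x i j : R^o)) ->
  (forall x, U x -> X x \in unitmx) ->
  smooth_on U (fun x => invmx (X x) i j : R^o).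
Proof.
move=> sX uX.
apply: (@smooth_eq _ _ _ oU (fun x => (\det (X x))^-1 * cofactor (X x) j i : R^o)).
  by move=> x Ux; rewrite /invmx uX // !mxE.
apply: smoothM => //.
  move=> k; apply: CkV => //; last exact: smooth_det.
  by move=> x /uX; rewrite unitmxE unitfE.
apply: smoothM => //; first exact: smooth_cst.
by apply: smooth_det => // a b k; apply: Ck_eq (sX _ _ k) => // x _; rewrite !mxE.
Qed.

End SmoothInverse.

Section SmoothCoord.
Variables (R : realType) (n : nat).

Lemma derive_coord m (A B : 'M[R]_(m, n)) (i : 'I_m) (j : 'I_n) :
  'D_B (fun A : 'M[R]_(m, n) => A i j : R^o) A = B i j.
Proof.
have := @derive_mx R _ m n id A B (@derivable_id _ _ A B).
by rewrite derive_id => /matrixP/(_ i j); rewrite !mxE.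
Qed.

Lemma smooth_coord m (U : set 'M[R]_(m, n)) (i : 'I_m) (j : 'I_n) :
  smooth_on U (fun A : 'M[R]_(m, n) => A i j : R^o).
Proof.
case=> [|k]; first by move=> A _; exact: coord_continuous.
split=> [A _|B]; first exact: differentiable_coord.
have -> : 'D_B (fun A : 'M[R]_(m, n) => A i j : R^o) = cst (B i j).
  by apply/funext => A; exact: derive_coord.
exact: Ck_cst.
Qed.

End SmoothCoord.

(** * Connections and jets on a manifold *)

Section TupleSums.
Variables (T : finType) (A : nmodType).

Lemma sum_tuple0 (F : 0.-tuple T -> A) : \sum_I F I = F [tuple].
Proof. by rewrite (big_pred1 [tuple]) // => I; apply/esym/eqP; exact: tuple0. Qed.

Lemma sum_tupleS r (F : r.+1.-tuple T -> A) :
  \sum_I F I = \sum_i \sum_(I : r.-tuple T) F [tuple of i :: I].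
Proof.
rewrite pair_big /= (reindex (fun p : T * r.-tuple T => [tuple of p.1 :: p.2])) //=.
exists (fun I => (thead I, [tuple of behead I])) => [[i I] _|I _] /=.
  by congr pair; apply: val_inj.
by rewrite -tuple_eta.
Qed.

Lemma sum_tuple2 (F : 2.-tuple T -> A) :
  \sum_I F I = \sum_i \sum_j F [tuple i; j].
Proof.
rewrite sum_tupleS; apply: eq_bigr => i _; rewrite sum_tupleS.
by apply: eq_bigr => j _; rewrite sum_tuple0; congr F; apply: val_inj.
Qed.

Lemma sum_tuple3 (F : 3.-tuple T -> A) :
  \sum_I F I = \sum_i \sum_j \sum_k F [tuple i; j; k].
Proof.
rewrite sum_tupleS; apply: eq_bigr => i _; rewrite sum_tuple2.
by apply: eq_bigr => j _; apply: eq_bigr => k _; congr F; apply: val_inj.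
Qed.

Lemma sum_tuple4 (F : 4.-tuple T -> A) :
  \sum_I F I = \sum_i \sum_j \sum_k \sum_l F [tuple i; j; k; l].
Proof.
rewrite sum_tupleS; apply: eq_bigr => i _; rewrite sum_tuple3.
apply: eq_bigr => j _; apply: eq_bigr => k _; apply: eq_bigr => l _.
by congr F; apply: val_inj.
Qed.

End TupleSums.

Section TupleProducts.
Variables (T : Type) (A : comPzSemiRingType).

Lemma prod_tuple4 (F : 'I_4 -> T -> A) i j k l :
  \prod_(s < 4) F s (tnth [tuple i; j; k; l] s) = F 0 i * F 1 j * F 2 k * F 3 l.
Proof.
rewrite 3!big_ord_recl big_ord1 !(tnth_nth i) /= !mulrA.
by congr (F _ _ * F _ _ * F _ _ * F _ _); apply: val_inj.
Qed.

End TupleProducts.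

Section PartialE.
Variables (R : realType) (n : nat).

Lemma tuple3_eta (T : Type) (I : 3.-tuple T) :
  I = [tuple tnth I 0; tnth I 1; tnth I 2].
Proof.
by apply: eq_from_tnth => -[[|[|[|//]]] h]; rewrite [RHS](tnth_nth (tnth I 0)) /=;
  congr tnth; apply: val_inj.
Qed.

Lemma tuple4_eta (T : Type) (I : 4.-tuple T) :
  I = [tuple tnth I 0; tnth I 1; tnth I 2; tnth I 3].
Proof.
by apply: eq_from_tnth => -[[|[|[|[|//]]]] h]; rewrite [RHS](tnth_nth (tnth I 0)) /=;
  congr tnth; apply: val_inj.
Qed.

Lemma init_idx3 (a b c : 'I_n) : init_idx [tuple a; b; c] = [tuple a; b].
Proof.
apply: eq_from_tnth => s; rewrite tnth_mktuple !(tnth_nth a) /=.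
by case: s => [[|[|//]] h].
Qed.

Lemma init_idx4 (a b c d : 'I_n) : init_idx [tuple a; b; c; d] = [tuple a; b; c].
Proof.
apply: eq_from_tnth => s; rewrite tnth_mktuple !(tnth_nth a) /=.
by case: s => [[|[|[|//]]] h].
Qed.

Lemma last_idx3 (a b c : 'I_n) : last_idx [tuple a; b; c] = c.
Proof. by rewrite /last_idx (tnth_nth a). Qed.

Lemma last_idx4 (a b c d : 'I_n) : last_idx [tuple a; b; c; d] = d.
Proof. by rewrite /last_idx (tnth_nth a). Qed.

Lemma partial3E (T : cfield R n 2) u a b c :
  partial T u [tuple a; b; c] = 'D_(evec R c) (fun v => T v [tuple a; b]) u.
Proof. by rewrite /partial init_idx3 last_idx3. Qed.

Lemma partial4E (T : cfield R n 3) u a b c d :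
  partial T u [tuple a; b; c; d] = 'D_(evec R d) (fun v => T v [tuple a; b; c]) u.
Proof. by rewrite /partial init_idx4 last_idx4. Qed.

Lemma partial_partialE (T : cfield R n 2) u a b c d :
  partial (partial T) u [tuple a; b; c; d] =
  'D_(evec R d) ('D_(evec R c) (fun v => T v [tuple a; b])) u.
Proof.
have E : (fun v => partial T v [tuple a; b; c]) = 'D_(evec R c) (fun v => T v [tuple a; b]).
  by apply/funext => v; exact: partial3E.
rewrite (partial4E (partial T)).
rewrite E.
by [].
Qed.

End PartialE.

(** This is the part of the open set [cimg x] that [cinv x], continuous there, sends into the open
    domain of [y]. *)
Lemma chart_overlap_open (R : realType) (n : nat) (M : topologicalType) (x y : chart R n M) :
  open (cmap x @` (cdom x `&` cdom y)).
Proof.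
rewrite openE => u [q [qx qy] <-].
have xq : cimg x (cmap x q) by exists q.
have := cinv_cont xq => /(_ (cdom y)); rewrite /= cmapK // => H.
have Ny : nbhs q (cdom y) by apply: open_nbhs_nbhs; split=> //; exact: cdom_open.
have := H Ny; rewrite nbhs_simpl /= => Hy.
have Hx : nbhs (cmap x q) (cimg x).
  by apply: open_nbhs_nbhs; split=> //; exact: cimg_open.
apply: filterS2 Hy Hx => w /= wy [r rx rw].
exists r => //; split=> //; by rewrite -rw cmapK in wy.
Qed.

Section Transitions.
Variables (R : realType) (n : nat) (M : manifold R n) (x y : chart R n M).
Hypotheses (ax : atlas x) (ay : atlas y).

Let U := cmap x @` (cdom x `&` cdom y).

Lemma overlap_image_open : open U.
Proof. exact: chart_overlap_open. Qed.

Lemma transition_smooth i : smooth_on U (transition x y i).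
Proof. exact: atlas_compatible. Qed.

Lemma overlap_image_point u : U u ->
  [/\ overlap x y (cinv x u), cmap x (cinv x u) = u & cimg y (cmap y (cinv x u))].
Proof.
move=> [q [qx qy] <-]; rewrite cmapK //; split=> //.
by exists q.
Qed.

End Transitions.

(** * Christoffel symbols under a change of chart *)

Section Christoffel.
Variables (R : realType) (n : nat) (M : manifold R n) (g : lorentz_metric M).
Variables (x y : chart R n M) (p : M).
Hypothesis xyp : overlap x y p.

Let U := cmap x @` (cdom x `&` cdom y).
Let u := cmap x p.
Let w := cmap y p.
Let H i a b : R := 'D_(evec R a) ('D_(evec R b) (transition x y i)) u.
Let J i a : R := jac x y p i a.

Let ax : atlas x. Proof. by case: xyp. Qed.
Let ay : atlas y. Proof. by case: xyp. Qed.
Let oU : open U. Proof. exact: overlap_image_open. Qed.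
Let Uu : U u. Proof. by case: xyp => _ _ px py; exists p. Qed.
Let xu : cinv x u = p. Proof. by case: xyp => _ _ px py; rewrite /u cmapK. Qed.
Let yw : cimg y w. Proof. by case: xyp => _ _ px py; exists p. Qed.

Lemma transition_derivative_sym i a b : H i a b = H i b a.
Proof. exact: Ck2_Schwarz oU Uu (transition_smooth ax ay i 2%N). Qed.

Lemma metric_transition v a b : U v ->
  g x v [tuple a; b] = \sum_i \sum_j
    'D_(evec R a) (transition x y i) v * 'D_(evec R b) (transition x y j) v
      * g y (cmap y (cinv x v)) [tuple i; j].
Proof.
move=> Uv; have [ov xv _] := overlap_image_point ax ay Uv.
rewrite -[in LHS]xv (tcomp_change g [tuple a; b] ov) sum_tuple2.
apply: eq_bigr => i _; apply: eq_bigr => j _; congr (_ * _).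
rewrite big_ord_recl big_ord1 /jac xv !(tnth_nth i) /=.
by [].
Qed.

Lemma is_derive_pullback r (T : tensor_field r M) I c :
  is_derive u (evec R c) (fun v => T y (cmap y (cinv x v)) I : R^o)
   (\sum_k J k c * 'D_(evec R k) (fun v => T y v I) w).
Proof.
have dt k : differentiable (fun v => (cmap y (cinv x v)) 0 k : R^o) u.
  exact: smooth_differentiable (transition_smooth ax ay k) Uu.
have dT : differentiable (fun v => T y v I) w.
  exact: smooth_differentiable (tcomp_smooth T I ay) yw.
have dP : differentiable (fun v => cmap y (cinv x v)) u by exact: rV_differentiable.
have xw : cmap y (cinv x u) = w by rewrite xu.
have := @derive_comp_rV _ _ _ (fun v => cmap y (cinv x v)) (fun v => T y v I) u
  (evec R c) dP.
rewrite /= xw => /(_ dT) <-; apply: is_derive_of_derivable.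
apply: diff_derivable; apply: (@differentiable_comp _ _ _ _
  (fun v => cmap y (cinv x v)) (fun v => T y v I)) => //.
by rewrite xw.
Qed.

Lemma metric_derivative_transition a b c :
  partial (g x) u [tuple a; b; c] = \sum_i \sum_j
    ((H i c a * J j b + J i a * H j c b) * g y w [tuple i; j]
     + J i a * J j b * \sum_k J k c * partial (g y) w [tuple i; j; k]).
Proof.
rewrite partial3E.
have Jd i d : is_derive u (evec R c) ('D_(evec R d) (transition x y i)) (H i c d).
  apply: is_derive_of_derivable.
  exact: smooth_derivable (smooth_derive _ (transition_smooth ax ay i)) Uu.
have JE i d : 'D_(evec R d) (transition x y i) u = J i d by [].
rewrite (near_eq_derive (g := fun v => \sum_i \sum_j
    'D_(evec R a) (transition x y i) v * 'D_(evec R b) (transition x y j) v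
      * g y (cmap y (cinv x v)) [tuple i; j])); last first.
  near=> v; apply: metric_transition; near: v.
  exact: open_nbhs_nbhs.
apply: is_derive_val; apply: is_derive_fsum => i; apply: is_derive_fsum => j.
have := is_derive_mul (is_derive_mul (Jd i a) (Jd j b))
  (is_derive_pullback g [tuple i; j] c).
rewrite xu !JE; under eq_bigr do rewrite -partial3E.
by [].
Unshelve. all: by end_near. Qed.

Lemma metric_symmetric (z : chart R n M) v i j : atlas z -> cimg z v ->
  g z v [tuple i; j] = g z v [tuple j; i].
Proof.
move=> az zv; have [/matrixP/(_ i j) + _] := metric_lorentz g az zv.
by rewrite !mxE.
Qed.

(** Each partial derivative of the metric contributes two terms with second derivatives [H] of the
    transition. In the combination defining [lc_low], symmetry of [H] cancels four of the six and
    makes the other two equal. *)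
Lemma lc_low_transition a b c :
  lc_low (g x) u a b c =
    \sum_i \sum_j H i a b * J j c * g y w [tuple i; j]
    + \sum_i \sum_j \sum_k J i a * J j b * J k c * lc_low (g y) w i j k.
Proof.
pose h a b c := \sum_i \sum_j H i a b * J j c * g y w [tuple i; j].
pose q a b c := \sum_i \sum_j \sum_k
  J i a * J j b * J k c * partial (g y) w [tuple i; j; k].
have E a' b' c' : partial (g x) u [tuple a'; b'; c'] = h c' a' b' + h c' b' a' + q a' b' c'.
  rewrite metric_derivative_transition.
  rewrite [h c' b' a']exchange_big /= -!big_split /=; apply: eq_bigr => i _.
  rewrite -!big_split /=; apply: eq_bigr => j _.
  rewrite (metric_symmetric j i ay yw) mulr_sumr mulrDl.
  congr (_ + _ + _); first by ring.
  by apply: eq_bigr => k _; ring.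
have hS a' b' c' : h a' b' c' = h b' a' c'.
  by apply: eq_bigr => i _; apply: eq_bigr => j _; rewrite transition_derivative_sym.
have qE : \sum_i \sum_j \sum_k J i a * J j b * J k c * lc_low (g y) w i j k =
    2^-1 * (q b c a + q a c b - q a b c).
  have q1 : q b c a = \sum_i \sum_j \sum_k
      J i a * J j b * J k c * partial (g y) w [tuple j; k; i].
    rewrite exchange_big /=; apply: eq_bigr => i _; rewrite exchange_big /=.
    by apply: eq_bigr => j _; apply: eq_bigr => k _; ring.
  have q2 : q a c b = \sum_i \sum_j \sum_k
      J i a * J j b * J k c * partial (g y) w [tuple i; k; j].
    apply: eq_bigr => i _; rewrite exchange_big /=.
    by apply: eq_bigr => j _; apply: eq_bigr => k _; ring.
  rewrite q1 q2 -big_split -sumrB mulr_sumr; apply: eq_bigr => i _.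
  rewrite -big_split -sumrB mulr_sumr; apply: eq_bigr => j _.
  rewrite -big_split -sumrB mulr_sumr; apply: eq_bigr => k _.
  by rewrite /lc_low /=; ring.
rewrite qE /lc_low !E -/(h a b c).
clearbody h q; rewrite (hS b a c) (hS c a b) (hS c b a).
by move: (h a b c) (h a c b) (h b c a) (q _ _ _) (q _ _ _) (q _ _ _) => *; field.
Qed.

End Christoffel.

Section LorentzMatrices.
Variables (R : realType) (n : nat).

Lemma minkowski_sq : Defs.minkowski R n *m Defs.minkowski R n = 1%:M.
Proof.
apply/matrixP => i j; rewrite !mxE (bigD1 i) //= big1 ?addr0.
  by rewrite !mxE eqxx; case: (i == j); case: (val i == 0%N); rewrite /=; ring.
by move=> k ki; rewrite !mxE eq_sym (negbTE ki) mul0r.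
Qed.

Lemma minkowski_unit : Defs.minkowski R n \in unitmx.
Proof. by case: (mulmx1_unit minkowski_sq). Qed.

Lemma lorentz_unit (G : 'M[R]_n) : lorentz_mx G -> G \in unitmx.
Proof.
move=> [_ [P uP E]]; have := minkowski_unit; rewrite -E !unitmx_mul.
by case/andP => /andP[].
Qed.

(** A Lorentz matrix is invertible, hence so is each of its square factors. Jacobians of transitions
    and isometries obtain their invertibility this way. *)
Lemma lorentz_tr_unit (J G G' : 'M[R]_n) :
  lorentz_mx G' -> G' = J^T *m G *m J -> J \in unitmx.
Proof. by move=> /lorentz_unit + E; rewrite E unitmx_mul => /andP[]. Qed.

Lemma pullback_invmx (J G G' : 'M[R]_n) : G \in unitmx -> J \in unitmx ->
  G' = J^T *m G *m J -> J *m invmx G' *m J^T = invmx G.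
Proof.
move=> uG uJ ->.
have uJT : J^T \in unitmx by rewrite unitmx_tr.
have E : invmx (J^T *m G *m J) = invmx J *m invmx G *m invmx J^T.
  apply: (@row_free_inj _ _ _ n (J^T *m G *m J)).
    by rewrite row_free_unit !unitmx_mul uJT uG uJ.
  rewrite mulVmx ?unitmx_mul ?uJT ?uG ?uJ // !mulmxA mulmxKV // mulmxKV //.
  by rewrite mulVmx.
by rewrite E !mulmxA mulmxV // mul1mx mulmxKV.
Qed.

End LorentzMatrices.

(** * Connections with a prescribed difference tensor *)

Section LeviCivitaPlus.
Variables (R : realType) (n : nat) (M : manifold R n) (g : lorentz_metric M).
Variable D : tensor_field 3 M.

(** Lowered coefficients of the Levi-Civita connection plus [D]. Since they come from a connection
    for every tensor field [D], the hypothesis on [L] may be read with [D] as a free variable. *)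
Definition lcD_low (x : chart R n M) u (I : 3.-tuple 'I_n) : R^o :=
  lc_low (g x) u (tnth I 0) (tnth I 1) (tnth I 2) + D x u I.

Definition lcD_coef (x : chart R n M) u (k i j : 'I_n) : R^o :=
  \sum_l inv_metric (g x) u k l * lcD_low x u [tuple i; j; l].

Lemma metric_unit x u : atlas x -> cimg x u -> mx_of (g x) u \in unitmx.
Proof. by move=> ax xu; exact/lorentz_unit/metric_lorentz. Qed.

Lemma inv_metric_smooth x i j : atlas x ->
  smooth_on (cimg x) (fun u => inv_metric (g x) u i j : R^o).
Proof.
move=> ax; apply: smooth_invmx => [||u]; [exact: cimg_open| |exact: metric_unit].
move=> a b; apply: smooth_eq (tcomp_smooth g [tuple a; b] ax); first exact: cimg_open.
by move=> u _; rewrite mxE.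
Qed.

Lemma lc_low_smooth x i j k : atlas x ->
  smooth_on (cimg x) (fun u => lc_low (g x) u i j k : R^o).
Proof.
move=> ax; have ox : open (cimg x) by exact: cimg_open.
have sp a b c : smooth_on (cimg x) (fun u => partial (g x) u [tuple a; b; c]).
  apply: smooth_eq (smooth_derive (evec R c) (tcomp_smooth g [tuple a; b] ax)) => //.
  by move=> u _; rewrite partial3E.
apply: smoothM => //; first exact: smooth_cst.
by apply: smoothB => //; apply: smoothD.
Qed.

Lemma lcD_low_smooth x I : atlas x -> smooth_on (cimg x) (fun u => lcD_low x u I).
Proof.
move=> ax; apply: smoothD; [exact: cimg_open|exact: lc_low_smooth|exact: tcomp_smooth].
Qed.

Lemma lcD_coef_smooth x k i j : atlas x ->
  smooth_on (cimg x) (fun u => lcD_coef x u k i j).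
Proof.
move=> ax; have ox : open (cimg x) by exact: cimg_open.
 apply: smooth_sum => // l _; apply: smoothM => //.
  exact: inv_metric_smooth.
exact: lcD_low_smooth.
Qed.

Lemma metric_pullback (x y : chart R n M) (p : M) : overlap x y p ->
  let J := \matrix_(i, a) jac x y p i a in
  mx_of (g x) (cmap x p) = J^T *m mx_of (g y) (cmap y p) *m J.
Proof.
move=> xyp J; apply/matrixP => a b; rewrite !mxE (tcomp_change g _ xyp) sum_tuple2.
under [RHS]eq_bigr do rewrite mxE mulr_suml.
rewrite exchange_big /=; apply: eq_bigr => i _; apply: eq_bigr => j _.
rewrite !mxE big_ord_recl big_ord1 !(tnth_nth i) /=; ring.
Qed.

Lemma jac_unit (x y : chart R n M) (p : M) : overlap x y p ->
  \matrix_(i, a) jac x y p i a \in unitmx.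
Proof.
move=> xyp; apply: lorentz_tr_unit (metric_pullback xyp).
by case: xyp => ax _ px _; apply: metric_lorentz => //; exists p.
Qed.

Lemma lcD_low_transition x y p a b c : overlap x y p ->
  lcD_low x (cmap x p) [tuple a; b; c] =
  \sum_l jac x y p l c *
    (\sum_k 'D_(evec R a) ('D_(evec R b) (transition x y k)) (cmap x p)
        * g y (cmap y p) [tuple k; l]
     + \sum_i \sum_j jac x y p i a * jac x y p j b
        * lcD_low y (cmap y p) [tuple i; j; l]).
Proof.
move=> xyp; rewrite {1}/lcD_low (tcomp_change D _ xyp) !(tnth_nth a) /=.
rewrite (lc_low_transition g xyp) sum_tuple3 -addrA.
under [RHS]eq_bigr do rewrite mulrDr.
rewrite [RHS]big_split /=; congr (_ + _).
  rewrite exchange_big /=; apply: eq_bigr => l _; rewrite mulr_sumr.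
  by apply: eq_bigr => k _; ring.
rewrite -big_split /=.
transitivity (\sum_i \sum_j \sum_l jac x y p l c * (jac x y p i a * jac x y p j b
   * lcD_low y (cmap y p) [tuple i; j; l])).
  apply: eq_bigr => i _; rewrite -big_split; apply: eq_bigr => j _.
  rewrite -big_split; apply: eq_bigr => l _ /=.
  rewrite 2!big_ord_recl big_ord1 /lcD_low !(tnth_nth i) /=; ring.
transitivity (\sum_i \sum_l \sum_j jac x y p l c * (jac x y p i a * jac x y p j b
   * lcD_low y (cmap y p) [tuple i; j; l])).
  by apply: eq_bigr => i _; exact: exchange_big.
rewrite exchange_big /=; apply: eq_bigr => l _; rewrite mulr_sumr.
by apply: eq_bigr => i _; rewrite mulr_sumr.
Qed.

(** Contraction of the lowered law [lcD_low_transition] with the inverse metric, using that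
    [J *m invmx Gx *m J^T] is the inverse metric in the other chart. *)
Lemma lcD_coef_change x y p k a b : overlap x y p ->
  \sum_(e < n) jac x y p k e * lcD_coef x (cmap x p) e a b =
      'D_(evec R a) ('D_(evec R b) (transition x y k)) (cmap x p)
      + \sum_(i < n) \sum_(j < n)
          jac x y p i a * jac x y p j b * lcD_coef y (cmap y p) k i j.
Proof.
move=> xyp.
pose J := \matrix_(i, a) jac x y p i a.
pose Gx := mx_of (g x) (cmap x p); pose Gy := mx_of (g y) (cmap y p).
have uy : Gy \in unitmx.
  by case: xyp => _ ay _ py; apply: metric_unit => //; exists p.
have JJ : J *m invmx Gx *m J^T = invmx Gy.
  exact: pullback_invmx uy (jac_unit xyp) (metric_pullback xyp).
pose m l := \sum_k 'D_(evec R a) ('D_(evec R b) (transition x y k)) (cmap x p)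
        * g y (cmap y p) [tuple k; l]
     + \sum_i \sum_j jac x y p i a * jac x y p j b
        * lcD_low y (cmap y p) [tuple i; j; l].
transitivity (\sum_l invmx Gy k l * m l).
  rewrite -JJ.
  under [RHS]eq_bigr do rewrite mxE mulr_suml.
  rewrite [RHS]exchange_big /=.
  transitivity (\sum_c (J *m invmx Gx) k c * lcD_low x (cmap x p) [tuple a; b; c]).
    under [RHS]eq_bigr do rewrite mxE mulr_suml.
    rewrite [RHS]exchange_big /=; apply: eq_bigr => e _; rewrite mulr_sumr.
    by apply: eq_bigr => c _; rewrite !mxE mulrA.
  apply: eq_bigr => c _; rewrite (lcD_low_transition a b c xyp) mulr_sumr.
  by apply: eq_bigr => l _; rewrite /m !mxE mulrA.
rewrite /m; under eq_bigr do rewrite mulrDr.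
rewrite big_split /=; congr (_ + _).
  under eq_bigr do rewrite mulr_sumr.
  rewrite exchange_big /=.
  transitivity (\sum_i 'D_(evec R a) ('D_(evec R b) (transition x y i)) (cmap x p)
     * (1%:M : 'M[R]_n) k i).
    apply: eq_bigr => i _; rewrite -(mulVmx uy) mxE mulr_sumr.
    apply: eq_bigr => l _; rewrite [mx_of _ _ _ _]mxE.
    rewrite (metric_symmetric g l i); first by ring.
      by case: xyp.
    by case: xyp => _ _ _ py; exists p.
  rewrite (bigD1 k) //= mxE eqxx mulr1 big1 ?addr0 // => i ik.
  by rewrite mxE eq_sym (negbTE ik) mulr0.
under eq_bigr do rewrite mulr_sumr.
rewrite exchange_big /=; apply: eq_bigr => i _.
under eq_bigr do rewrite mulr_sumr.
rewrite exchange_big /=; apply: eq_bigr => j _; rewrite /lcD_coef mulr_sumr.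
by apply: eq_bigr => l _; rewrite mulrCA.
Qed.

Definition lcD_connection : connection M :=
  Connection lcD_coef_smooth lcD_coef_change.

Lemma conn_low_lcD x u I : atlas x -> cimg x u ->
  conn_low g lcD_connection x u I = lcD_low x u I.
Proof.
move=> ax xu; rewrite /conn_low /= /lcD_coef.
under eq_bigr do rewrite mulr_suml.
rewrite exchange_big /=.
transitivity (\sum_l lcD_low x u [tuple tnth I 0; tnth I 1; l]
     * (1%:M : 'M[R]_n) l (tnth I 2)).
  apply: eq_bigr => l _; rewrite -(mulVmx (metric_unit ax xu)) mxE mulr_sumr.
  apply: eq_bigr => m _; rewrite [mx_of _ _ _ _]mxE.
  rewrite /inv_metric -/(mx_of _ _).
  have -> : invmx (mx_of (g x) u) m l = invmx (mx_of (g x) u) l m.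
    have [sG _] := metric_lorentz g ax xu.
    by rewrite -{1}sG -trmx_inv mxE.
  ring.
rewrite (bigD1 (tnth I 2)) //= big1 => [|l lI]; last by rewrite mxE (negbTE lI) mulr0.
by rewrite -tuple3_eta mxE (eqxx (tnth I 2)) mulr1 addr0.
Qed.

End LeviCivitaPlus.

Section JetInvariance.
Variables (R : realType) (n : nat) (L : jet_space R n -> R^o).
Hypothesis L_inv : forall (M : manifold R n) (g : lorentz_metric M)
   (nabla : connection M), exists f : M -> R, represents L g nabla f.

Lemma jet_near (g : cfield R n 2) (Gam Gam' : cfield R n 3) u :
  (\forall v \near u, Gam v = Gam' v) -> jet g Gam u = jet g Gam' u.
Proof.
move=> E; rewrite /jet (nbhs_singleton E); congr (_, _).
apply/rowP => k; rewrite !mxE; apply: near_eq_derive.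
by near=> v; rewrite (near E v).
Unshelve. all: by end_near. Qed.

(** The lowered coefficients of [lcD_connection] are known to be [lcD_low] only on the open image of
    the chart, where the metric is invertible; a jet depends only on the germ. *)
Lemma jet_invariance (M : manifold R n) (g : lorentz_metric M)
    (D : tensor_field 3 M) x y p : overlap x y p ->
  L (jet (g x) (lcD_low g D x) (cmap x p)) = L (jet (g y) (lcD_low g D y) (cmap y p)).
Proof.
move=> [ax ay px py].
have [f [_ Hf]] := L_inv g (lcD_connection g D).
have E z : atlas z -> cdom z p ->
    L (jet (g z) (lcD_low g D z) (cmap z p)) = f p.
  move=> az pz; rewrite -(Hf z p az pz); congr L; apply: jet_near.
  near=> v; apply/funext => I; rewrite conn_low_lcD //.
  near: v; apply: open_nbhs_nbhs; split; [exact: cimg_open|by exists p].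
by rewrite !E.
Unshelve. all: by end_near. Qed.

End JetInvariance.

(** * Charts and tensor fields on R^n *)

Lemma prod_sum_tuple (T : finType) (A : comPzSemiRingType) r (F : 'I_r -> T -> A) :
  \prod_(s < r) \sum_b F s b = \sum_(K : r.-tuple T) \prod_(s < r) F s (tnth K s).
Proof.
rewrite bigA_distr_bigA /=.
rewrite (reindex (fun K : r.-tuple T => [ffun s => tnth K s])) /=; last first.
  exists (fun f : {ffun 'I_r -> T} => [tuple f s | s < r]) => [K _|f _].
    by apply: eq_from_tnth => s; rewrite tnth_mktuple ffunE.
  by apply/ffunP => s; rewrite ffunE tnth_mktuple.
by apply: eq_bigr => K _; apply: eq_bigr => s _; rewrite ffunE.
Qed.

Section RowTopology.
Variables (R : realType) (n : nat).

Lemma rV_second_countable : @second_countable 'rV[R]_n.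
Proof.
pose f (qk : 'rV[rat]_n * nat) : set 'rV[R]_n :=
  ball (map_mx (ratr : rat -> R) qk.1 : 'rV[R]_n) (qk.2.+1%:R^-1).
exists (f @` setT).
  by apply: card_le_trans (card_image_le f setT) _; exact: countableP.
split=> [_ [qk _ <-]|x V].
  by apply: ball_open; rewrite invr_gt0.
move=> /nbhs_ballP[e /= e0 xe].
have [k /= ke] := @ltr_add_invr R 0 (e / 2) (divr_gt0 e0 (ltr0Sn _ 1)).
rewrite add0r in ke.
have k0 : 0 < k.+1%:R^-1 :> R by rewrite invr_gt0.
have q_ i : {q : rat | ratr q \in `](x 0 i - k.+1%:R^-1), (x 0 i + k.+1%:R^-1)[}.
  by apply/cid/rat_in_itvoo; rewrite ltrBlDr -addrA ltrDl addr_gt0.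
pose q := \row_i sval (q_ i).
have xq : ball (map_mx (ratr : rat -> R) q : 'rV[R]_n) k.+1%:R^-1 x.
  split=> // i j; rewrite !mxE ord1.
  have := svalP (q_ j); rewrite in_itv /= => /andP[h1 h2].
  by rewrite /ball /= distrC ltr_distl ltrBlDr ltrBlDr in h1 h2 *; rewrite h1 h2.
exists (f (q, k)) => /=; first by split=> //; exists (q, k).
move=> z fz; apply: xe.
rewrite (splitr e); apply: (@ball_triangle _ _ (map_mx (ratr : rat -> R) q : 'rV[R]_n)).
  by apply: le_ball (ball_sym xq); exact: ltW.
by apply: le_ball fz; exact: ltW.
Qed.

Lemma rV_hausdorff : hausdorff_space 'rV[R]_n.
Proof. exact: norm_hausdorff. Qed.

End RowTopology.

Section Euclidean.
Variables (R : realType) (n : nat).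
Notation E := ('rV[R]_n : topologicalType).

Section DiffeoChart.
Variables (phi psi : 'rV[R]_n -> 'rV[R]_n).
Hypothesis phiK : cancel phi psi.
Hypothesis psiK : cancel psi phi.
Hypothesis sphi : forall i, smooth_on setT (fun u => phi u 0 i : R^o).
Hypothesis spsi : forall i, smooth_on setT (fun u => psi u 0 i : R^o).

Lemma diffeo_image : psi @` [set: E] = setT.
Proof. by apply/seteqP; split=> // u _; exists (phi u). Qed.

Lemma diffeo_image_open : open (psi @` [set: E]).
Proof. by rewrite diffeo_image; exact: openT. Qed.

Lemma diffeo_continuous u : {for u, continuous psi}.
Proof. by apply: rV_continuous => i; exact: (spsi i 0%N). Qed.

Lemma diffeo_inv_continuous u : {for u, continuous phi}.
Proof. by apply: rV_continuous => i; exact: (sphi i 0%N). Qed.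

(** The map [phi] goes from coordinates to points: it is [cinv], and its derivatives are the ones
    prescribed later. *)
Definition diffeo_chart : chart R n E :=
  @Chart R n E setT psi phi openT diffeo_image_open (fun p _ => psiK p)
    (fun p _ => @diffeo_continuous p) (fun u _ => @diffeo_inv_continuous u).

End DiffeoChart.

Lemma id_coord_smooth i : smooth_on setT (fun u : 'rV[R]_n => id u 0 i : R^o).
Proof. exact: smooth_coord. Qed.

Definition id_chart : chart R n E :=
  @diffeo_chart id id (fun=> erefl) (fun=> erefl) id_coord_smooth id_coord_smooth.

(** Two charts compatible with the identity are compatible with each other through it, and
    maximality follows by testing against the identity alone. *)
Definition euclidean_atlas : set (chart R n E) :=
  [set x | compatible id_chart x /\ compatible x id_chart].

Lemma compatible_idP (x : chart R n E) :
  compatible id_chart x <-> forall i, smooth_on (cdom x) (fun u => cmap x u 0 i : R^o).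
Proof. by rewrite /compatible /= setTI image_id. Qed.

Lemma compatible_id_invP (x : chart R n E) :
  compatible x id_chart <-> forall i, smooth_on (cimg x) (fun u => cinv x u 0 i : R^o).
Proof. by rewrite /compatible /= setIT. Qed.

Lemma euclidean_compatible x y :
  euclidean_atlas x -> euclidean_atlas y -> compatible x y.
Proof.
move=> [_ /compatible_id_invP sx] [/compatible_idP sy _] i k.
pose U := cmap x @` (cdom x `&` cdom y).
apply: (@Ck_comp _ _ _ _ U (cdom y) (cinv x) (fun u => cmap y u 0 i : R^o)) => //.
- exact: chart_overlap_open.
- by move=> _ [q [qx qy] <-]; rewrite cmapK.
- move=> j; apply: Ck_sub (sx j k) => _ [q [qx _] <-]; by exists q.
- exact: sy.
Qed.

Lemma id_chart_atlas : euclidean_atlas id_chart.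
Proof.
by split; [apply/compatible_idP|apply/compatible_id_invP] => i; exact: smooth_coord.
Qed.

Lemma euclidean_cover (p : E) : exists2 x, euclidean_atlas x & cdom x p.
Proof. by exists id_chart => //; exact: id_chart_atlas. Qed.

Lemma euclidean_maximal x :
  (forall y, euclidean_atlas y -> compatible x y /\ compatible y x) ->
  euclidean_atlas x.
Proof. by move=> /(_ _ id_chart_atlas)[]. Qed.

Definition euclidean : manifold R n :=
  Manifold (@rV_hausdorff R n) (@rV_second_countable R n)
    euclidean_cover euclidean_compatible euclidean_maximal.

Lemma diffeo_chart_atlas phi psi phiK psiK sphi spsi :
  euclidean_atlas (@diffeo_chart phi psi phiK psiK sphi spsi).
Proof.
split; [apply/compatible_idP|apply/compatible_id_invP] => i; first exact: spsi.
by rewrite /cimg /= (diffeo_image phiK).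
Qed.

End Euclidean.

Section EuclideanTensors.
Variables (R : realType) (n : nat).
Notation E := (euclidean R n).
Notation chartE := (chart R n E).

Definition chart_jac (x : chartE) (u : 'rV[R]_n) (i a : 'I_n) : R :=
  'D_(evec R a) (fun v => cinv x v 0 i : R^o) u.

(** [T] holds the components in the identity chart. Between two arbitrary charts the transformation
    law follows from the chain rule for [chart_jac]. *)
Definition pull_comp r (T : cfield R n r) (x : chartE) : cfield R n r :=
  fun u J => \sum_(I : r.-tuple 'I_n)
    (\prod_(s < r) chart_jac x u (tnth I s) (tnth J s)) * T (cinv x u) I.

Lemma cinv_smooth (x : chartE) i : atlas x ->
  smooth_on (cimg x) (fun u => cinv x u 0 i : R^o).
Proof. by move=> [_ /compatible_id_invP]; apply. Qed.

Lemma chart_jac_chain (x y : chartE) (p : E) i a : overlap x y p ->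
  chart_jac x (cmap x p) i a = \sum_b chart_jac y (cmap y p) i b * jac x y p b a.
Proof.
move=> xyp; have [ax ay px py] := xyp.
pose U := cmap x @` (cdom x `&` cdom y).
have oU : open U by exact: chart_overlap_open.
have Uu : U (cmap x p) by exists p.
have yw : cimg y (cmap y p) by exists p.
rewrite /chart_jac (near_eq_derive (g :=
  ((fun v => cinv y v 0 i : R^o) \o (fun v => cmap y (cinv x v))))); last first.
  near=> v; have [q [qx qy] <-] : U v by near: v; exact: open_nbhs_nbhs.
  by rewrite /= cmapK // cmapK.
rewrite derive_comp_rV; last 2 first.
- apply: rV_differentiable => k.
  exact: smooth_differentiable (transition_smooth ax ay k) Uu.
- by rewrite cmapK //; exact: smooth_differentiable (cinv_smooth i ay) yw.
by apply: eq_bigr => b _; rewrite cmapK // mulrC.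
Unshelve. all: by end_near. Qed.

Variables (r : nat) (T : cfield R n r).
Hypothesis sT : forall I, smooth_on setT (fun u => T u I).

Lemma pull_comp_smooth x I : atlas x -> smooth_on (cimg x) (fun u => pull_comp T x u I).
Proof.
move=> ax; have ox : open (cimg x) by exact: cimg_open.
apply: smooth_sum => // J _; apply: smoothM => //.
  by apply: smooth_prod => // s _; apply: smooth_derive; exact: cinv_smooth.
move=> k; apply: (@Ck_comp _ _ _ _ _ setT (cinv x) (fun u => T u J)) => //.
  by move=> i; exact: cinv_smooth.
exact: sT.
Qed.

Lemma pull_comp_change x y p J : overlap x y p ->
    pull_comp T x (cmap x p) J =
      \sum_(I : r.-tuple 'I_n)
        (\prod_(s < r) jac x y p (tnth I s) (tnth J s))
        * pull_comp T y (cmap y p) I.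
Proof.
move=> xyp; have [_ _ px py] := xyp; rewrite /pull_comp !cmapK //.
under [RHS]eq_bigr do rewrite mulr_sumr.
rewrite exchange_big /=; apply: eq_bigr => I _.
under [RHS]eq_bigr do rewrite mulrA.
rewrite -mulr_suml; congr (_ * _).
under eq_bigr do rewrite (chart_jac_chain _ _ xyp).
rewrite prod_sum_tuple; apply: eq_bigr => K _; rewrite -big_split /=.
by apply: eq_bigr => s _; rewrite mulrC.
Qed.

Definition pull_tensor : tensor_field r E :=
  TensorField pull_comp_smooth pull_comp_change.

End EuclideanTensors.

Section EuclideanMetrics.
Variables (R : realType) (n : nat).
Notation E := (euclidean R n).
Notation chartE := (chart R n E).

Lemma lorentz_congr (G J : 'M[R]_n) : lorentz_mx G -> J \in unitmx ->
  lorentz_mx (J^T *m G *m J).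
Proof.
move=> [sG [P uP PG]] uJ; split; first by rewrite !trmx_mul trmxK sG mulmxA.
have uJT : J^T \in unitmx by rewrite unitmx_tr.
exists (P *m invmx J^T); first by rewrite unitmx_mul uP unitmx_inv.
rewrite trmx_mul trmx_inv trmxK !mulmxA mulmxKV // -!mulmxA (mulmxA J).
by rewrite mulmxV // mul1mx mulmxA.
Qed.

Variable (g0 : cfield R n 2).
Hypothesis sg0 : forall I, smooth_on setT (fun u => g0 u I).
Hypothesis lg0 : forall v, lorentz_mx (mx_of g0 v).

Lemma chart_jac_unit (x : chartE) u : atlas x -> cimg x u ->
  \matrix_(i, a) chart_jac x u i a \in unitmx.
Proof.
move=> ax [p px <-].
have ov : overlap (id_chart R n : chartE) x (p : E).
  by split=> //; exact: id_chart_atlas.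
suff /mulmx1_unit[] : \matrix_(i, a) chart_jac x (cmap x p) i a *m
  \matrix_(b, a) jac (id_chart R n : chartE) x (p : E) b a = 1%:M by [].
apply/matrixP => i a; rewrite !mxE; under eq_bigr do rewrite !mxE.
rewrite -(chart_jac_chain i a ov) /chart_jac /=.
by rewrite derive_coord mxE eqxx /= eq_sym.
Qed.

Lemma pull_metric_mx (x : chartE) u :
  let J := \matrix_(i, a) chart_jac x u i a in
  mx_of (pull_comp g0 x) u = J^T *m mx_of g0 (cinv x u) *m J.
Proof.
move=> J; apply/matrixP => a b; rewrite !mxE /pull_comp sum_tuple2.
under [RHS]eq_bigr do rewrite mxE mulr_suml.
rewrite exchange_big /=; apply: eq_bigr => i _; apply: eq_bigr => j _.
rewrite !mxE big_ord_recl big_ord1 !(tnth_nth i) /=; ring.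
Qed.

Lemma pull_metric_lorentz x u : atlas x -> cimg x u ->
  lorentz_mx (mx_of (pull_tensor sg0 x) u).
Proof.
move=> ax xu; rewrite pull_metric_mx; apply: lorentz_congr => //.
exact: chart_jac_unit.
Qed.

Definition pull_metric : lorentz_metric E := LorentzMetric pull_metric_lorentz.

End EuclideanMetrics.

(** The fixed-point theorem behind [near_id_surj] asks for a complete normed module. *)
HB.instance Definition _ (R : realType) n := Complete.on 'rV[R]_n.

Lemma derive_evec (R : realType) n (f : 'rV[R]_n -> R^o) u h :
  differentiable f u -> 'D_h f u = \sum_a h 0 a * 'D_(evec R a) f u.
Proof.
move=> df; have := @derive_comp_rV _ _ _ id f u h.
move=> ->; [|by apply: rV_differentiable => i; exact: differentiable_coord|by []].
by apply: eq_bigr => a _; congr (_ * _); exact: derive_coord.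
Qed.

Lemma mulmx_norm_le (R : realType) n (A : 'M[R]_n) (h : 'rV[R]_n) :
  `|h *m A| <= (\sum_i \sum_a `|A a i|) * `|h|.
Proof.
rewrite [leLHS]/Num.norm /= mx_normrE.
apply: bigmax_le => [|[i0 i] _].
  by rewrite mulr_ge0 // sumr_ge0 // => i _; rewrite sumr_ge0.
rewrite mxE /= (le_trans (ler_norm_sum _ _ _)) //.
apply: (@le_trans _ _ ((\sum_a `|A a i|) * `|h|)); last first.
  rewrite ler_wpM2r // [leRHS](bigD1 i) //= lerDl sumr_ge0 // => j _.
  by rewrite sumr_ge0.
rewrite mulr_suml; apply: ler_sum => a _; rewrite normrM mulrC ler_wpM2l //.
rewrite [leRHS]/Num.norm /= mx_normrE ord1.
exact: (@le_bigmax _ _ _ 0 (fun i : 'I_1 * 'I_n => `|h i.1 i.2|) (0, a)).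
Qed.

(** * Global diffeomorphisms close to the identity *)

Section NearIdentity.
Variables (R : realType) (n : nat) (P : 'rV[R]_n -> 'rV[R]_n).
Hypothesis sP : forall i, smooth_on setT (fun u => P u 0 i : R^o).
Hypothesis lipP : forall u v, `|P u - P v| <= 2^-1 * `|u - v|.

Let phi u := u + P u.

(** [|u - v|] is at most [|phi u - phi v|] plus half of itself. Injectivity, the Lipschitz bound for
    the inverse and invertibility of the Jacobian all rest on this. *)
Lemma near_id_expand u v : `|u - v| <= 2 * `|phi u - phi v|.
Proof.
have -> : u - v = (phi u - phi v) - (P u - P v).
  rewrite /phi opprD addrACA addrK //.
have := lipP u v; have := ler_normB (phi u - phi v) (P u - P v).
rewrite [X in _ <= 2^-1 * `|X|](_ : _ = (phi u - phi v) - (P u - P v)); last first.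
  by rewrite /phi opprD addrACA addrK.
move: `|phi u - phi v - _| `|phi u - phi v| `|P u - P v| => a b c; lra.
Qed.

(** A preimage of [v] is a fixed point of the contraction [u |-> v - P u]. *)
Lemma near_id_surj v : exists u, phi u = v.
Proof.
pose f : 'rV[R]_n -> 'rV[R]_n := fun u => v - P u.
have fS : isFun _ _ [set: 'rV[R]_n] [set: 'rV[R]_n] f by [].
pose F : {fun [set: 'rV[R]_n] >-> [set: 'rV[R]_n]} := HB.pack f fS.
have [] := @banach_fixed_point R ('rV[R]_n : completeNormedModType R) setT F.
- exists (2^-1)%:nng; split; first by rewrite /=; lra.
  move=> [a b] _ /=; rewrite /f opprB addrC addrA subrK.
  by rewrite distrC; exact: lipP.
- exact: closedT.
- by exists 0.
- by move=> u _ E; exists u; rewrite /phi {1}E /f subrK.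
Qed.

Definition near_id_inv v := sval (cid (near_id_surj v)).
Let psi := near_id_inv.

Lemma near_id_invK : cancel psi phi.
Proof. by move=> v; rewrite /psi /near_id_inv; case: cid. Qed.

Lemma near_idK : cancel phi psi.
Proof.
move=> u; apply/eqP; rewrite -subr_eq0 -normr_le0.
by apply: le_trans (near_id_expand _ _) _; rewrite near_id_invK subrr normr0 mulr0.
Qed.

Lemma near_id_smooth i : smooth_on setT (fun u => phi u 0 i : R^o).
Proof.
apply: (@smooth_eq R 'rV[R]_n setT openT (fun u => u 0 i + P u 0 i : R^o)).
  by move=> u _; rewrite mxE.
by apply: smoothD => //; [exact: openT|exact: smooth_coord].
Qed.

Lemma near_id_differentiable u : differentiable phi u.
Proof.
by apply: rV_differentiable => i; apply: smooth_differentiable (near_id_smooth i) _.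
Qed.

Let Jac u := \matrix_(a, i) 'D_(evec R a) (fun v => phi v 0 i : R^o) u.

Lemma near_id_diff u h : 'd phi u h = h *m Jac u.
Proof.
have dphi := near_id_differentiable u.
rewrite -(deriveE h dphi); apply/rowP => i; rewrite rV_derive //.
rewrite derive_evec; last by apply: smooth_differentiable (near_id_smooth i) _.
by rewrite mxE; apply: eq_bigr => a _; rewrite mxE.
Qed.

(** Along a kernel vector of the Jacobian, [phi] would move only to higher order, against
    [near_id_expand]. *)
Lemma near_id_jac_unit u : Jac u \in unitmx.
Proof.
rewrite -row_free_unit -kermx_eq0; apply/eqP/row_matrixP => k; rewrite row0.
set h := row k _.
have hJ : h *m Jac u = 0 by rewrite -row_mul mulmx_ker row0.
(* Any tolerance below [1 / 2] would do, [1 / 2] being the expansion constant of [phi]; below, [t]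
   scales [h] to norm [r / 2], inside the ball of the estimate. *)
have e0 : 0 < 4^-1 :> R by rewrite invr_gt0.
have H := differentiable_near0 (near_id_differentiable u) e0.
apply/eqP/negPn/negP => h0; have hn : 0 < `|h| by rewrite normr_gt0.
move: H => /nbhs_ballP[r /= r0 Hr].
pose t := r / (2 * `|h|).
have t0 : 0 < t by rewrite divr_gt0 // mulr_gt0.
have thE : `|t *: h| = r / 2.
  by rewrite normrZ gtr0_norm // /t; field; rewrite gt_eqF.
have Hb : ball 0 r (t *: h).
  by rewrite -ball_normE /= sub0r normrN thE ltr_pdivrMr // ltr_pMr // ltr1n.
have := Hr _ Hb; rewrite linearZ /= near_id_diff hJ scaler0 subr0 thE => H.
have := near_id_expand (t *: h + u) u; rewrite addrK thE => H'.
move: H H'; move: `|_| => b; lra.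
Qed.

(** The increment [k] of the inverse has norm at most [2 * |h|], so the first-order error of [phi]
    at [k] is small relative to [h]; applying the inverse Jacobian [A] turns it into the error
    [k - h *m A]. *)
Lemma near_id_inv_diff v :
  differentiable psi v /\ forall h, 'd psi v h = h *m invmx (Jac (psi v)).
Proof.
set u := psi v; set A := invmx (Jac u).
pose C := 1 + \sum_i \sum_a `|A a i|.
have C0 : 0 < C by rewrite ltr_pwDl // sumr_ge0 // => i _; rewrite sumr_ge0.
have HC (h : 'rV[R]_n) : `|h *m A| <= C * `|h|.
  by apply: le_trans (mulmx_norm_le _ _) _; rewrite ler_wpM2r // lerDr.
have cA : continuous (mulmxr A : 'rV[R]_n -> 'rV[R]_n).
  move=> h; apply: rV_continuous => i; apply: differentiable_continuous.
  apply: (@smooth_differentiable _ _ setT); last by [].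
  apply: (@smooth_eq R 'rV[R]_n setT openT (fun h : 'rV[R]_n => \sum_a h 0 a * A a i : R^o)).
    by move=> z _; rewrite mxE.
  apply: smooth_sum => [|a _]; first exact: openT.
  apply: smoothM; [exact: openT|exact: smooth_coord|exact: smooth_cst].
have [||d E] := @differentiable_near0P R _ _ psi v (mulmxr A).
- exact: cA.
- move=> e e0.
  (* [C] pays for applying [A], and 2 for passing from [|k|] to [|h|]. *)
  have e'0 : 0 < e / (2 * C) by rewrite divr_gt0 // mulr_gt0.
  have /nbhs_ballP[r /= r0 Hr] := differentiable_near0 (near_id_differentiable u) e'0.
  apply/nbhs_ballP; exists (r / 2) => /=; first by rewrite divr_gt0.
  move=> h; rewrite -ball_normE /= sub0r normrN => hr.
  set k := psi (h + v) - u.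
  have kh : `|k| <= 2 * `|h|.
    apply: le_trans (near_id_expand _ _) _.
    by rewrite /u !near_id_invK addrK.
  have hE : h = phi (k + u) - phi u.
    by rewrite /k subrK /u !near_id_invK addrK.
  have kr : ball 0 r k.
    rewrite -ball_normE /= sub0r normrN; apply: le_lt_trans kh _.
    by rewrite mulrC -ltr_pdivlMr.
  have := Hr _ kr; rewrite -hE near_id_diff => H.
  have -> : k - h *m A = - ((h - k *m Jac u) *m A).
    rewrite mulmxBl opprB -mulmxA mulmxV ?mulmx1 //; exact: near_id_jac_unit.
  rewrite normrN; apply: le_trans (HC _) _.
  apply: le_trans (ler_wpM2l (ltW C0) H) _.
  apply: le_trans (_ : C * (e / (2 * C) * (2 * `|h|)) <= _).
    by rewrite ler_wpM2l ?(ltW C0) // ler_wpM2l ?(ltW e'0).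
  by rewrite le_eqVlt; apply/orP; left; apply/eqP; field; rewrite gt_eqF.
- by split=> // h; rewrite E.
Qed.

(** Bootstrap: the derivative of [psi] is the smooth function [invmx (Jac _)] composed with [psi],
    hence as regular as [psi] itself. *)
Lemma near_id_inv_smooth i : smooth_on setT (fun v => psi v 0 i : R^o).
Proof.
suff H k j : Ck k setT (fun v => psi v 0 j : R^o) by move=> k; exact: H.
elim: k j => [|k IH] j.
  move=> v _; apply: (@continuous_comp _ _ _ psi (fun u : 'rV[R]_n => u 0 j : R^o)).
    exact: differentiable_continuous (near_id_inv_diff v).1.
  exact: coord_continuous.
split=> [v _|h].
  apply: (@differentiable_comp _ _ _ _ psi (fun u : 'rV[R]_n => u 0 j : R^o)).
    exact: (near_id_inv_diff v).1.
  exact: differentiable_coord.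
apply: (@Ck_eq _ _ _ _ (fun v => \sum_a h 0 a *
    ((fun u => invmx (Jac u) a j : R^o) \o psi) v)).
- exact: openT.
- move=> v _; have [d E] := near_id_inv_diff v.
  by rewrite -rV_derive // deriveE // E mxE.
apply: Ck_sum => [|a _]; first exact: openT.
apply: CkM; [exact: openT|exact: Ck_cst|].
apply: (@Ck_comp _ _ _ _ _ setT) => //; first exact: openT.
apply: smooth_invmx => [||u _]; [exact: openT| |exact: near_id_jac_unit].
move=> b c; apply: (@smooth_eq R 'rV[R]_n setT openT
   ('D_(evec R b) (fun v => phi v 0 c : R^o))); first by move=> u _; rewrite mxE.
by apply: smooth_derive; exact: near_id_smooth.
Qed.

Definition near_id_chart : chart R n (euclidean R n) :=
  diffeo_chart near_idK near_id_invK near_id_smooth near_id_inv_smooth.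

Lemma near_id_chart_atlas : @atlas R n (euclidean R n) near_id_chart.
Proof. exact: diffeo_chart_atlas. Qed.

End NearIdentity.

(** * Jets at the origin *)

Section Jets.
Variables (R : realType) (n : nat).
Notation V := 'rV[R]_n.
Notation dd a f := ('D_(evec R a) f).

Definition jet1 (f : V -> R^o) (c : R) (l : 'I_n -> R) :=
  [/\ smooth_on setT f, f 0 = c & forall a, dd a f 0 = l a].

(** [q a b] differentiates first along [a], then along [b]. Smoothness on the whole space is
    included through [jet1], so that jets can be multiplied and composed. *)
Definition jet2 (f : V -> R^o) c l (q : 'I_n -> 'I_n -> R) :=
  jet1 f c l /\ forall a b, dd b (dd a f) 0 = q a b.

Lemma jet1_ext f f' c c' l l' : f =1 f' -> c = c' -> l =1 l' ->
  jet1 f c l -> jet1 f' c' l'.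
Proof. by move=> /funext -> -> /funext ->. Qed.

Lemma jet2_ext f f' c c' l l' q q' : f =1 f' -> c = c' -> l =1 l' -> q =2 q' ->
  jet2 f c l q -> jet2 f' c' l' q'.
Proof.
move=> /funext -> -> /funext -> qq' [j1 j2].
by split=> // a b; rewrite j2 qq'.
Qed.

Lemma derive_cst_at (c : R) u v : 'D_v (fun=> c : R^o) (u : V) = 0.
Proof. exact: derive_cst. Qed.

Lemma derive_add_at (f h : V -> R^o) u v : smooth_on setT f -> smooth_on setT h ->
  'D_v (fun u => f u + h u) u = 'D_v f u + 'D_v h u.
Proof. by move=> sf sh; apply: deriveD; exact: smooth_derivable. Qed.

Lemma derive_mul_at (f h : V -> R^o) u v : smooth_on setT f -> smooth_on setT h ->
  'D_v (fun u => f u * h u : R^o) u = 'D_v f u * h u + f u * 'D_v h u.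
Proof.
move=> sf sh; apply: is_derive_val.
by apply: is_derive_mul; apply: is_derive_of_derivable; exact: smooth_derivable.
Qed.

Lemma derive_sum_at (I : Type) (r : seq I) (F : I -> V -> R^o) u v :
  (forall i, smooth_on setT (F i)) ->
  'D_v (fun u => \sum_(i <- r) F i u) u = \sum_(i <- r) 'D_v (F i) u.
Proof.
move=> sF; apply: is_derive_val; apply: is_derive_fsum => i.
by apply: is_derive_of_derivable; exact: smooth_derivable.
Qed.

Lemma jet1_cst c : jet1 (fun=> c) c (fun=> 0).
Proof. by split=> [| |a]; [exact: smooth_cst|by []|exact: derive_cst_at]. Qed.

Lemma jet1_mul f h c c' l l' : jet1 f c l -> jet1 h c' l' ->
  jet1 (fun u => f u * h u : R^o) (c * c') (fun a => l a * c' + c * l' a).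
Proof.
move=> [sf f0 df] [sh h0 dh]; split=> [| |a].
- by apply: smoothM => //; exact: openT.
- by rewrite f0 h0.
- by rewrite derive_mul_at // f0 h0 df dh.
Qed.

Lemma jet1_add f h c c' l l' : jet1 f c l -> jet1 h c' l' ->
  jet1 (fun u => f u + h u) (c + c') (fun a => l a + l' a).
Proof.
move=> [sf f0 df] [sh h0 dh]; split=> [| |a].
- by apply: smoothD => //; exact: openT.
- by rewrite f0 h0.
- by rewrite derive_add_at // df dh.
Qed.

Lemma jet1_sum (I : finType) (F : I -> V -> R^o) c l :
  (forall i, jet1 (F i) (c i) (l i)) ->
  jet1 (fun u => \sum_i F i u) (\sum_i c i) (fun a => \sum_i l i a).
Proof.
move=> H; have sF i : smooth_on setT (F i) by have [] := H i.
split=> [| |a].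
- by apply: smooth_sum => //; exact: openT.
- by apply: eq_bigr => i _; have [] := H i.
- by rewrite derive_sum_at //; apply: eq_bigr => i _; have [] := H i.
Qed.

(** Reduces second-order data to first-order data of an explicit gradient [df]. *)
Lemma jet2I f c l q (df : 'I_n -> V -> R^o) :
  smooth_on setT f -> f 0 = c -> (forall a u, dd a f u = df a u) ->
  (forall a, jet1 (df a) (l a) (q a)) -> jet2 f c l q.
Proof.
move=> sf f0 dfE H.
have E a : dd a f = df a by apply/funext => u; exact: dfE.
split=> [|a b]; last by rewrite E; have [] := H a.
by split=> // a; rewrite dfE; have [] := H a.
Qed.

Lemma jet2_derive f c l q a : jet2 f c l q -> jet1 (dd a f) (l a) (q a).
Proof.
by move=> [[sf _ H1] H2]; split=> [| |b]; [exact: smooth_derive|exact: H1|exact: H2].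
Qed.

Lemma jet2_cst c : jet2 (fun=> c) c (fun=> 0) (fun _ _ => 0).
Proof.
apply: (jet2I (df := fun _ _ => 0)) => //; first exact: smooth_cst.
  by move=> a u; exact: derive_cst_at.
by move=> a; exact: jet1_cst.
Qed.

Lemma jet2_mul f h c c' l l' q q' : jet2 f c l q -> jet2 h c' l' q' ->
  jet2 (fun u => f u * h u : R^o) (c * c') (fun a => l a * c' + c * l' a)
    (fun a b => q a b * c' + l a * l' b + l b * l' a + c * q' a b).
Proof.
move=> j j'; have [j1 _] := j; have [j1' _] := j'.
have [sf f0 df] := j1; have [sh h0 dh] := j1'.
apply: (jet2I (df := fun a u => dd a f u * h u + f u * dd a h u)).
- by apply: smoothM => //; exact: openT.
- by rewrite f0 h0.
- by move=> a u; exact: derive_mul_at.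
move=> a; apply: jet1_ext (jet1_add (jet1_mul (jet2_derive a j) j1')
  (jet1_mul j1 (jet2_derive a j'))) => // b; ring.
Qed.

Lemma jet2_add f h c c' l l' q q' : jet2 f c l q -> jet2 h c' l' q' ->
  jet2 (fun u => f u + h u) (c + c') (fun a => l a + l' a)
    (fun a b => q a b + q' a b).
Proof.
move=> j j'; have [j1 _] := j; have [j1' _] := j'.
have [sf f0 df] := j1; have [sh h0 dh] := j1'.
apply: (jet2I (df := fun a u => dd a f u + dd a h u)).
- by apply: smoothD => //; exact: openT.
- by rewrite f0 h0.
- by move=> a u; exact: derive_add_at.
by move=> a; exact: jet1_add (jet2_derive a j) (jet2_derive a j').
Qed.

Lemma jet2_sum (I : finType) (F : I -> V -> R^o) c l q :
  (forall i, jet2 (F i) (c i) (l i) (q i)) ->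
  jet2 (fun u => \sum_i F i u) (\sum_i c i) (fun a => \sum_i l i a)
    (fun a b => \sum_i q i a b).
Proof.
move=> H; have sF i : smooth_on setT (F i) by have [[]] := H i.
apply: (jet2I (df := fun a u => \sum_i dd a (F i) u)).
- by apply: smooth_sum => //; exact: openT.
- by apply: eq_bigr => i _; have [[]] := H i.
- by move=> a u; exact: derive_sum_at.
by move=> a; apply: jet1_sum => i; exact: jet2_derive.
Qed.

Lemma jet1_coord i : jet1 (fun u => u 0 i) 0 (fun a => (i == a)%:R).
Proof.
split=> [| |a]; [exact: smooth_coord|by rewrite mxE|].
by rewrite derive_coord mxE eqxx.
Qed.

Section JetComp.
Variables (phi : V -> V) (j : 'I_n -> 'I_n -> R) (p : 'I_n -> 'I_n -> 'I_n -> R).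
Hypothesis phi0 : phi 0 = 0.
Hypothesis sphi : forall i, smooth_on setT (fun u => phi u 0 i : R^o).
Hypothesis jphi : forall i a,
  jet1 (dd a (fun u => phi u 0 i : R^o)) (j i a) (p i a).

Lemma derive_comp_at (f : V -> R^o) a u : smooth_on setT f ->
  dd a (fun u => f (phi u)) u =
    \sum_i dd a (fun u => phi u 0 i : R^o) u * dd i f (phi u).
Proof.
move=> sf; apply: (@derive_comp_rV _ _ _ phi f).
  by apply: rV_differentiable => i; exact: smooth_differentiable (sphi i) _.
exact: smooth_differentiable sf _.
Qed.

Lemma smooth_comp (f : V -> R^o) : smooth_on setT f ->
  smooth_on setT (fun u => f (phi u)).
Proof.
move=> sf k; apply: (@Ck_comp _ _ _ _ setT setT phi f) => //; first exact: openT.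
by move=> i; exact: sphi.
Qed.

Lemma jet1_comp f c l : jet1 f c l ->
  jet1 (fun u => f (phi u)) c (fun a => \sum_i j i a * l i).
Proof.
move=> [sf f0 df]; split=> [| |a]; [exact: smooth_comp|by rewrite phi0|].
rewrite derive_comp_at //; apply: eq_bigr => i _.
by have [_ -> _] := jphi i a; rewrite phi0 df.
Qed.

Lemma jet2_comp f c l q : jet2 f c l q ->
  jet2 (fun u => f (phi u)) c (fun a => \sum_i j i a * l i)
    (fun a b => \sum_i (p i a b * l i + j i a * \sum_k j k b * q i k)).
Proof.
move=> jf; have [[sf f0 df] _] := jf.
apply: (jet2I (df := fun a u =>
    \sum_i dd a (fun u => phi u 0 i : R^o) u * dd i f (phi u))) => //.
- exact: smooth_comp.
- by rewrite phi0.
- by move=> a u; exact: derive_comp_at.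
move=> a; apply: jet1_sum => i.
exact: jet1_mul (jphi i a) (jet1_comp (jet2_derive i jf)).
Qed.

End JetComp.

(** * Bounded substitutes for the coordinate functions *)

Section Cutoff.
Variable e : R.
Hypothesis e0 : 0 < e.

(* A bounded substitute for the coordinate function [u_i], with the same
   derivatives of order at most 2 at the origin. *)
Definition cutoff (i : 'I_n) (u : V) : R^o := e * sin (e^-1 * u 0 i).

(** The derivative of [cutoff i] in its own coordinate direction. *)
Definition cutoff' (i : 'I_n) (u : V) : R^o := cos (e^-1 * u 0 i).

Lemma is_derive_comp1 (h : R -> R) (dh : R) (i : 'I_n) (u v : V) :
  is_derive (e^-1 * u 0 i) 1 h dh ->
  is_derive u v (fun u : V => h (e^-1 * u 0 i) : R^o) (e^-1 * v 0 i * dh : R^o).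
Proof.
move=> [dv hE].
have dh' : differentiable (h : R -> R^o) (e^-1 * u 0 i) by apply/derivable1_diffP.
have dc : differentiable (fun u : V => e^-1 * u 0 i : R^o) u.
  apply: (@smooth_differentiable _ _ setT) => //.
  by apply: smoothM; [exact: openT|exact: smooth_cst|exact: smooth_coord].
have dcomp : differentiable ((h : R -> R^o) \o (fun u : V => e^-1 * u 0 i : R^o)) u.
  exact: differentiable_comp.
apply: DeriveDef; first exact: diff_derivable.
rewrite (deriveE v dcomp) diff_comp //=.
have -> : 'd (fun u : V => e^-1 * u 0 i : R^o) u v = e^-1 * v 0 i.
  rewrite -deriveE // derive_mul_at; [|exact: smooth_cst|exact: smooth_coord].
  by rewrite derive_cst_at mul0r add0r derive_coord.
rewrite -[X in 'd _ _ X]mulr1 -[X in 'd _ _ X]/(_ *: (1 : R^o)) linearZ /=.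
by rewrite -(deriveE (1 : R) dh') hE.
Qed.

Lemma derive_cutoff_at i u v : 'D_v (cutoff i) u = v 0 i * cutoff' i u.
Proof.
apply: is_derive_val.
apply: is_derive_congr (is_derive_mul (is_derive_cst (e : R^o) u v)
  (is_derive_comp1 v (is_derive_sin _))) => //.
by rewrite mul0r add0r /cst /cutoff' mulrA mulrA mulfV ?gt_eqF // mul1r.
Qed.

Lemma derive_cutoff'_at i u v :
  'D_v (cutoff' i) u = - (e^-1 ^+ 2 * v 0 i) * cutoff i u.
Proof.
apply: is_derive_val.
apply: is_derive_congr (is_derive_comp1 v (is_derive_cos _)) => //.
by rewrite /cutoff; field; rewrite gt_eqF.
Qed.

Lemma cutoff_differentiable i u :
  differentiable (cutoff i) u /\ differentiable (cutoff' i) u.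
Proof.
have dl : differentiable (fun u : V => e^-1 * u 0 i : R^o) u.
  apply: (@smooth_differentiable _ _ setT) => //.
  by apply: smoothM; [exact: openT|exact: smooth_cst|exact: smooth_coord].
have ds (x : R) : differentiable (sin : R -> R^o) x.
  exact/derivable1_diffP/derivable_sin.
have dc (x : R) : differentiable (cos : R -> R^o) x.
  exact/derivable1_diffP/derivable_cos.
have dsl : differentiable ((sin : R -> R^o) \o (fun u : V => e^-1 * u 0 i : R^o)) u.
  exact: differentiable_comp.
have dcl : differentiable ((cos : R -> R^o) \o (fun u : V => e^-1 * u 0 i : R^o)) u.
  exact: differentiable_comp.
by split=> //; apply: differentiableM => //; exact: differentiable_cst.
Qed.

(** Each of the two functions has the other as derivative up to a constant factor, so the induction
    treats both at once. *)
Lemma cutoff_smooth i : smooth_on setT (cutoff i) /\ smooth_on setT (cutoff' i).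
Proof.
have H k : Ck k setT (cutoff i) /\ Ck k setT (cutoff' i).
  elim: k => [|k [IH IH']].
    by split=> u _; apply: differentiable_continuous; have [] := cutoff_differentiable i u.
  split; split=> [u _|v]; try by have [] := cutoff_differentiable i u.
    apply: Ck_eq (CkZ (v 0 i) openT IH') => [|u _]; first exact: openT.
    by rewrite derive_cutoff_at.
  apply: Ck_eq (CkZ (- (e^-1 ^+ 2 * v 0 i)) openT IH) => [|u _]; first exact: openT.
  by rewrite derive_cutoff'_at.
by split=> k; have [] := H k.
Qed.

Lemma cutoff0 i : cutoff i 0 = 0.
Proof. by rewrite /cutoff mxE mulr0 sin0 mulr0. Qed.

Lemma cutoff'0 i : cutoff' i 0 = 1.
Proof. by rewrite /cutoff' mxE mulr0 cos0. Qed.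

Lemma jet1_cutoff i : jet1 (cutoff i) 0 (fun a => (i == a)%:R).
Proof.
have [s _] := cutoff_smooth i; split=> // [|a]; first exact: cutoff0.
by rewrite derive_cutoff_at cutoff'0 mulr1 mxE eqxx.
Qed.

Lemma jet1_cutoff' i : jet1 (cutoff' i) 1 (fun=> 0).
Proof.
have [_ s] := cutoff_smooth i; split=> // [|a]; first exact: cutoff'0.
by rewrite derive_cutoff'_at cutoff0 mulr0.
Qed.

Lemma jet2_cutoff i : jet2 (cutoff i) 0 (fun a => (i == a)%:R) (fun _ _ => 0).
Proof.
have [s _] := cutoff_smooth i.
apply: (jet2I (df := fun a u => (evec R a) 0 i * cutoff' i u)) => //.
- exact: cutoff0.
- by move=> a u; rewrite derive_cutoff_at.
move=> a; apply: jet1_ext (jet1_mul (jet1_cst _) (jet1_cutoff' i)) => //.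
  by rewrite mulr1 mxE eqxx.
by move=> b; rewrite mul0r mulr0 addr0.
Qed.

Lemma jet2_cutoff' i : jet2 (cutoff' i) 1 (fun=> 0)
  (fun a b => - (e^-1 ^+ 2 * (i == a)%:R) * (i == b)%:R).
Proof.
have [_ s] := cutoff_smooth i.
apply: (jet2I (df := fun a u => - (e^-1 ^+ 2 * (evec R a) 0 i) * cutoff i u)) => //.
- exact: cutoff'0.
- by move=> a u; rewrite derive_cutoff'_at.
move=> a; apply: jet1_ext (jet1_mul (jet1_cst _) (jet1_cutoff i)) => //.
  by rewrite mulr0.
by move=> b; rewrite mul0r add0r mxE eqxx.
Qed.

Lemma cutoff_bound i u : `|cutoff i u| <= e.
Proof. by rewrite normrM gtr0_norm // ler_piMr ?(ltW e0) // sin_max. Qed.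

Lemma sin_lipschitz (a b : R) : `|sin a - sin b| <= `|a - b|.
Proof.
wlog ab : a b / b <= a => [H|].
  by have [/H //|/ltW/H] := leP b a; rewrite distrC [`|b - a|]distrC.
have [|c _ ->] := MVT_segment ab (fun x _ => is_derive_sin x).
  by apply: continuous_subspaceT => x; exact: continuous_sin.
by rewrite normrM ler_piMl // cos_max.
Qed.

Lemma cutoff_lipschitz i u v : `|cutoff i u - cutoff i v| <= `|u - v|.
Proof.
rewrite -mulrBr normrM gtr0_norm //.
apply: le_trans (ler_wpM2l (ltW e0) (sin_lipschitz _ _)) _.
rewrite -mulrBr normrM (gtr0_norm (_ : 0 < e^-1)) ?invr_gt0 // mulrA.
rewrite mulfV ?gt_eqF // mul1r [leRHS]/Num.norm /= mx_normrE.
have := @le_bigmax _ _ _ 0 (fun i : 'I_1 * 'I_n => `|(u - v) i.1 i.2|) (0, i).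
by rewrite /= !mxE.
Qed.

End Cutoff.

End Jets.

(** * The equations satisfied by L *)

Section JetFunction.
Variables (R : realType) (n : nat).
Notation T2 := ('I_n -> 'I_n -> R).
Notation T3 := ('I_n -> 'I_n -> 'I_n -> R).
Notation T4 := ('I_n -> 'I_n -> 'I_n -> 'I_n -> R).
Notation V := 'rV[R]_n.
Notation dd a f := ('D_(evec R a) f).

Definition uncurry3 (A : T3) (I : 3.-tuple 'I_n) : R :=
  A (tnth I 0) (tnth I 1) (tnth I 2).

Definition uncurry4 (B : T4) (I : 4.-tuple 'I_n) : R :=
  B (tnth I 0) (tnth I 1) (tnth I 2) (tnth I 3).

Lemma uncurry3K (T : 3.-tuple 'I_n -> R) :
  uncurry3 (fun a b c => T [tuple a; b; c]) = T.
Proof. by apply/funext => I; rewrite /uncurry3 -tuple3_eta. Qed.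

Lemma uncurry4K (T : 4.-tuple 'I_n -> R) :
  uncurry4 (fun a b c d => T [tuple a; b; c; d]) = T.
Proof. by apply/funext => I; rewrite /uncurry4 -tuple4_eta. Qed.

Lemma uncurry3E (A : T3) a b c : uncurry3 A [tuple a; b; c] = A a b c.
Proof. by rewrite /uncurry3 !(tnth_nth a). Qed.

Lemma uncurry4E (B : T4) a b c d : uncurry4 B [tuple a; b; c; d] = B a b c d.
Proof. by rewrite /uncurry4 !(tnth_nth a). Qed.

(* Christoffel symbols with lowered last index, and their derivatives, in terms
   of [A a b c = g_{ab,c}] and [B a b c d = g_{ab,cd}]. *)
Definition chr (A : T3) : T3 := fun a b c => 2^-1 * (A b c a + A a c b - A a b c).

Definition dchr (B : T4) : T4 :=
  fun a b c d => 2^-1 * (B b c a d + B a c b d - B a b c d).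

(* The jet of [(g, nabla)] in terms of the difference tensor [D] and its partial
   derivatives [E]. *)
Definition jetF (G : 'M[R]_n) (A : T3) (B : T4) (D : T3) (E : T4) : jet_space R n :=
  (G, to_tensor (uncurry3 A), to_tensor (uncurry4 B),
   to_tensor (uncurry3 (fun a b c => chr A a b c + D a b c)),
   to_tensor (uncurry4 (fun a b c d => dchr B a b c d + E a b c d))).

(** A jet sees only the value and the first derivatives of [Gam] at [u], so its decomposition is
    assumed to that order; this covers coefficients known only near [u]. *)
Lemma jetFE (g : cfield R n 2) (D Gam : cfield R n 3) u :
  (forall I, Gam u I = lc_low g u (tnth I 0) (tnth I 1) (tnth I 2) + D u I) ->
  (forall I c, dd c (fun v => Gam v I) u =
     dd c (fun v => lc_low g v (tnth I 0) (tnth I 1) (tnth I 2) + D v I) u) ->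
  (forall a b c d, derivable (dd c (fun v => g v [tuple a; b])) u (evec R d)) ->
  (forall I d, derivable (fun v => D v I) u (evec R d)) ->
  jet g Gam u = jetF (mx_of g u)
    (fun a b c => dd c (fun v => g v [tuple a; b]) u)
    (fun a b c d => dd d (dd c (fun v => g v [tuple a; b])) u)
    (fun a b c => D u [tuple a; b; c])
    (fun a b c d => dd d (fun v => D v [tuple a; b; c]) u).
Proof.
move=> GE dGE dg dD; rewrite /jet /jetF.
have E1 : partial g u = uncurry3 (fun a b c => dd c (fun v => g v [tuple a; b]) u).
  by rewrite -[LHS]uncurry3K; apply/funext => I; rewrite /uncurry3 partial3E.
have E2 : partial (partial g) u =
    uncurry4 (fun a b c d => dd d (dd c (fun v => g v [tuple a; b])) u).
  by rewrite -[LHS]uncurry4K; apply/funext => I; rewrite /uncurry4 partial_partialE.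
rewrite E1 E2; congr (_, _, _, to_tensor _, to_tensor _).
  apply/funext => I; rewrite GE [in D u I](tuple3_eta I) /uncurry3 /lc_low E1.
  by rewrite !uncurry3E.
rewrite -[LHS]uncurry4K; apply/funext => I; rewrite /uncurry4 partial4E dGE.
set a := tnth I 0; set b := tnth I 1; set c := tnth I 2; set d := tnth I 3.
rewrite !(tnth_nth a) /=.
have pE x y z : (fun v => partial g v [tuple x; y; z]) = dd z (fun v => g v [tuple x; y]).
  by apply/funext => v; rewrite partial3E.
have dp x y z : derivable (fun v => partial g v [tuple x; y; z]) u (evec R d).
  by rewrite pE.
apply: is_derive_val.
have ip x y z : is_derive u (evec R d) (fun v => partial g v [tuple x; y; z])
    (dd d (dd z (fun v => g v [tuple x; y])) u).
  by rewrite -pE; exact: is_derive_of_derivable.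
apply: is_derive_congr (is_deriveD (is_derive_mul (is_derive_cst (2^-1 : R^o) u (evec R d))
   (is_deriveB (is_deriveD (ip b c a) (ip a c b)) (ip a b c)))
   (is_derive_of_derivable (dD [tuple a; b; c] d))) => //.
by rewrite mul0r add0r.
Qed.

End JetFunction.

Section FunctionalEquation.
Variables (R : realType) (n : nat) (L : jet_space R n -> R^o).
Hypothesis L_inv : forall (M : manifold R n) (g : lorentz_metric M)
   (nabla : connection M), exists f : M -> R, represents L g nabla f.
Notation T2 := ('I_n -> 'I_n -> R).
Notation T3 := ('I_n -> 'I_n -> 'I_n -> R).
Notation T4 := ('I_n -> 'I_n -> 'I_n -> 'I_n -> R).
Notation dd a f := ('D_(evec R a) f).
Notation chartE := (chart R n (euclidean R n)).

Definition F (G : 'M[R]_n) (A : T3) (B : T4) (D : T3) (E : T4) : R :=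
  L (jetF G A B D E).

Lemma jet_lcD (M : manifold R n) (g : lorentz_metric M) (D : tensor_field 3 M) x u :
  atlas x -> cimg x u ->
  L (jet (g x) (lcD_low g D x) u) = F (mx_of (g x) u)
    (fun a b c => dd c (fun v => g x v [tuple a; b]) u)
    (fun a b c d => dd d (dd c (fun v => g x v [tuple a; b])) u)
    (fun a b c => D x u [tuple a; b; c])
    (fun a b c d => dd d (fun v => D x v [tuple a; b; c]) u).
Proof.
move=> ax xu; congr L; apply: jetFE => // [a b c d|I d].
  exact: smooth_derivable (smooth_derive _ (tcomp_smooth g _ ax)) xu.
exact: smooth_derivable (tcomp_smooth D _ ax) xu.
Qed.

(** [j], [p], [t] are the derivatives of order one, two and three at 0 of [cinv x], the map along
    which fields given in the identity chart are pulled back. *)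
Record chart_jets (x : chartE) (j : T2) (p : T3) (t : T4) : Prop := ChartJets {
  cj_atlas : atlas x;
  cj_dom : cdom x = setT;
  cj_img : cimg x = setT;
  cj_map0 : cmap x 0 = 0;
  cj_inv0 : cinv x 0 = 0;
  cj_jet : forall i a, jet2 (dd a (fun v => cinv x v 0 i : R^o)) (j i a) (p i a) (t i a)
}.

Definition delta : T2 := fun i a => (i == a)%:R.

Lemma id_chart_jets :
  chart_jets (id_chart R n) delta (fun _ _ _ => 0) (fun _ _ _ _ => 0).
Proof.
split=> //; first exact: id_chart_atlas.
  by apply/seteqP; split=> // u _; exists u.
move=> i a; have -> : dd a (fun v => cinv (id_chart R n : chartE) v 0 i : R^o) =
    (fun=> delta i a).
  by apply/funext => u; rewrite derive_coord mxE eqxx.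
exact: jet2_cst.
Qed.

Section PullJets.
Variables (g0 : cfield R n 2) (D0 : cfield R n 3).
Hypothesis sg0 : forall I, smooth_on setT (fun u => g0 u I).
Hypothesis lg0 : forall v, lorentz_mx (mx_of g0 v).
Hypothesis sD0 : forall I, smooth_on setT (fun u => D0 u I).
Variables (G : 'M[R]_n) (B : T4) (D : T3) (E : T4).
Hypothesis jg0 : forall i j, jet2 (fun v => g0 v [tuple i; j]) (G i j) (fun=> 0) (B i j).
Hypothesis jD0 : forall i j k, jet1 (fun v => D0 v [tuple i; j; k]) (D i j k) (E i j k).
Variables (x : chartE) (j : T2) (p : T3) (t : T4).
Hypothesis xj : chart_jets x j p t.

Lemma cj_smooth i : smooth_on setT (fun v => cinv x v 0 i : R^o).
Proof. by rewrite -(cj_img xj); apply: cinv_smooth; exact: cj_atlas xj. Qed.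

(** The first derivatives of [g0] vanish at the origin, so the second derivatives of the pullback
    contain no products of them with derivatives of the chart. *)
Lemma pull_metric_jet a b :
  jet2 (fun v => pull_comp g0 x v [tuple a; b])
    (\sum_i \sum_k j i a * j k b * G i k)
    (fun c => \sum_i \sum_k (p i a c * j k b + j i a * p k b c) * G i k)
    (fun c d => \sum_i \sum_k
       ((t i a c d * j k b + p i a c * p k b d + p i a d * p k b c + j i a * t k b c d)
          * G i k
        + j i a * j k b * \sum_l \sum_m j l c * j m d * B i k l m)).
Proof.
have j1 i a' : jet1 (dd a' (fun v => cinv x v 0 i : R^o)) (j i a') (p i a').
  by have [] := cj_jet xj i a'.
have jc i k : jet2 (fun v => g0 (cinv x v) [tuple i; k]) (G i k) (fun=> 0)
    (fun c d => \sum_l \sum_m j l c * j m d * B i k l m).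
  apply: jet2_ext (jet2_comp (cj_inv0 xj) cj_smooth j1 (jg0 i k)) => //.
    by move=> c; rewrite big1 // => l _; rewrite mulr0.
  move=> c d; apply: eq_bigr => l _; rewrite mulr0 add0r mulr_sumr.
  by apply: eq_bigr => m _; rewrite mulrA.
apply: jet2_ext (jet2_sum (fun i => jet2_sum (fun k =>
  jet2_mul (jet2_mul (cj_jet xj i a) (cj_jet xj k b)) (jc i k)))) => //.
- move=> v; rewrite /pull_comp sum_tuple2; apply: eq_bigr => i _.
  apply: eq_bigr => k _; rewrite big_ord_recl big_ord1 !(tnth_nth i) /=.
  by rewrite /chart_jac.
- by move=> c; apply: eq_bigr => i _; apply: eq_bigr => k _; rewrite mulr0 addr0.
- move=> c d; apply: eq_bigr => i _; apply: eq_bigr => k _.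
  by rewrite !mulr0 !addr0.
Qed.

Lemma pull_D_jet a b c :
  jet1 (fun v => pull_comp D0 x v [tuple a; b; c])
    (\sum_i \sum_k \sum_l j i a * j k b * j l c * D i k l)
    (fun d => \sum_i \sum_k \sum_l
       (((p i a d * j k b + j i a * p k b d) * j l c + j i a * j k b * p l c d) * D i k l
        + j i a * j k b * j l c * \sum_m j m d * E i k l m)).
Proof.
have j1 i a' : jet1 (dd a' (fun v => cinv x v 0 i : R^o)) (j i a') (p i a').
  by have [] := cj_jet xj i a'.
apply: jet1_ext (jet1_sum (fun i => jet1_sum (fun k => jet1_sum (fun l =>
  jet1_mul (jet1_mul (jet1_mul (j1 i a) (j1 k b)) (j1 l c))
    (jet1_comp (cj_inv0 xj) cj_smooth j1 (jD0 i k l)))))) => //.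
move=> v; rewrite /pull_comp sum_tuple3; apply: eq_bigr => i _.
apply: eq_bigr => k _; apply: eq_bigr => l _.
rewrite 2!big_ord_recl big_ord1 !(tnth_nth i) /= mulrA.
by rewrite /chart_jac.
Qed.

Lemma pull_jet :
  L (jet (pull_metric sg0 lg0 x) (lcD_low (pull_metric sg0 lg0) (pull_tensor sD0) x) 0)
  = F (\matrix_(a, b) \sum_i \sum_k j i a * j k b * G i k)
    (fun a b c => \sum_i \sum_k (p i a c * j k b + j i a * p k b c) * G i k)
    (fun a b c d => \sum_i \sum_k
       ((t i a c d * j k b + p i a c * p k b d + p i a d * p k b c + j i a * t k b c d)
          * G i k
        + j i a * j k b * \sum_l \sum_m j l c * j m d * B i k l m))
    (fun a b c => \sum_i \sum_k \sum_l j i a * j k b * j l c * D i k l)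
    (fun a b c d => \sum_i \sum_k \sum_l
       (((p i a d * j k b + j i a * p k b d) * j l c + j i a * j k b * p l c d) * D i k l
        + j i a * j k b * j l c * \sum_m j m d * E i k l m)).
Proof.
rewrite jet_lcD; [|exact: cj_atlas xj|by rewrite (cj_img xj)].
congr F.
- by apply/matrixP => a b; rewrite !mxE; have [[_ H _] _] := pull_metric_jet a b; exact: H.
- apply/funext => a; apply/funext => b; apply/funext => c.
  by have [[_ _ H] _] := pull_metric_jet a b; exact: H.
- apply/funext => a; apply/funext => b; apply/funext => c; apply/funext => d.
  by have [_ H] := pull_metric_jet a b; exact: H.
- apply/funext => a; apply/funext => b; apply/funext => c.
  by have [_ H _] := pull_D_jet a b c; exact: H.
- apply/funext => a; apply/funext => b; apply/funext => c; apply/funext => d.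
  by have [_ _ H] := pull_D_jet a b c; exact: H.
Qed.

End PullJets.

Lemma sum_delta (f : 'I_n -> R) a : \sum_i delta i a * f i = f a.
Proof.
rewrite (bigD1 a) //= /delta eqxx mul1r big1 ?addr0 // => i ia.
by rewrite (negbTE ia) mul0r.
Qed.

Lemma sum_delta2 (f : 'I_n -> 'I_n -> R) a b :
  \sum_i \sum_k delta i a * delta k b * f i k = f a b.
Proof.
under eq_bigr do under eq_bigr do rewrite -mulrA.
under eq_bigr do rewrite -mulr_sumr sum_delta.
exact: sum_delta.
Qed.

Lemma sum_delta3 (f : 'I_n -> 'I_n -> 'I_n -> R) a b c :
  \sum_i \sum_k \sum_l delta i a * delta k b * delta l c * f i k l = f a b c.
Proof.
transitivity (\sum_i \sum_k delta i a * delta k b * f i k c).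
  apply: eq_bigr => i _; apply: eq_bigr => k _.
  by under eq_bigr do rewrite -mulrA; rewrite -mulr_sumr sum_delta.
exact: sum_delta2.
Qed.

End FunctionalEquation.

(** * Charts with prescribed derivatives at the origin *)

Section ModelFields.
Variables (R : realType) (n : nat).
Notation T2 := ('I_n -> 'I_n -> R).
Notation T3 := ('I_n -> 'I_n -> 'I_n -> R).
Notation T4 := ('I_n -> 'I_n -> 'I_n -> 'I_n -> R).
Notation V := 'rV[R]_n.
Notation delta := (@delta R n).
Notation dd a f := ('D_(evec R a) f).
Notation chartE := (chart R n (euclidean R n)).

Lemma cutoff_prod2 (e : R) (e0 : 0 < e) a b (u v : V) :
  `|cutoff e a u * cutoff e b u - cutoff e a v * cutoff e b v| <= 2 * e * `|u - v|.
Proof.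
have := cutoff_lipschitz e0 a u v; have := cutoff_lipschitz e0 b u v.
have := cutoff_bound e0 a v; have := cutoff_bound e0 b u.
move: (cutoff e a u) (cutoff e b u) (cutoff e a v) (cutoff e b v) => x y x' y'.
move: `|u - v| => d H1 H2 H3 H4.
have -> : x * y - x' * y' = (x - x') * y + x' * (y - y') by ring.
apply: le_trans (ler_normD _ _) _; rewrite !normrM.
have := ler_pM (normr_ge0 _) (normr_ge0 _) H4 H1.
have := ler_pM (normr_ge0 _) (normr_ge0 _) H2 H3.
lra.
Qed.

Lemma cutoff_prod3 (e : R) (e0 : 0 < e) a b c (u v : V) :
  `|cutoff e a u * cutoff e b u * cutoff e c u
    - cutoff e a v * cutoff e b v * cutoff e c v| <= 3 * e ^+ 2 * `|u - v|.
Proof.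
have := cutoff_prod2 e0 a b u v; have := cutoff_lipschitz e0 c u v.
have := cutoff_bound e0 a v; have := cutoff_bound e0 b v; have := cutoff_bound e0 c u.
move: (cutoff e a u * cutoff e b u) (cutoff e c u) => x y.
move: (cutoff e a v) (cutoff e b v) (cutoff e c v) => z z' y'.
move: `|u - v| => d H1 H2 H3 H4 H5.
have -> : x * y - z * z' * y' = (x - z * z') * y + z * z' * (y - y') by ring.
apply: le_trans (ler_normD _ _) _; rewrite !normrM.
have := ler_pM (normr_ge0 _) (normr_ge0 _) H5 H1.
have := ler_pM (mulr_ge0 (normr_ge0 _) (normr_ge0 _)) (normr_ge0 _)
  (ler_pM (normr_ge0 _) (normr_ge0 _) H3 H2) H4.
rewrite expr2; lra.
Qed.

Section NearIdModel.
Variables (e : R) (p : T3) (t : T4).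
Hypothesis e0 : 0 < e.
Hypothesis pS : forall i a b, p i a b = p i b a.
Hypothesis tS1 : forall i a b c, t i a b c = t i b a c.
Hypothesis tS2 : forall i a b c, t i a b c = t i a c b.
Let s := @cutoff R n e.
Let s' := @cutoff' R n e.

(** The quadratic and cubic Taylor terms, evaluated at the bounded functions [s a]. *)
Definition near_id_poly (u : V) : V := \row_m
  (2^-1 * (\sum_a \sum_b p m a b * (s a u * s b u))
   + 6^-1 * (\sum_a \sum_b \sum_c t m a b c * (s a u * s b u * s c u))).

Let Cp := \sum_m \sum_a \sum_b `|p m a b|.
Let Ct := \sum_m \sum_a \sum_b \sum_c `|t m a b c|.
Hypothesis eC : e * (Cp + Ct) <= 2^-1.
Hypothesis e1 : e <= 1.

(** Products of two or three cutoffs have Lipschitz constants [2 * e] and [3 * e ^+ 2], so [eC]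
    brings the total down to [1 / 2]. *)
Lemma near_id_poly_lipschitz u v :
  `|near_id_poly u - near_id_poly v| <= 2^-1 * `|u - v|.
Proof.
rewrite [leLHS]/Num.norm /= mx_normrE.
apply: bigmax_le => [|[i0 m] _]; first by rewrite mulr_ge0.
rewrite !mxE /=; set d := `|u - v|; have d0 : 0 <= d by rewrite normr_ge0.
set X := \sum_a _; set Y := \sum_a _; set X' := \sum_a _; set Y' := \sum_a _.
have HX : `|X - X'| <= 2 * e * d * Cp.
  rewrite /X /X' -sumrB (le_trans (ler_norm_sum _ _ _)) //.
  apply: (@le_trans _ _ (\sum_a \sum_b 2 * e * d * `|p m a b|)).
    apply: ler_sum => a _; rewrite -sumrB (le_trans (ler_norm_sum _ _ _)) //.
    apply: ler_sum => b _; rewrite -mulrBr normrM mulrC ler_wpM2r //.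
    exact: cutoff_prod2.
  under eq_bigr do rewrite -mulr_sumr.
  rewrite -mulr_sumr ler_wpM2l //; first by rewrite !mulr_ge0 // ltW.
  rewrite /Cp [leRHS](bigD1 m) //= lerDl sumr_ge0 // => k _.
  by rewrite sumr_ge0 // => a _; rewrite sumr_ge0.
have HY : `|Y - Y'| <= 3 * e ^+ 2 * d * Ct.
  rewrite /Y /Y' -sumrB (le_trans (ler_norm_sum _ _ _)) //.
  apply: (@le_trans _ _ (\sum_a \sum_b \sum_c 3 * e ^+ 2 * d * `|t m a b c|)).
    apply: ler_sum => a _; rewrite -sumrB (le_trans (ler_norm_sum _ _ _)) //.
    apply: ler_sum => b _; rewrite -sumrB (le_trans (ler_norm_sum _ _ _)) //.
    apply: ler_sum => c _; rewrite -mulrBr normrM mulrC ler_wpM2r //.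
    exact: cutoff_prod3.
  under eq_bigr do under eq_bigr do rewrite -mulr_sumr.
  under eq_bigr do rewrite -mulr_sumr.
  rewrite -mulr_sumr ler_wpM2l //; first by rewrite !mulr_ge0 // ltW.
  rewrite /Ct [leRHS](bigD1 m) //= lerDl sumr_ge0 // => k _.
  by rewrite sumr_ge0 // => a _; rewrite sumr_ge0 // => b _; rewrite sumr_ge0.
have -> : 2^-1 * X + 6^-1 * Y - (2^-1 * X' + 6^-1 * Y') =
  2^-1 * (X - X') + 6^-1 * (Y - Y') by ring.
apply: le_trans (ler_normD _ _) _; rewrite !normrM [`|2^-1|]gtr0_norm ?invr_gt0 //
  [`|6^-1|]gtr0_norm ?invr_gt0 //.
have Ct0 : 0 <= Ct.
  rewrite sumr_ge0 // => k _; rewrite sumr_ge0 // => a _.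
  by rewrite sumr_ge0 // => b _; rewrite sumr_ge0.
(* Weakened from 3 to 6, using [e <= 1], so that the Taylor factor [6^-1] cancels and both parts
   have the shape [e * d * C]. *)
have Y1 : 3 * e ^+ 2 * d * Ct <= 6 * e * d * Ct.
  have ed : 0 <= e * d * Ct by rewrite !mulr_ge0 // ltW.
  have -> : 3 * e ^+ 2 * d * Ct = 3 * e * (e * d * Ct) by ring.
  have : e * (e * d * Ct) <= 1 * (e * d * Ct) by rewrite ler_wpM2r.
  lra.
have Z : e * d * Cp + e * d * Ct <= 2^-1 * d.
  have -> : e * d * Cp + e * d * Ct = e * (Cp + Ct) * d by ring.
  by rewrite ler_wpM2r.
have X2 : 2^-1 * `|X - X'| <= e * d * Cp by lra.
have Y2 : 6^-1 * `|Y - Y'| <= e * d * Ct by lra.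
exact: le_trans (lerD X2 Y2) Z.
Qed.

Lemma near_id_poly_smooth i : smooth_on setT (fun u => near_id_poly u 0 i : R^o).
Proof.
have oT := @openT V.
have ss a : smooth_on setT (s a) by have [] := cutoff_smooth e0 a.
apply: (@smooth_eq _ _ _ oT (fun u => 2^-1 * (\sum_a \sum_b p i a b * (s a u * s b u))
   + 6^-1 * (\sum_a \sum_b \sum_c t i a b c * (s a u * s b u * s c u)) : R^o)).
  by move=> u _; rewrite mxE.
apply: smoothD => //; (apply: smoothM => //; first exact: smooth_cst).
  apply: smooth_sum => // a _; apply: smooth_sum => // b _.
  by apply: smoothM => //; [exact: smooth_cst|exact: smoothM].
apply: smooth_sum => // a _; apply: smooth_sum => // b _; apply: smooth_sum => // c _.
apply: smoothM => //; first exact: smooth_cst.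
by apply: smoothM => //; exact: smoothM.
Qed.

Let W m c (u : V) : R^o :=
  \sum_b p m c b * s b u + \sum_a \sum_b 2^-1 * t m c a b * (s a u * s b u).

(** Only [s c] varies along [evec c], so a factor [s' c] comes out; the symmetries of [p] and [t]
    identify the two, respectively three, terms of the product rule. *)
Lemma derive_near_id m c u :
  dd c (fun u => (u + near_id_poly u) 0 m : R^o) u = delta m c + s' c u * W m c u.
Proof.
have ds a : is_derive u (evec R c) (s a) (delta a c * s' a u).
  have [sa _] := cutoff_smooth e0 a.
  have := is_derive_of_derivable (smooth_derivable (v := evec R c) sa (I : setT u)).
  by rewrite derive_cutoff_at // mxE eqxx.
have dk (k : R) := is_derive_cst (k : R^o) u (evec R c).
have du : is_derive u (evec R c) (fun u : V => u 0 m : R^o) (delta m c).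
  have := is_derive_of_derivable (smooth_derivable (v := evec R c)
    (@smooth_coord R n 1 setT 0 m) (I : setT u)).
  by rewrite derive_coord mxE eqxx.
apply: is_derive_val.
apply: is_derive_congr (is_deriveD du (is_deriveD
  (is_derive_mul (dk (2^-1)) (is_derive_fsum (index_enum 'I_n) (fun a =>
     is_derive_fsum (index_enum 'I_n) (fun b =>
     is_derive_mul (dk (p m a b)) (is_derive_mul (ds a) (ds b))))))
  (is_derive_mul (dk (6^-1)) (is_derive_fsum (index_enum 'I_n) (fun a =>
     is_derive_fsum (index_enum 'I_n) (fun b => is_derive_fsum (index_enum 'I_n) (fun d =>
     is_derive_mul (dk (t m a b d)) (is_derive_mul (is_derive_mul (ds a) (ds b)) (ds d)))))))
  )) => [v|]; first by rewrite !mxE.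
rewrite !mul0r !add0r; congr (_ + _); rewrite /W mulrDr; congr (_ + _).
  set S := \sum_b p m c b * s b u.
  have S1 : \sum_a \sum_b p m a b * (delta a c * s' a u * s b u) = s' c u * S.
    rewrite -(sum_delta (fun a => s' a u * \sum_b p m a b * s b u) c).
    apply: eq_bigr => a _; rewrite !mulr_sumr; apply: eq_bigr => b _; ring.
  have S2 : \sum_a \sum_b p m a b * (s a u * (delta b c * s' b u)) = s' c u * S.
    rewrite exchange_big /= -S1; apply: eq_bigr => a _; apply: eq_bigr => b _.
    rewrite pS; ring.
  transitivity (2^-1 * (s' c u * S + s' c u * S)); last by field.
  rewrite -{1}S1 -S2 -big_split /=; congr (_ * _); apply: eq_bigr => a _.
  rewrite -big_split /=; apply: eq_bigr => b _; rewrite /cst; ring.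
set S := \sum_a \sum_b t m c a b * (s a u * s b u).
have S1 : \sum_a \sum_b \sum_d t m a b d * (delta a c * s' a u * s b u * s d u) = s' c u * S.
  rewrite -(sum_delta (fun a => s' a u * \sum_b \sum_d t m a b d * (s b u * s d u)) c).
  apply: eq_bigr => a _; rewrite !mulr_sumr; apply: eq_bigr => b _.
  rewrite !mulr_sumr; apply: eq_bigr => d _; ring.
have S2 : \sum_a \sum_b \sum_d t m a b d * (s a u * (delta b c * s' b u) * s d u) = s' c u * S.
  rewrite exchange_big /= -S1; apply: eq_bigr => a _; apply: eq_bigr => b _.
  apply: eq_bigr => d _; rewrite tS1; ring.
have S3 : \sum_a \sum_b \sum_d t m a b d * (s a u * s b u * (delta d c * s' d u)) = s' c u * S.
  rewrite -S2; apply: eq_bigr => a _; rewrite exchange_big /=; apply: eq_bigr => b _.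
  apply: eq_bigr => d _; rewrite tS2; ring.
transitivity (6^-1 * (s' c u * S + s' c u * S + s' c u * S)).
  rewrite -{1}S1 -{1}S2 -S3 -!big_split /=; congr (_ * _); apply: eq_bigr => a _.
  rewrite -!big_split /=; apply: eq_bigr => b _.
  rewrite -!big_split /=; apply: eq_bigr => d _; rewrite /cst; ring.
have -> : \sum_a \sum_b 2^-1 * t m c a b * (s a u * s b u) = 2^-1 * S.
  rewrite mulr_sumr; apply: eq_bigr => a _; rewrite mulr_sumr; apply: eq_bigr => b _.
  by rewrite [RHS]mulrA.
by field.
Qed.

(** The second derivative of [s' c] at 0 is of size [e ^- 2], but it is multiplied by [W m c 0 = 0];
    hence the jet does not depend on [e]. *)
Lemma jet2_near_id m c : jet2 (fun u => delta m c + s' c u * W m c u)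
  (delta m c) (p m c) (t m c).
Proof.
have jW : jet2 (W m c) 0 (p m c) (t m c).
  apply: jet2_ext (jet2_add
    (jet2_sum (fun b => jet2_mul (jet2_cst n (p m c b)) (jet2_cutoff e0 b)))
    (jet2_sum (fun a => jet2_sum (fun b => jet2_mul (jet2_cst n (2^-1 * t m c a b))
      (jet2_mul (jet2_cutoff e0 a) (jet2_cutoff e0 b)))))) => //.
  - rewrite big1 => [|b _]; last by rewrite mulr0.
    by rewrite big1 ?addr0 // => a _; rewrite big1 // => b _; rewrite mulr0 mulr0.
  - move=> d; rewrite [X in _ + X]big1 ?addr0; last first.
      by move=> a _; rewrite big1 // => b _; rewrite !(mulr0, mul0r, addr0).
    rewrite -[RHS](sum_delta (p m c) d); apply: eq_bigr => b _.
    by rewrite mul0r add0r mulrC.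
  - move=> d f; rewrite [X in X + _]big1 ?add0r; last first.
      by move=> b _; rewrite !(mulr0, mul0r, addr0).
    transitivity (\sum_a \sum_b (2^-1 * (delta a d * delta b f * t m c a b)
        + 2^-1 * (delta a f * delta b d * t m c a b))).
      apply: eq_bigr => a _; apply: eq_bigr => b _; rewrite /delta; ring.
    under eq_bigr do rewrite big_split -!mulr_sumr /=.
    by rewrite big_split -!mulr_sumr /= !sum_delta2 [t m c f d]tS2; field.
apply: jet2_ext (jet2_add (jet2_cst n (delta m c)) (jet2_mul (jet2_cutoff' e0 c) jW)) => //.
- by rewrite mulr0 addr0.
- by move=> d; rewrite mul0r !add0r mul1r.
- by move=> d f; rewrite !(mulr0, mul0r, add0r, addr0) mul1r.
Qed.

Lemma near_id_chart_jets : exists x : chartE, chart_jets x delta p t.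
Proof.
exists (near_id_chart near_id_poly_smooth near_id_poly_lipschitz).
have P0 : near_id_poly 0 = 0.
  apply/rowP => m; rewrite !mxE /s; under eq_bigr do under eq_bigr do
    rewrite cutoff0 mul0r mulr0.
  rewrite big1 ?mulr0 ?add0r; last by move=> a _; rewrite big1.
  rewrite big1 ?mulr0 // => a _; rewrite big1 // => b _; rewrite big1 // => c _.
  by rewrite cutoff0 !mul0r mulr0.
split=> //.
- exact: near_id_chart_atlas.
- exact: diffeo_image (near_idK near_id_poly_lipschitz).
- rewrite /= -[RHS](near_idK near_id_poly_lipschitz 0).
  by rewrite P0 addr0.
- by rewrite /= P0 addr0.
move=> i a; apply: jet2_ext (jet2_near_id i a) => // u.
by rewrite /= derive_near_id.
Qed.

End NearIdModel.

Lemma chart_with_jets (p : T3) (t : T4) :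
  (forall i a b, p i a b = p i b a) ->
  (forall i a b c, t i a b c = t i b a c) ->
  (forall i a b c, t i a b c = t i a c b) ->
  exists x : chartE, chart_jets x delta p t.
Proof.
move=> pS tS1 tS2.
set C := \sum_m \sum_a \sum_b `|p m a b| + \sum_m \sum_a \sum_b \sum_c `|t m a b c|.
have C0 : 0 <= C.
  rewrite addr_ge0 // sumr_ge0 // => m _; rewrite sumr_ge0 // => a _;
    rewrite sumr_ge0 // => b _; rewrite sumr_ge0 //.
have D0 : 0 < 2 * (1 + C) by rewrite mulr_gt0 // ltr_pwDl.
(* This value satisfies [e * C <= 1 / 2] and [e <= 1] together, even when [C] is 0. *)
apply: (@near_id_chart_jets (2 * (1 + C))^-1) => //.
- by rewrite invr_gt0.
- by rewrite -/C mulrC ler_pdivrMr //; lra.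
- by rewrite invf_le1 //; lra.
Qed.

(** Points are rows, so the inverse of the chart is [u |-> u *m J^T], whose component [i] has
    derivative [J i a] along [evec a]. *)
Lemma linear_chart_jets (J : 'M[R]_n) : J \in unitmx ->
  exists x : chartE, chart_jets x J (fun _ _ _ => 0) (fun _ _ _ _ => 0).
Proof.
move=> uJ; have uJT : J^T \in unitmx by rewrite unitmx_tr.
pose phi (u : V) : V := u *m J^T; pose psi (u : V) : V := u *m invmx J^T.
have phiK : cancel phi psi by move=> u; rewrite /phi /psi mulmxK.
have psiK : cancel psi phi by move=> u; rewrite /phi /psi mulmxKV.
have sm (A : 'M[R]_n) i : smooth_on setT (fun u : V => (u *m A) 0 i : R^o).
  have oT := @openT V.
  apply: (@smooth_eq _ _ _ oT (fun u : V => \sum_a u 0 a * A a i : R^o)).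
    by move=> u _; rewrite mxE.
  apply: smooth_sum => // a _; apply: smoothM => //; first exact: smooth_coord.
  exact: smooth_cst.
exists (diffeo_chart phiK psiK (sm J^T) (sm (invmx J^T))); split=> //.
- exact: diffeo_chart_atlas.
- exact: diffeo_image phiK.
- by rewrite /= /psi mul0mx.
- by rewrite /= /phi mul0mx.
move=> i a; apply: jet2_ext (jet2_cst n (J i a)) => // u.
rewrite /= /phi -rV_derive; last first.
  by apply: rV_differentiable => k; apply: smooth_differentiable (sm _ k) _.
have -> : 'D_(evec R a) (fun v : V => v *m J^T) u = evec R a *m J^T.
  apply/rowP => k; rewrite rV_derive; last first.
    by apply: rV_differentiable => m; apply: smooth_differentiable (sm _ m) _.
  rewrite (_ : (fun u : V => _) = (fun u : V => \sum_b u 0 b * J^T b k : R^o)); last first.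
    by apply/funext => v; rewrite mxE.
  rewrite derive_sum_at; last first.
    move=> b; apply: smoothM; [exact: openT|exact: smooth_coord|exact: smooth_cst].
  rewrite mxE; apply: eq_bigr => b _.
  rewrite derive_mul_at; [|exact: smooth_coord|exact: smooth_cst].
  by rewrite derive_coord derive_cst_at mulr0 addr0.
by rewrite -rowE !mxE.
Qed.

End ModelFields.

(** * Metrics and tensor fields with prescribed jets *)

Section ModelMetric.
Variables (R : realType) (n : nat).
Notation T3 := ('I_n -> 'I_n -> 'I_n -> R).
Notation T4 := ('I_n -> 'I_n -> 'I_n -> 'I_n -> R).
Notation V := 'rV[R]_n.
Notation delta := (@delta R n).

(** A kernel vector would satisfy [h *m N = - h], impossible when the sum of the absolute entries, a
    bound for the operator norm, is below 1. *)
Lemma near_one_unit (N : 'M[R]_n) : \sum_i \sum_a `|N a i| < 1 -> 1%:M + N \in unitmx.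
Proof.
move=> N1; rewrite -row_free_unit -kermx_eq0; apply/eqP/row_matrixP => k; rewrite row0.
set h := row k _.
have hN : h *m N = - h.
  have : h *m (1%:M + N) = 0 by rewrite -row_mul mulmx_ker row0.
  by rewrite mulmxDr mulmx1 addrC => /eqP; rewrite addr_eq0 => /eqP.
have := mulmx_norm_le N h; rewrite hN normrN => H.
apply/eqP/negPn/negP => h0; have hn : 0 < `|h| by rewrite normr_gt0.
by move: H; rewrite ler_pMl // leNgt N1.
Qed.

(* The metric is [X^T G X] with [X] close to 1, hence Lorentz everywhere. *)
Lemma model_metric (G : 'M[R]_n) (B : T4) : lorentz_mx G ->
  (forall a b c d, B a b c d = B b a c d) ->
  (forall a b c d, B a b c d = B a b d c) ->
  exists g0 : cfield R n 2, [/\ forall I, smooth_on setT (fun u => g0 u I),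
    forall v, lorentz_mx (mx_of g0 v) &
    forall i j, jet2 (fun v => g0 v [tuple i; j]) (G i j) (fun=> 0) (B i j)].
Proof.
move=> lG BS1 BS2; have uG := lorentz_unit lG; have sG := lG.1.
(* [C] is [B] with its first index raised. The matrix [X] below has second derivative [2^-1 * C] at
   0, so each factor of [X^T G X] contributes half of [B]. The constant [e] is chosen so that the
   entries of [X - 1] sum to less than 1. *)
pose C k l c d := \sum_m invmx G k m * B m l c d.
pose K := \sum_i \sum_a \sum_c \sum_d `|4^-1 * C a i c d|.
have K0 : 0 <= K.
  rewrite sumr_ge0 // => i _; rewrite sumr_ge0 // => a _; rewrite sumr_ge0 // => c _.
  by rewrite sumr_ge0.
pose e : R := (1 + K)^-1.
have e0 : 0 < e by rewrite invr_gt0 ltr_pwDl.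
have e1 : e <= 1 by rewrite invf_le1 ?ltr_pwDl // lerDl.
have eK : K * e < 1 by rewrite ltr_pdivrMr ?ltr_pwDl // mul1r ltrDr.
pose N k l (v : V) : R^o := \sum_c \sum_d 4^-1 * C k l c d * (cutoff e c v * cutoff e d v).
pose X v := 1%:M + \matrix_(k, l) N k l v.
have uX v : X v \in unitmx.
  apply: near_one_unit; apply: le_lt_trans eK; rewrite mulr_suml.
  apply: ler_sum => i _; rewrite mulr_suml; apply: ler_sum => a _; rewrite mxE.
  rewrite (le_trans (ler_norm_sum _ _ _)) // mulr_suml; apply: ler_sum => c _.
  rewrite (le_trans (ler_norm_sum _ _ _)) // mulr_suml; apply: ler_sum => d _.
  rewrite normrM ler_wpM2l // normrM -[leRHS]mulr1.
  by apply: ler_pM => //; [exact: cutoff_bound|apply: le_trans e1; exact: cutoff_bound].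
have jN k l : jet2 (N k l) 0 (fun=> 0) (fun c d => 2^-1 * C k l c d).
  apply: jet2_ext (jet2_sum (fun c => jet2_sum (fun d =>
    jet2_mul (jet2_cst n (4^-1 * C k l c d))
      (jet2_mul (jet2_cutoff e0 c) (jet2_cutoff e0 d))))) => //.
  - by rewrite big1 // => c _; rewrite big1 // => d _; rewrite !mulr0.
  - by move=> a; rewrite big1 // => c _; rewrite big1 // => d _; rewrite !(mulr0, mul0r, addr0).
  - move=> a b.
    transitivity (\sum_c \sum_d (4^-1 * (delta c a * delta d b * C k l c d)
        + 4^-1 * (delta c b * delta d a * C k l c d))).
      apply: eq_bigr => c _; apply: eq_bigr => d _; rewrite /delta; ring.
    under eq_bigr do rewrite big_split -!mulr_sumr /=.
    rewrite big_split -!mulr_sumr /= !sum_delta2.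
    have -> : C k l b a = C k l a b by apply: eq_bigr => m _; rewrite BS2.
    by field.
have jX k l : jet2 (fun v => X v k l) (delta k l) (fun=> 0)
    (fun c d => 2^-1 * C k l c d).
  apply: jet2_ext (jet2_add (jet2_cst n (delta k l)) (jN k l)) => //.
  - by move=> v; rewrite !mxE.
  - by rewrite addr0.
  - by move=> a; rewrite addr0.
  - by move=> a b; rewrite add0r.
pose g0 : cfield R n 2 := fun v I =>
  \sum_k \sum_l G k l * (X v k (tnth I 0) * X v l (tnth I 1)).
have jg i j := jet2_sum (fun k => jet2_sum (fun l =>
    jet2_mul (jet2_cst n (G k l)) (jet2_mul (jX k i) (jX l j)))).
exists g0; split.
- by move=> I; have [[s _ _] _] := jg (tnth I 0) (tnth I 1).
- move=> v; have -> : mx_of g0 v = (X v)^T *m G *m X v.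
    apply/matrixP => a b; rewrite !mxE.
    under [RHS]eq_bigr do rewrite mxE mulr_suml.
    rewrite exchange_big /=; apply: eq_bigr => k _; apply: eq_bigr => l _.
    rewrite !(tnth_nth a) /= [(X v)^T _ _]mxE; ring.
  exact: lorentz_congr.
move=> i j; apply: jet2_ext (jg i j) => //.
- rewrite -[RHS](sum_delta2 (fun k l => G k l) i j).
  by apply: eq_bigr => k _; apply: eq_bigr => l _; rewrite mulrC.
- move=> a; rewrite big1 // => k _; rewrite big1 // => l _.
  by rewrite !(mulr0, mul0r, addr0).
- move=> c d.
  have GC k l a b : \sum_m G k m * C m l a b = B k l a b.
    transitivity (\sum_m (1%:M : 'M[R]_n) k m * B m l a b).
      under eq_bigr do rewrite mulr_sumr.
      rewrite exchange_big /=; apply: eq_bigr => m _.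
      rewrite -(mulmxV uG) mxE mulr_suml; apply: eq_bigr => q _; ring.
    rewrite (bigD1 k) //= mxE eqxx mul1r big1 ?addr0 // => m mk.
    by rewrite mxE eq_sym (negbTE mk) mul0r.
  transitivity (2^-1 * \sum_k \sum_l (G k l * C k i c d) * delta l j
     + 2^-1 * \sum_l \sum_k (G k l * C l j c d) * delta k i).
    rewrite [X in _ = _ + 2^-1 * X]exchange_big /= !mulr_sumr -big_split /=.
    apply: eq_bigr => k _; rewrite [X in _ = X + _]mulr_sumr [X in _ = _ + X]mulr_sumr.
    rewrite -big_split /=; apply: eq_bigr => l _; ring.
  have -> : \sum_k \sum_l (G k l * C k i c d) * delta l j = B i j c d.
    rewrite -(BS1 j) -(GC j); apply: eq_bigr => k _.
    under eq_bigr do rewrite mulrC.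
    by rewrite sum_delta -{1}sG mxE.
  have -> : \sum_l \sum_k (G k l * C l j c d) * delta k i = B i j c d.
    rewrite -(GC i); apply: eq_bigr => l _.
    under eq_bigr do rewrite mulrC.
    by rewrite sum_delta.
  by field.
Qed.

Lemma model_tensor (D : T3) (E : T4) : exists D0 : cfield R n 3,
  (forall I, smooth_on setT (fun u => D0 u I)) /\
  forall i j k, jet1 (fun v => D0 v [tuple i; j; k]) (D i j k) (E i j k).
Proof.
pose D0 : cfield R n 3 := fun v I =>
  uncurry3 D I + \sum_l uncurry3 (fun i j k => E i j k l) I * v 0 l.
have j0 I := jet1_add (jet1_cst n (uncurry3 D I)) (jet1_sum (fun l =>
   jet1_mul (jet1_cst n (uncurry3 (fun i j k => E i j k l) I)) (jet1_coord R l))).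
exists D0; split=> [I|i j k]; first by have [] := j0 I.
apply: jet1_ext (j0 [tuple i; j; k]) => //.
- by rewrite big1 ?addr0 ?uncurry3E // => l _; rewrite mulr0.
- move=> a; rewrite add0r -[RHS](sum_delta (E i j k) a); apply: eq_bigr => l _.
  by rewrite uncurry3E mul0r add0r mulrC.
Qed.

End ModelMetric.

(** * Equations for [F] from changes of coordinates *)

Section Equations.
Variables (R : realType) (n : nat) (L : jet_space R n -> R^o).
Hypothesis L_inv : forall (M : manifold R n) (g : lorentz_metric M)
   (nabla : connection M), exists f : M -> R, represents L g nabla f.
Notation T3 := ('I_n -> 'I_n -> 'I_n -> R).
Notation T4 := ('I_n -> 'I_n -> 'I_n -> 'I_n -> R).
Notation delta := (@delta R n).
Notation F := (F L).

Definition sym4 (B : T4) :=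
  (forall a b c d, B a b c d = B b a c d) /\ (forall a b c d, B a b c d = B a b d c).

(** Compares the chart [x] with the identity chart at the origin for model fields whose metric has
    vanishing first derivatives. Nonzero first derivatives will come from the second derivatives [p]
    of the chart. *)
Lemma F_change (G : 'M[R]_n) (B : T4) (D : T3) (E : T4) x j p t :
  lorentz_mx G -> sym4 B -> chart_jets x j p t ->
  F (\matrix_(a, b) \sum_i \sum_k j i a * j k b * G i k)
    (fun a b c => \sum_i \sum_k (p i a c * j k b + j i a * p k b c) * G i k)
    (fun a b c d => \sum_i \sum_k
       ((t i a c d * j k b + p i a c * p k b d + p i a d * p k b c + j i a * t k b c d)
          * G i k
        + j i a * j k b * \sum_l \sum_m j l c * j m d * B i k l m))
    (fun a b c => \sum_i \sum_k \sum_l j i a * j k b * j l c * D i k l)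
    (fun a b c d => \sum_i \sum_k \sum_l
       (((p i a d * j k b + j i a * p k b d) * j l c + j i a * j k b * p l c d) * D i k l
        + j i a * j k b * j l c * \sum_m j m d * E i k l m))
  = F G (fun _ _ _ => 0) B D E.
Proof.
move=> lG [BS1 BS2] xj.
have [g0 [sg lg jg]] := model_metric lG BS1 BS2.
have [D0 [sD jD]] := model_tensor D E.
have H z jz pz tz (zj : chart_jets z jz pz tz) := pull_jet L sg lg sD jg jD zj.
rewrite -(H _ _ _ _ xj).
have := H _ _ _ _ (id_chart_jets R n); rewrite -[LHS]/(L _) => E0.
have ov : overlap (M := euclidean R n) x (id_chart R n) (0 : 'rV[R]_n).
  split=> //; [exact: cj_atlas xj|exact: id_chart_atlas|by rewrite (cj_dom xj)].
have := jet_invariance L_inv (pull_metric sg lg) (pull_tensor sD) ov.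
rewrite (cj_map0 xj) => -> /=; rewrite [LHS]E0; congr F.
- apply/matrixP => a b; rewrite mxE; exact: sum_delta2.
- apply/funext => a; apply/funext => b; apply/funext => c.
  by rewrite big1 // => i _; rewrite big1 // => k _; rewrite !(mul0r, mulr0, addr0).
- apply/funext => a; apply/funext => b; apply/funext => c; apply/funext => d.
  rewrite -[RHS](sum_delta2 (fun i k => B i k c d) a b).
  apply: eq_bigr => i _; apply: eq_bigr => k _.
  by rewrite !(mul0r, mulr0, addr0) add0r sum_delta2.
- apply/funext => a; apply/funext => b; apply/funext => c; exact: sum_delta3.
- apply/funext => a; apply/funext => b; apply/funext => c; apply/funext => d.
  rewrite -[RHS](sum_delta3 (fun i k l => E i k l d) a b c).
  apply: eq_bigr => i _; apply: eq_bigr => k _; apply: eq_bigr => l _.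
  by rewrite !(mul0r, mulr0, addr0) add0r sum_delta.
Qed.

Definition pull3 (J : 'M[R]_n) (D : T3) : T3 := fun a b c =>
  \sum_i \sum_k \sum_l J i a * J k b * J l c * D i k l.

Definition pull4 (J : 'M[R]_n) (B : T4) : T4 := fun a b c d =>
  \sum_i \sum_k \sum_l \sum_m J i a * J k b * J l c * J m d * B i k l m.

Lemma F_linear (G J : 'M[R]_n) B D E : lorentz_mx G -> sym4 B -> J \in unitmx ->
  F (J^T *m G *m J) (fun _ _ _ => 0) (pull4 J B) (pull3 J D) (pull4 J E) =
  F G (fun _ _ _ => 0) B D E.
Proof.
move=> lG sB uJ; have [x xj] := linear_chart_jets uJ.
rewrite -(F_change D E lG sB xj); congr F.
- apply/matrixP => a b; rewrite !mxE.
  under eq_bigr do rewrite mxE mulr_suml.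
  rewrite exchange_big /=; apply: eq_bigr => i _; apply: eq_bigr => k _.
  rewrite mxE; ring.
- apply/funext => a; apply/funext => b; apply/funext => c.
  by rewrite big1 // => i _; rewrite big1 // => k _; rewrite !(mul0r, mulr0, addr0).
- apply/funext => a; apply/funext => b; apply/funext => c; apply/funext => d.
  apply: eq_bigr => i _; apply: eq_bigr => k _.
  rewrite !(mul0r, mulr0, addr0) add0r mulr_sumr; apply: eq_bigr => l _.
  by rewrite mulr_sumr; apply: eq_bigr => m _; rewrite !mulrA.
- apply/funext => a; apply/funext => b; apply/funext => c; apply/funext => d.
  apply: eq_bigr => i _; apply: eq_bigr => k _; apply: eq_bigr => l _.
  rewrite !(mul0r, mulr0, addr0) add0r mulr_sumr; apply: eq_bigr => m _.
  by rewrite !mulrA.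
Qed.

(* [chrU G A m a b] is the coefficient of [d_m] in the Levi-Civita derivative of
   [d_b] along [d_a]; [star] is the correction that turns a partial derivative
   into a covariant one. *)
Definition chrU (G : 'M[R]_n) (A : T3) : T3 := fun m a b =>
  \sum_l invmx G m l * chr A a b l.

(* A quadratic change of coordinates adds [qchr G A] to the second derivatives of
   the metric, and the cubic terms of a change add [symT T]. *)
Definition qchr (G : 'M[R]_n) (A : T3) : T4 := fun a b c d =>
  \sum_m (chrU G A m a c * chr A b d m + chrU G A m a d * chr A b c m).

Definition star (G : 'M[R]_n) (A : T3) (D : T3) : T4 := fun a b c d =>
  \sum_m (chrU G A m d a * D m b c + chrU G A m d b * D a m c + chrU G A m d c * D a b m).

Definition symT (T : T4) : T4 := fun a b c d => T a c d b + T b c d a.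

(** The chart has second derivatives [chrU G A], which create the first derivatives [A] of the
    metric and the corrections [qchr] and [star]. Its third derivatives are [T] with the last index
    raised, which contribute [symT T]; total symmetry in the first three slots is what third
    derivatives allow. *)
Lemma F_normal (G : 'M[R]_n) A B D E T : lorentz_mx G -> sym4 B ->
  (forall a b c, A a b c = A b a c) ->
  (forall a b c d, T a b c d = T b a c d) -> (forall a b c d, T a b c d = T a c b d) ->
  F G A (fun a b c d => B a b c d + qchr G A a b c d + symT T a b c d) D
    (fun a b c d => E a b c d + star G A D a b c d)
  = F G (fun _ _ _ => 0) B D E.
Proof.
move=> lG sB AS TS1 TS2.
have uG := lorentz_unit lG; have sG := lG.1.
have GS i k : G i k = G k i by rewrite -{1}sG mxE.
have cS a b c : chr A a b c = chr A b a c.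
  by rewrite /chr [A b a c]AS; congr (_ * (_ - _)); rewrite addrC.
have GG (f : 'I_n -> R) k : \sum_i G k i * (\sum_l invmx G i l * f l) = f k.
  transitivity (\sum_m (1%:M : 'M[R]_n) k m * f m).
    under eq_bigr do rewrite mulr_sumr.
    rewrite exchange_big /=; apply: eq_bigr => m _.
    rewrite -(mulmxV uG) mxE mulr_suml; apply: eq_bigr => q _; ring.
  rewrite (bigD1 k) //= mxE eqxx mul1r big1 ?addr0 // => m mk.
  by rewrite mxE eq_sym (negbTE mk) mul0r.
have GU k a b : \sum_i G k i * chrU G A i a b = chr A a b k by exact: GG.
pose t i a c d := \sum_l invmx G i l * T a c d l.
have [|||x xj] := @chart_with_jets R n (chrU G A) t.
- by move=> i a b; apply: eq_bigr => l _; rewrite cS.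
- by move=> i a b c; apply: eq_bigr => l _; rewrite TS1.
- by move=> i a b c; apply: eq_bigr => l _; rewrite TS2.
rewrite -(F_change D E lG sB xj); congr F.
- by apply/matrixP => a b; rewrite mxE sum_delta2.
- apply/funext => a; apply/funext => b; apply/funext => c.
  transitivity (\sum_i \sum_k delta k b * (chrU G A i a c * G i k)
      + \sum_i \sum_k delta i a * (chrU G A k b c * G i k)); last first.
    rewrite -big_split; apply: eq_bigr => i _; rewrite -big_split; apply: eq_bigr => k _ /=.
    ring.
  under eq_bigr do rewrite sum_delta.
  under [X in _ + X]eq_bigr do rewrite -mulr_sumr.
  rewrite sum_delta.
  have -> : \sum_i chrU G A i a c * G i b = chr A a c b.
    by rewrite -GU; apply: eq_bigr => i _; rewrite GS mulrC.
  have -> : \sum_i chrU G A i b c * G a i = chr A b c a.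
    by rewrite -GU; apply: eq_bigr => i _; rewrite mulrC.
  rewrite /chr [A c b a]AS [A c a b]AS [A b a c]AS; by field.
- apply/funext => a; apply/funext => b; apply/funext => c; apply/funext => d.
  transitivity (\sum_i \sum_k delta i a * delta k b * B i k c d
     + \sum_i \sum_k (chrU G A i a c * (G i k * chrU G A k b d)
                      + chrU G A i a d * (G i k * chrU G A k b c))
     + (\sum_i \sum_k delta k b * (t i a c d * G i k)
        + \sum_i \sum_k delta i a * (t k b c d * G i k))); last first.
    rewrite -!big_split; apply: eq_bigr => i _; rewrite -!big_split; apply: eq_bigr => k _ /=.
    rewrite sum_delta2; ring.
  rewrite sum_delta2; congr (_ + _ + (_ + _)).
  + apply: eq_bigr => i _; rewrite big_split /= -!mulr_sumr !GU.
    by [].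
  + under eq_bigr do rewrite sum_delta.
    by rewrite -[LHS](GG (T a c d)); apply: eq_bigr => i _; rewrite GS mulrC.
  + under eq_bigr do rewrite -mulr_sumr.
    rewrite sum_delta.
    by rewrite -[LHS](GG (T b c d)); apply: eq_bigr => i _; rewrite mulrC.
- by apply/funext => a; apply/funext => b; apply/funext => c; rewrite sum_delta3.
- apply/funext => a; apply/funext => b; apply/funext => c; apply/funext => d.
  have pS i u v : chrU G A i u v = chrU G A i v u.
    by apply: eq_bigr => l _; rewrite cS.
  transitivity (\sum_i \sum_k \sum_l delta i a * delta k b * delta l c * E i k l d
    + (\sum_i \sum_k \sum_l delta k b * delta l c * (chrU G A i a d * D i k l)
    + \sum_k \sum_i \sum_l delta i a * delta l c * (chrU G A k b d * D i k l)
    + \sum_l \sum_i \sum_k delta i a * delta k b * (chrU G A l c d * D i k l))).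
    rewrite sum_delta3; congr (_ + _); rewrite -!big_split /=.
    by apply: eq_bigr => m _; rewrite !sum_delta2 !(pS m d).
  rewrite [X in _ + (_ + X + _)]exchange_big /=.
  rewrite [X in _ + (_ + _ + X)]exchange_big /=.
  under [X in _ + (_ + _ + X)]eq_bigr do rewrite exchange_big /=.
  rewrite -!big_split; apply: eq_bigr => i _; rewrite -!big_split; apply: eq_bigr => k _ /=.
  rewrite -!big_split; apply: eq_bigr => l _ /=; rewrite sum_delta; ring.
Qed.

End Equations.

(** * The quadratic part of L *)

Section QuadraticStructure.
Variables (R : realType) (n : nat) (L : jet_space R n -> R^o).
Hypothesis L_smooth : smooth_on (@Y3 R n) L.
Hypothesis L_third : forall u v w : jet_space R n,
   jet_base u = 0 -> jet_base v = 0 -> jet_base w = 0 ->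
   forall y, Y3 y -> 'D_u ('D_v ('D_w L)) y = 0.
Notation T3 := ('I_n -> 'I_n -> 'I_n -> R).
Notation T4 := ('I_n -> 'I_n -> 'I_n -> 'I_n -> R).
Notation F := (F L).

Lemma jet_base_continuous : continuous (@jet_base R n).
Proof.
move=> y.
apply: (@continuous_comp _ _ _ fst (fun z => z.1.1.1)); first exact: cvg_fst.
apply: (@continuous_comp _ _ _ fst (fun z => z.1.1)); first exact: cvg_fst.
apply: (@continuous_comp _ _ _ fst fst); exact: cvg_fst.
Qed.

Lemma det_nonzero_open : open [set w : 'M[R]_n | \det w != 0].
Proof.
rewrite (_ : [set _ | _] = (fun w : 'M[R]_n => \det w : R^o) @^-1` [set x | x != 0]) //.
apply: open_comp; last exact: open_neq.
move=> w _; apply: (@smooth_det _ _ setT openT n id) 0%N _ I => i j.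
exact: smooth_coord.
Qed.

Lemma Y3_open : open (@Y3 R n).
Proof.
apply: (@open_comp _ _ (@jet_base R n) [set w : 'M[R]_n | \det w != 0]).
  by move=> y _; exact: jet_base_continuous.
exact: det_nonzero_open.
Qed.

Definition base_point (G : 'M[R]_n) : jet_space R n := (G, 0, 0, 0, 0).

Definition lin (G : 'M[R]_n) (v : jet_space R n) : R := 'D_v L (base_point G).

Definition quad (G : 'M[R]_n) (u v : jet_space R n) : R :=
  2^-1 * 'D_u ('D_v L) (base_point G).

Section AtPoint.
Variable G : 'M[R]_n.
Hypothesis G0 : \det G != 0.
Let y0 := base_point G.
Let Y0 : Y3 y0. Proof. exact: G0. Qed.

Lemma lin_linear k u v : lin G (k *: u + v) = k * lin G u + lin G v.
Proof.
have d : differentiable L y0 := (L_smooth 1).1 _ Y0.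
by rewrite /lin !deriveE // linearP.
Qed.

Lemma quad_sym u v : quad G u v = quad G v u.
Proof. by rewrite /quad (Ck2_Schwarz v u Y3_open Y0 (L_smooth 2)). Qed.

Lemma quad_linear w k u v : quad G (k *: u + v) w = k * quad G u w + quad G v w.
Proof.
have d : differentiable ('D_w L) y0 
  by have [_ H] := L_smooth 2; have [dw _] := H w; exact: dw.
by rewrite /quad !deriveE // linearP mulrDr /GRing.scale /= mulrCA.
Qed.

(** A direction with zero base component does not change the determinant, so the whole line stays in
    [Y3] and Taylor's formula of order two is exact. *)
Lemma L_quadratic v : jet_base v = 0 ->
  L (y0 + v) = L y0 + lin G v + quad G v v.
Proof.
move=> v0; apply: (@line_quadratic _ _ (@Y3 R n)) => // [t|z Yz].
  rewrite /Y3 /= /jet_base /=.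
  by have := v0; rewrite /jet_base => ->; rewrite scaler0 addr0.
exact: L_third.
Qed.

End AtPoint.

Definition zero3 : T3 := fun _ _ _ => 0.
Definition zero4 : T4 := fun _ _ _ _ => 0.

(** [jetF] with zero metric slot is linear in the other variables: this is the displacement from
    [base_point G] to [jetF G A B D E]. *)
Definition vec A B D E : jet_space R n := jetF 0 A B D E.

Lemma to_tensor_lin r (S T U : r.-tuple 'I_n -> R) k :
  (forall I, U I = k * S I + T I) -> to_tensor U = k *: to_tensor S + to_tensor T.
Proof. by move=> E; apply/rowP => i; rewrite !mxE. Qed.

Lemma vec_lin k A B D E A' B' D' E' :
  vec (fun a b c => k * A a b c + A' a b c)
      (fun a b c d => k * B a b c d + B' a b c d)
      (fun a b c => k * D a b c + D' a b c)
      (fun a b c d => k * E a b c d + E' a b c d)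
  = k *: vec A B D E + vec A' B' D' E'.
Proof.
rewrite /vec /jetF; congr (_, _, _, _, _).
- by rewrite /= scaler0 addr0.
- exact: to_tensor_lin.
- exact: to_tensor_lin.
- by apply: to_tensor_lin => I; rewrite /uncurry3 /chr; ring.
- by apply: to_tensor_lin => I; rewrite /uncurry4 /dchr; ring.
Qed.

Lemma jetF_vec G A B D E : jetF G A B D E = base_point G + vec A B D E.
Proof.
by rewrite /vec /jetF /base_point; congr (_, _, _, _, _); rewrite /= ?addr0 ?add0r.
Qed.

Lemma vec0 : vec zero3 zero4 zero3 zero4 = 0.
Proof.
rewrite /vec /jetF; congr (_, _, _, _, _); apply/rowP => i; rewrite !mxE //.
  by rewrite /uncurry3 /chr /zero3; ring.
by rewrite /uncurry4 /dchr /zero4; ring.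
Qed.

Lemma F_quadratic G A B D E : \det G != 0 ->
  F G A B D E = L (base_point G) + lin G (vec A B D E)
    + quad G (vec A B D E) (vec A B D E).
Proof. by move=> G0; rewrite /F jetF_vec L_quadratic. Qed.

Definition linear4 (k : T4 -> R) := forall c B B',
  k (fun x y u v => c * B x y u v + B' x y u v) = c * k B + k B'.

Definition vB B := vec zero3 B zero3 zero4.
Definition vD D := vec zero3 zero4 D zero4.
Definition vE E := vec zero3 zero4 zero3 E.

Lemma vB_lin k B B' : vB (fun x y u v => k * B x y u v + B' x y u v) = k *: vB B + vB B'.
Proof.
rewrite -vec_lin; congr vec; rewrite /zero3 /zero4; apply/funext => a; apply/funext => b;
  apply/funext => c; try apply/funext => d; ring.
Qed.

Lemma vD_lin k D D' : vD (fun x y u => k * D x y u + D' x y u) = k *: vD D + vD D'.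
Proof.
rewrite -vec_lin; congr vec; rewrite /zero3 /zero4; apply/funext => a; apply/funext => b;
  apply/funext => c; try apply/funext => d; ring.
Qed.

Lemma vE_lin k E E' : vE (fun x y u v => k * E x y u v + E' x y u v) = k *: vE E + vE E'.
Proof.
rewrite -vec_lin; congr vec; rewrite /zero3 /zero4; apply/funext => a; apply/funext => b;
  apply/funext => c; try apply/funext => d; ring.
Qed.

Lemma vec_split B D E : vec zero3 B D E = vB B + vD D + vE E.
Proof.
rewrite -addrA -[vB B]scale1r -[vD D]scale1r /vB /vD /vE -!vec_lin.
congr vec; rewrite /zero3 /zero4; apply/funext => a; apply/funext => b;
  apply/funext => c; try apply/funext => d; ring.
Qed.

End QuadraticStructure.

(** * Linear forms on second derivatives of the metric *)

Section CurvatureSpan.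
Variables (R : realType) (n : nat).
Notation T3 := ('I_n -> 'I_n -> 'I_n -> R).
Notation T4 := ('I_n -> 'I_n -> 'I_n -> 'I_n -> R).
Notation delta := (@delta R n).

Variable kap : T4 -> R.
Hypothesis kap_lin : linear4 kap.

Lemma fun4_ext (B B' : T4) : (forall x y u v, B x y u v = B' x y u v) -> B = B'.
Proof.
move=> H; apply/funext => x; apply/funext => y.
by apply/funext => u; apply/funext => v; exact: H.
Qed.

Lemma lin4D B B' : kap (fun x y u v => B x y u v + B' x y u v) = kap B + kap B'.
Proof.
by rewrite -[kap B]mul1r -kap_lin; congr kap; apply: fun4_ext => x y u v; rewrite mul1r.
Qed.

Lemma lin40 : kap (@zero4 R n) = 0.
Proof.
have H := kap_lin 1 (@zero4 R n) (@zero4 R n).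
have E : (fun x y u v => 1 * zero4 R x y u v + zero4 R x y u v) = @zero4 R n.
  by apply: fun4_ext => x y u v; rewrite /zero4 mulr0 addr0.
move: H; rewrite E mul1r => /eqP; rewrite -subr_eq0 opprD addrA subrr add0r oppr_eq0.
by move=> /eqP.
Qed.

Lemma lin4Z c B : kap (fun x y u v => c * B x y u v) = c * kap B.
Proof.
rewrite -[RHS]addr0 -lin40 -kap_lin; congr kap; apply: fun4_ext => x y u v.
by rewrite /zero4 addr0.
Qed.

Lemma lin4_sum (I : Type) (r : seq I) (c : I -> R) (B : I -> T4) :
  kap (fun x y u v => \sum_(i <- r) c i * B i x y u v) = \sum_(i <- r) c i * kap (B i).
Proof.
elim: r => [|i r IH].
  by rewrite big_nil -[RHS]lin40; congr kap; apply: fun4_ext => x y u v; rewrite big_nil.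
rewrite big_cons -IH -kap_lin; congr kap; apply: fun4_ext => x y u v.
by rewrite big_cons.
Qed.

Definition sym_basis a b c d : T4 := fun x y u v =>
  (delta a x * delta b y + delta b x * delta a y)
  * (delta c u * delta d v + delta d u * delta c v).

Lemma sym_basis_sym4 a b c d : sym4 (sym_basis a b c d).
Proof. by split=> x y u v; rewrite /sym_basis; ring. Qed.

(** Each [sym_basis] is a sum of four elementary tensors, whence the factor [4^-1]. *)
Lemma sym4_expand B : sym4 B ->
  kap B = 4^-1 * \sum_a \sum_b \sum_c \sum_d B a b c d * kap (sym_basis a b c d).
Proof.
move=> [S1 S2].
transitivity (4^-1 * kap (fun x y u v => \sum_a \sum_b \sum_c \sum_d
    B a b c d * sym_basis a b c d x y u v)).
  rewrite -lin4Z; congr kap; apply: fun4_ext => x y u v.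
  have E a : \sum_b \sum_c \sum_d B a b c d * sym_basis a b c d x y u v =
      \sum_b (delta a x * delta b y + delta b x * delta a y) * (2 * B a b u v).
    apply: eq_bigr => b _.
    transitivity ((delta a x * delta b y + delta b x * delta a y) *
      (\sum_c \sum_d delta c u * delta d v * B a b c d
      + \sum_d \sum_c delta d u * delta c v * B a b c d)).
      rewrite [in X in _ = _ * (_ + X)]exchange_big /= -big_split mulr_sumr.
      apply: eq_bigr => c _; rewrite -big_split mulr_sumr; apply: eq_bigr => d _ /=.
      rewrite /sym_basis; ring.
    rewrite sum_delta2.
    have -> : \sum_d \sum_c delta d u * delta c v * B a b c d = B a b v u.
      exact: (sum_delta2 (fun d c => B a b c d)).
    rewrite (S2 _ _ v u); ring.
  under eq_bigr do rewrite E.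
  transitivity (4^-1 * (\sum_a \sum_b delta a x * delta b y * (2 * B a b u v)
      + \sum_b \sum_a delta b x * delta a y * (2 * B a b u v))).
    rewrite sum_delta2 (sum_delta2 (fun b a => 2 * B a b u v)) (S1 y x); by field.
  congr (_ * _); rewrite [X in _ + X]exchange_big /= -big_split; apply: eq_bigr => a _.
  rewrite -big_split; apply: eq_bigr => b _ /=; ring.
congr (_ * _).
have K a b c : kap (fun x y u v => \sum_d B a b c d * sym_basis a b c d x y u v) =
   \sum_d B a b c d * kap (sym_basis a b c d) by exact: lin4_sum.
pose S3 a b c : T4 := fun x y u v => \sum_d B a b c d * sym_basis a b c d x y u v.
pose S2' a b : T4 := fun x y u v => \sum_c 1 * S3 a b c x y u v.
pose S1' a : T4 := fun x y u v => \sum_b 1 * S2' a b x y u v.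
transitivity (kap (fun x y u v => \sum_a 1 * S1' a x y u v)).
  congr kap; apply: fun4_ext => x y u v.
  apply: eq_bigr => a _; rewrite mul1r; apply: eq_bigr => b _; rewrite mul1r.
  by apply: eq_bigr => c _; rewrite mul1r.
rewrite lin4_sum; apply: eq_bigr => a _; rewrite mul1r lin4_sum.
apply: eq_bigr => b _; rewrite mul1r lin4_sum.
by apply: eq_bigr => c _; rewrite mul1r K.
Qed.

Hypothesis kap_symT : forall T : T4, (forall a b c d, T a b c d = T b a c d) ->
  (forall a b c d, T a b c d = T a c b d) -> kap (symT T) = 0.

(** The tensor [T] symmetrises [a, c, d] over its first three slots and puts [b] in the last; its
    [symT] is the sum of the three basis tensors. This is the analogue of a Bianchi identity. *)
Lemma kap_cyclic a b c d :
  kap (sym_basis a b c d) + kap (sym_basis c b a d) + kap (sym_basis d b a c) = 0.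
Proof.
pose T : T4 := fun x u v y => delta b y *
  (delta a x * (delta c u * delta d v + delta d u * delta c v)
   + delta c x * (delta a u * delta d v + delta d u * delta a v)
   + delta d x * (delta a u * delta c v + delta c u * delta a v)).
rewrite -2!lin4D -(kap_symT (T := T)); first last.
- by move=> x u v y; rewrite /T; ring.
- by move=> x u v y; rewrite /T; ring.
congr kap; apply: fun4_ext => x y u v.
rewrite /symT /T /sym_basis; ring.
Qed.

Variable G : 'M[R]_n.
Hypothesis lG : lorentz_mx G.
Hypothesis kap_q : forall A : T3, (forall a b c, A a b c = A b a c) -> kap (qchr G A) = 0.

(** For Christoffel symbols of the form [h a b * w c] with a covector [w] of square -1, [qchr] is
    minus this expression. *)
Lemma kap_square (h : 'I_n -> 'I_n -> R) : (forall a b, h a b = h b a) ->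
  kap (fun a b c d => h a c * h b d + h a d * h b c) = 0.
Proof.
move=> hS; case: (posnP n) => [n0|n0].
  rewrite -[RHS]lin40; congr kap; apply/funext => a.
  by have := ltn_ord a; rewrite [X in (_ < X)%N]n0.
pose i0 := Ordinal n0.
have [sG [P uP PG]] := lG.
(* The timelike vector of an orthonormal basis, lowered with [G]; this is where the entry -1 of the
   Minkowski matrix is used. *)
pose w := row i0 (P *m G).
have ww : \sum_m \sum_l invmx G m l * (w 0 l * w 0 m) = -1.
  transitivity ((P *m G *m P^T) i0 i0); last by rewrite PG !mxE eqxx /=.
  have -> : P *m G *m P^T = P *m G *m invmx G *m (P *m G)^T.
    by rewrite trmx_mul sG mulmxK ?lorentz_unit // mulmxA.
  rewrite mxE exchange_big /= ; apply: eq_bigr => m _.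
  rewrite !mxE mulr_suml; apply: eq_bigr => l _; rewrite !mxE; ring.
(* The metric derivatives forced by the desired symbols: [A a b c] is the symbol of [c, a] lowered
   at [b] plus the one of [c, b] lowered at [a]. *)
pose A : T3 := fun a b c => h a c * w 0 b + h b c * w 0 a.
have AS a b c : A a b c = A b a c by rewrite /A addrC.
have cA a b c : chr A a b c = h a b * w 0 c.
  rewrite /chr /A (hS b a) (hS c a) (hS c b); by field.
have := kap_q AS.
have -> : qchr G A = (fun a b c d => (-1) * (h a c * h b d + h a d * h b c)).
  apply: fun4_ext => a b c d.
  rewrite -ww /qchr mulr_suml; apply: eq_bigr => m _; rewrite /chrU !cA.
  rewrite !mulr_suml -big_split; apply: eq_bigr => l _ /=; rewrite !cA; ring.
by rewrite lin4Z mulN1r => /eqP; rewrite oppr_eq0 => /eqP.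
Qed.

(** Polarisation of [kap_square] between the symmetric products of [a, c] and of [b, d]. *)
Lemma kap_polar a b c d :
  kap (sym_basis a b c d) + kap (sym_basis a d c b) + kap (sym_basis c b a d)
  + kap (sym_basis c d a b) = 0.
Proof.
pose h x y := delta a x * delta c y + delta c x * delta a y.
pose k x y := delta b x * delta d y + delta d x * delta b y.
have hS x y : h x y = h y x by rewrite /h; ring.
have kS x y : k x y = k y x by rewrite /k; ring.
have := kap_square (h := fun x y => h x y + k x y) _.
move=> /(_ (fun x y => f_equal2 +%R (hS x y) (kS x y))) H.
rewrite -3!lin4D; apply/eqP; rewrite -[X in _ == X]H -[X in X == _]addr0
  -[X in _ + X](kap_square hS).
rewrite -lin4D -[X in X == _]addr0 -[X in _ + X](kap_square kS) -lin4D; apply/eqP.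
congr kap; apply: fun4_ext => x y u v.
rewrite /sym_basis /h /k; ring.
Qed.

(** Cyclic and polarised relations together leave no nonzero value on basis tensors. Applied with
    one argument of the quadratic part fixed, this excludes [B] from it. *)
Lemma kap_vanish B : sym4 B -> kap B = 0.
Proof.
move=> sB; rewrite (sym4_expand sB) big1 ?mulr0 // => a _; rewrite big1 // => b _.
rewrite big1 // => c _; rewrite big1 // => d _.
have zS a' b' c' d' : kap (sym_basis a' b' c' d') = kap (sym_basis b' a' c' d').
  by congr kap; apply: fun4_ext => x y u v; rewrite /sym_basis; ring.
have zS' a' b' c' d' : kap (sym_basis a' b' c' d') = kap (sym_basis a' b' d' c').
  by congr kap; apply: fun4_ext => x y u v; rewrite /sym_basis; ring.
have C a' b' c' d' := kap_cyclic a' b' c' d'.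
(* In [H1 + H2 - H3] everything cancels except twice the value at [a, b, c, d]. *)
have H1 := C c b d a; have H2 := C c a d b; have H3 := kap_polar c b d a.
move: H1 H2 H3; rewrite (zS b a c d).
move: (kap (sym_basis c b d a)) (kap (sym_basis d b c a)) (kap (sym_basis c a d b)).
move: (kap (sym_basis d a c b)) (kap (sym_basis a b c d)) => z1 z2 z3 z4 z5 H1 H2 H3.
have -> : z2 = 0 by lra.
by rewrite mulr0.
Qed.

End CurvatureSpan.

(** * The form of [F] at a fixed Lorentz matrix *)

Section Structure.
Variables (R : realType) (n : nat) (L : jet_space R n -> R^o).
Hypothesis L_smooth : smooth_on (@Y3 R n) L.
Hypothesis L_third : forall u v w : jet_space R n,
   jet_base u = 0 -> jet_base v = 0 -> jet_base w = 0 ->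
   forall y, Y3 y -> 'D_u ('D_v ('D_w L)) y = 0.
Hypothesis L_inv : forall (M : manifold R n) (g : lorentz_metric M)
   (nabla : connection M), exists f : M -> R, represents L g nabla f.
Notation T3 := ('I_n -> 'I_n -> 'I_n -> R).
Notation T4 := ('I_n -> 'I_n -> 'I_n -> 'I_n -> R).
Notation F := (F L).
Notation lin := (lin L).
Notation quad := (quad L).
Notation z3 := (@zero3 R n).
Notation z4 := (@zero4 R n).

Lemma fun3_ext (B B' : T3) : (forall x y u, B x y u = B' x y u) -> B = B'.
Proof.
by move=> H; apply/funext => x; apply/funext => y; apply/funext => u; exact: H.
Qed.

Variable G : 'M[R]_n.
Hypothesis lG : lorentz_mx G.

Let G0 : \det G != 0.
Proof. by have := lorentz_unit lG; rewrite unitmxE unitfE. Qed.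

Let y0 := L (base_point G).

Lemma linD u v : lin G (u + v) = lin G u + lin G v.
Proof. by rewrite -[u]scale1r (lin_linear L_smooth G0) scale1r mul1r. Qed.

Lemma linZ k u : lin G (k *: u) = k * lin G u.
Proof.
have l0 : lin G 0 = 0 by rewrite /lin derive0.
by rewrite -[k *: u]addr0 (lin_linear L_smooth G0) l0 addr0.
Qed.

Lemma quadDl u v w : quad G (u + v) w = quad G u w + quad G v w.
Proof. by rewrite -[u]scale1r (quad_linear L_smooth G0) scale1r mul1r. Qed.

Lemma quadDr u v w : quad G w (u + v) = quad G w u + quad G w v.
Proof. by rewrite !(quad_sym L_smooth G0 w) quadDl. Qed.

Lemma quadZl k u w : quad G (k *: u) w = k * quad G u w.
Proof.
have q0 : quad G 0 w = 0 by rewrite /quad derive0 mulr0.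
by rewrite -[k *: u]addr0 (quad_linear L_smooth G0) q0 addr0.
Qed.

Lemma quadZr k u w : quad G w (k *: u) = k * quad G w u.
Proof. by rewrite !(quad_sym L_smooth G0 w) quadZl. Qed.

Lemma qchrE A a b c d : qchr G A a b c d =
  \sum_m \sum_l invmx G m l * (chr A a c l * chr A b d m + chr A a d l * chr A b c m).
Proof.
apply: eq_bigr => m _; rewrite /chrU !mulr_suml -big_split.
by apply: eq_bigr => l _ /=; ring.
Qed.

Lemma qchr_sym4 A : sym4 (qchr G A).
Proof.
split=> a b c d; last by apply: eq_bigr => m _; rewrite addrC.
rewrite !qchrE exchange_big /=; apply: eq_bigr => m _; apply: eq_bigr => l _.
have -> : invmx G l m = invmx G m l by rewrite -{1}lG.1 -trmx_inv mxE.
ring.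
Qed.

Lemma qchrZ k A : qchr G (fun a b c => k * A a b c)
  = fun a b c d => k ^+ 2 * qchr G A a b c d.
Proof.
apply: fun4_ext => a b c d; rewrite !qchrE !mulr_sumr; apply: eq_bigr => m _.
by rewrite mulr_sumr; apply: eq_bigr => l _; rewrite /chr; ring.
Qed.

Lemma chrUZ k A m a b : chrU G (fun a b c => k * A a b c) m a b = k * chrU G A m a b.
Proof. by rewrite mulr_sumr; apply: eq_bigr => l _; rewrite /chr; ring. Qed.

Lemma starZ k A D : star G (fun a b c => k * A a b c) (fun a b c => k * D a b c)
  = fun a b c d => k ^+ 2 * star G A D a b c d.
Proof.
apply: fun4_ext => a b c d; rewrite mulr_sumr; apply: eq_bigr => m _.
rewrite !chrUZ; ring.
Qed.

(** [F_normal] with [T = 0], read backwards: it removes the first derivatives of the metric. *)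
Lemma F_subtract A B D E : (forall a b c, A a b c = A b a c) -> sym4 B ->
  F G A B D E = F G z3 (fun a b c d => B a b c d - qchr G A a b c d) D
    (fun a b c d => E a b c d - star G A D a b c d).
Proof.
move=> AS sB.
have [q1 q2] := qchr_sym4 A.
pose B' : T4 := fun a b c d => B a b c d - qchr G A a b c d.
pose E' : T4 := fun a b c d => E a b c d - star G A D a b c d.
have sB' : sym4 B' by split=> a b c d; rewrite /B'; [rewrite sB.1 q1|rewrite sB.2 q2].
have H := @F_normal _ _ _ L_inv G A B' D E' z4 lG sB' AS
  (fun _ _ _ _ => erefl) (fun _ _ _ _ => erefl).
rewrite -/B' -/E' -H; congr F; apply: fun4_ext => a b c d.
  by rewrite /symT /zero4 /B' addr0 addr0 subrK.
by rewrite /E' subrK.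
Qed.

(** [F_subtract] at [t] times the arguments is a polynomial identity in [t], because [qchr] and
    [star] are homogeneous of degree two; the pairing is its coefficient of degree three, up to the
    factor -2. *)
Lemma quad_normal A B D E : (forall a b c, A a b c = A b a c) -> sym4 B ->
  quad G (vec z3 B D E) (vec z3 (qchr G A) z3 (star G A D)) = 0.
Proof.
move=> AS sB.
set y := vec z3 B D E; set z := vec z3 (qchr G A) z3 (star G A D).
pose x := vec A B D E.
have H (t : R) : y0 + t * lin G x + t ^+ 2 * quad G x x =
    y0 + (t * lin G y - t ^+ 2 * lin G z)
    + (t ^+ 2 * quad G y y - 2 * t ^+ 3 * quad G y z + t ^+ 4 * quad G z z).
  have sc (A' : T3) (B' : T4) (D' : T3) (E' : T4) :
      vec (fun a b c => t * A' a b c) (fun a b c d => t * B' a b c d)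
      (fun a b c => t * D' a b c) (fun a b c d => t * E' a b c d) = t *: vec A' B' D' E'.
    have := vec_lin t A' B' D' E' z3 z4 z3 z4; rewrite vec0 addr0 => <-.
    by congr vec;
      [apply: fun3_ext|apply: fun4_ext|apply: fun3_ext|apply: fun4_ext] => *;
      rewrite /zero3 /zero4 addr0.
  have AS' a b c : t * A a b c = t * A b a c by rewrite AS.
  have sB' : sym4 (fun a b c d => t * B a b c d).
    by split=> a b c d; [rewrite sB.1|rewrite sB.2].
  have := @F_subtract (fun a b c => t * A a b c) (fun a b c d => t * B a b c d)
    (fun a b c => t * D a b c) (fun a b c d => t * E a b c d) AS' sB'.
  rewrite qchrZ starZ.
  rewrite (F_quadratic L_smooth L_third (fun a b c => t * A a b c) _ _ _ G0).
  rewrite (F_quadratic L_smooth L_third z3 _ _ _ G0) sc.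
  have -> : vec z3 (fun a b c d => t * B a b c d - t ^+ 2 * qchr G A a b c d)
     (fun a b c => t * D a b c) (fun a b c d => t * E a b c d - t ^+ 2 * star G A D a b c d)
     = t *: y + - t ^+ 2 *: z.
    have -> : - t ^+ 2 *: z = vec z3 (fun a b c d => - t ^+ 2 * qchr G A a b c d) z3
        (fun a b c d => - t ^+ 2 * star G A D a b c d).
      have := vec_lin (- t ^+ 2) z3 (qchr G A) z3 (star G A D) z3 z4 z3 z4.
      rewrite vec0 addr0 => <-.
      by congr vec;
      [apply: fun3_ext|apply: fun4_ext|apply: fun3_ext|apply: fun4_ext] => *;
        rewrite /zero3 /zero4 ?addr0 ?mulr0 ?addr0.
    rewrite -vec_lin; congr vec;
      [apply: fun3_ext|apply: fun4_ext|apply: fun3_ext|apply: fun4_ext] => *;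
        rewrite /zero3 /zero4; ring.
  rewrite !linD !linZ !quadDl !quadDr !quadZl !quadZr (quad_sym L_smooth G0 z y).
  move: (lin G x) (lin G y) (lin G z) (quad G x x) (quad G y y) (quad G y z) (quad G z z).
  rewrite -/y0; move: y0 => y1 a b c d e f g H.
  have -> : y1 + t * a + t ^+ 2 * d = y1 + t * a + t * (t * d) by ring.
  rewrite H; ring.
have H1 := H 1; have H2 := H (-1); have H3 := H 2; have H4 := H (-2).
move: H1 H2 H3 H4; rewrite !exprS !expr0.
move: (lin G x) (lin G y) (lin G z) (quad G x x) (quad G y y) (quad G y z) (quad G z z).
move=> a b c d e f g H1 H2 H3 H4; lra.
Qed.

Lemma qchr0 : qchr G z3 = z4.
Proof.
apply: fun4_ext => a b c d; rewrite qchrE big1 // => m _; rewrite big1 // => l _.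
by rewrite /chr /zero3; ring.
Qed.

Lemma star0l (D : T3) : star G z3 D = z4.
Proof.
apply: fun4_ext => a b c d; rewrite /star big1 // => m _.
have chrU0 m' u v : chrU G z3 m' u v = 0.
  by rewrite /chrU big1 // => l _; rewrite /chr /zero3; ring.
by rewrite !chrU0 !mul0r !addr0.
Qed.

Lemma star0r (A : T3) : star G A z3 = z4.
Proof.
by apply: fun4_ext => a b c d; rewrite /star big1 // => m _; rewrite /zero3 !mulr0 !addr0.
Qed.

Lemma symT_sym4 (T : T4) : (forall a b c d, T a b c d = T b a c d) ->
  (forall a b c d, T a b c d = T a c b d) -> sym4 (symT T).
Proof.
move=> T1 T2; split=> a b c d; first by rewrite /symT addrC.
by rewrite /symT (T2 a c) (T2 b c).
Qed.

Section SymT.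
Variable T : T4.
Hypothesis T1 : forall a b c d, T a b c d = T b a c d.
Hypothesis T2 : forall a b c d, T a b c d = T a c b d.

(** Adding [symT T] to [B] leaves [F] unchanged; this is the resulting increment of the quadratic
    polynomial. *)
Let inv_symT (B : T4) D E : sym4 B ->
  lin G (vB (symT T)) + 2 * quad G (vec z3 B D E) (vB (symT T))
    + quad G (vB (symT T)) (vB (symT T)) = 0.
Proof.
move=> sB.
have := @F_normal _ _ _ L_inv G z3 B D E T lG sB (fun _ _ _ => erefl) T1 T2.
rewrite qchr0 star0l.
rewrite (F_quadratic L_smooth L_third z3 B D E G0).
rewrite (F_quadratic L_smooth L_third z3 _ _ _ G0).
have -> : vec z3 (fun a b c d => B a b c d + z4 a b c d + symT T a b c d) D
    (fun a b c d => E a b c d + z4 a b c d) = 1 *: vec z3 B D E + vB (symT T).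
  rewrite -vec_lin; congr vec;
      [apply: fun3_ext|apply: fun4_ext|apply: fun3_ext|apply: fun4_ext]
    => *; rewrite /zero3 /zero4; ring.
rewrite scale1r linD !quadDl !quadDr (quad_sym L_smooth G0 (vB _) (vec _ _ _ _)).
move: (lin G _) (lin G _) (quad G _ _) (quad G _ _) (quad G _ _) (L _).
by move=> a b c d e f H; lra.
Qed.

(** Subtracting the same identity at the zero jet leaves only the cross term. *)
Lemma quad_symT (B : T4) D E : sym4 B -> quad G (vec z3 B D E) (vB (symT T)) = 0.
Proof.
move=> sB; have := inv_symT D E sB; have := @inv_symT z4 z3 z4 _.
rewrite vec0 => /(_ (conj (fun _ _ _ _ => erefl) (fun _ _ _ _ => erefl))).
have -> : quad G 0 (vB (symT T)) = 0 by rewrite /quad derive0 mulr0.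
move: (quad G (vec z3 B D E) _) (quad G (vB _) _) (lin G _) => a b c; lra.
Qed.

(** With [B = symT T], both quadratic terms of the increment vanish by [quad_symT]. *)
Lemma lin_symT : lin G (vB (symT T)) = 0.
Proof.
have := inv_symT z3 z4 (symT_sym4 T1 T2).
have := quad_symT z3 z4 (symT_sym4 T1 T2); rewrite -/(vB _) => ->.
by rewrite mulr0 !addr0.
Qed.

End SymT.

(** [kap_vanish] for the form [X |-> quad G _ (vB X)]. Taking [D = 0] makes [star] vanish, so that
    [quad_normal] supplies the condition on [qchr]. *)
Lemma quad_B E (B B' : T4) : sym4 B -> sym4 B' -> quad G (vec z3 B z3 E) (vB B') = 0.
Proof.
move=> sB sB'; apply: (@kap_vanish _ _ (fun X => quad G (vec z3 B z3 E) (vB X)) _ _ G) => //.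
- by move=> c X X'; rewrite vB_lin quadDr quadZr.
- by move=> T T1 T2; exact: quad_symT.
- by move=> A AS; have := quad_normal z3 E AS sB; rewrite star0r.
Qed.

(** The difference of [quad_normal] at [E] and at 0 removes the terms with [D] on the left; the
    remaining pairing with [qchr] vanishes by [quad_B]. *)
Lemma quad_star (E : T4) A D : (forall a b c, A a b c = A b a c) ->
  quad G (vE E) (vE (star G A D)) = 0.
Proof.
move=> AS; have s4 : sym4 z4 by [].
have := quad_normal D E AS s4; have := quad_normal D z4 AS s4.
rewrite !vec_split !quadDl !quadDr.
have vD0 : vD z3 = 0 by rewrite -[RHS]vec0.
have vB0 : vB z4 = 0 by rewrite -[RHS]vec0.
have vE0 : vE z4 = 0 by rewrite -[RHS]vec0.
have q0 w : quad G 0 w = 0 by rewrite /quad derive0 mulr0.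
have q0r w : quad G w 0 = 0 by rewrite (quad_sym L_smooth G0) q0.
have H := quad_B E s4 (qchr_sym4 A).
rewrite vec_split !quadDl vB0 vD0 !q0 !add0r in H.
rewrite ?vB0 ?vE0 ?vD0 !q0 !q0r H !add0r !addr0 => ->.
by rewrite add0r.
Qed.

(** The change of coordinates by -1 fixes tensors of even order and negates [D]. *)
Lemma F_parity (B : T4) D E : sym4 B ->
  F G z3 B (fun a b c => - D a b c) E = F G z3 B D E.
Proof.
move=> sB; have uJ : ((-1)%:M : 'M[R]_n) \in unitmx by rewrite unitmxE det_scalar unitrX ?unitrN1.
rewrite -(F_linear L_inv D E lG sB uJ).
have -> : ((-1)%:M : 'M[R]_n)^T *m G *m (-1)%:M = G.
  by rewrite tr_scalar_mx mul_scalar_mx mul_mx_scalar scalerA mulrNN mulr1 scale1r.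
have JE i a : ((-1)%:M : 'M[R]_n) i a = - @delta R n i a.
  by rewrite mxE /delta; case: eqP => _; rewrite ?mulr1n ?mulr0n ?oppr0.
have p4 (X : T4) : pull4 (-1)%:M X = X.
  apply: fun4_ext => a b c d.
  transitivity (\sum_i \sum_k \sum_l delta R i a * delta R k b * delta R l c * X i k l d).
    apply: eq_bigr => i _; apply: eq_bigr => k _; apply: eq_bigr => l _.
    rewrite -[in RHS](sum_delta (X i k l) d) mulr_sumr; apply: eq_bigr => m _.
    rewrite !JE; ring.
  exact: sum_delta3.
rewrite !p4; congr F; apply: fun3_ext => a b c.
rewrite -[in LHS](sum_delta3 D a b c) -[LHS]mulN1r mulr_sumr; apply: eq_bigr => i _.
rewrite mulr_sumr; apply: eq_bigr => k _; rewrite mulr_sumr; apply: eq_bigr => l _.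
by rewrite !JE; ring.
Qed.

(** [quad_B] removes the products of [B] with [B] and [E]; parity removes the terms of degree one in
    [D], namely the linear one and the products with [B] and [E], as a single sum. *)
Lemma F_structure0 (B : T4) D E : sym4 B ->
  F G z3 B D E = y0 + lin G (vB B) + lin G (vE E) + quad G (vD D) (vD D)
    + quad G (vE E) (vE E).
Proof.
move=> sB; have := F_parity D E sB.
rewrite (F_quadratic L_smooth L_third z3 B D E G0).
rewrite (F_quadratic L_smooth L_third z3 _ _ _ G0).
have vDN : vD (fun a b c => - D a b c) = -1 *: vD D.
  have vD0 : vD z3 = 0 by rewrite -[RHS]vec0.
  rewrite -[RHS]addr0 -vD0 -vD_lin; congr vD; apply: fun3_ext => *.
  by rewrite mulN1r /zero3 addr0.
rewrite !vec_split vDN !linD !quadDl !quadDr !linZ !quadZl !quadZr.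
have H1 := quad_B E sB sB.
rewrite vec_split !quadDl in H1.
have vD0 : vD z3 = 0 by rewrite -[RHS]vec0.
have q0 w : quad G 0 w = 0 by rewrite /quad derive0 mulr0.
rewrite vD0 q0 addr0 in H1.
have s4 : sym4 z4 by [].
have H2 := quad_B E s4 sB; rewrite vec_split !quadDl vD0 q0 addr0 in H2.
have vB0 : vB z4 = 0 by rewrite -[RHS]vec0.
rewrite vB0 q0 add0r in H2; rewrite H2 addr0 in H1.
rewrite H1 H2 (quad_sym L_smooth G0 (vB B) (vE E)) H2 (quad_sym L_smooth G0 (vD D) (vE E)).
rewrite (quad_sym L_smooth G0 (vD D) (vB B)) -/y0.
clear -y0; move: (lin G (vB B)) (lin G (vD D)) (lin G (vE E)) (quad G (vB B) (vD D)).
move: (quad G (vE E) (vD D)) (quad G (vD D) (vD D)) (quad G (vE E) (vE E)) (y0 : R).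
move=> q d s y b m e p H.
have {}H : m + 2 * p + 2 * q = 0 by lra.
lra.
Qed.

(** Replacing [E] by [E - star] leaves the quadratic term in [E] unchanged by [quad_star], so the
    correction survives only in the linear term. *)
Lemma F_structure A (B : T4) D E : (forall a b c, A a b c = A b a c) -> sym4 B ->
  F G A B D E = y0 + lin G (vB (fun a b c d => B a b c d - qchr G A a b c d))
    + lin G (vE (fun a b c d => E a b c d - star G A D a b c d))
    + quad G (vD D) (vD D) + quad G (vE E) (vE E).
Proof.
move=> AS sB; have [q1 q2] := qchr_sym4 A.
have sB' : sym4 (fun a b c d => B a b c d - qchr G A a b c d).
  by split=> a b c d; [rewrite sB.1 q1|rewrite sB.2 q2].
rewrite (F_subtract D E AS sB) (F_structure0 D _ sB').
pose E' : T4 := fun a b c d => E a b c d - star G A D a b c d.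
have vE' : vE E' = -1 *: vE (star G A D) + vE E.
  by rewrite -vE_lin; congr vE; apply: fun4_ext => *; rewrite /E'; ring.
have q X : quad G (vE (star G A D)) (vE X) = 0.
  by rewrite (quad_sym L_smooth G0) (quad_star X D AS).
have -> : quad G (vE E') (vE E') = quad G (vE E) (vE E).
  rewrite vE' !quadDl !quadDr !quadZl !quadZr !q (quad_star E D AS).
  by rewrite !mulr0 !add0r.
by [].
Qed.

End Structure.

(** * Behaviour of the terms under linear changes of coordinates *)

Section Transformation.
Variables (R : realType) (n : nat) (L : jet_space R n -> R^o).
Hypothesis L_smooth : smooth_on (@Y3 R n) L.
Hypothesis L_third : forall u v w : jet_space R n,
   jet_base u = 0 -> jet_base v = 0 -> jet_base w = 0 ->
   forall y, Y3 y -> 'D_u ('D_v ('D_w L)) y = 0.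
Hypothesis L_inv : forall (M : manifold R n) (g : lorentz_metric M)
   (nabla : connection M), exists f : M -> R, represents L g nabla f.
Notation T3 := ('I_n -> 'I_n -> 'I_n -> R).
Notation T4 := ('I_n -> 'I_n -> 'I_n -> 'I_n -> R).
Notation z3 := (@zero3 R n).
Notation z4 := (@zero4 R n).
Variables (G J : 'M[R]_n).
Hypothesis lG : lorentz_mx G.
Hypothesis uJ : J \in unitmx.
Let G' := J^T *m G *m J.
Let lG' : lorentz_mx G'. Proof. exact: lorentz_congr. Qed.

Let sym4z : sym4 z4. Proof. by []. Qed.

Lemma pull4_sym4 (B : T4) : sym4 B -> sym4 (pull4 J B).
Proof.
move=> [s1 s2]; split=> a b c d.
  rewrite /pull4 exchange_big /=; apply: eq_bigr => i _; apply: eq_bigr => k _.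
  apply: eq_bigr => l _; apply: eq_bigr => m _; rewrite s1; ring.
apply: eq_bigr => i _; apply: eq_bigr => k _; rewrite exchange_big /=.
apply: eq_bigr => l _; apply: eq_bigr => m _; rewrite s2; ring.
Qed.

Lemma pull40 : pull4 J z4 = z4.
Proof.
apply: fun4_ext => a b c d; rewrite /pull4 big1 // => i _; rewrite big1 // => k _.
by rewrite big1 // => l _; rewrite big1 // => m _; rewrite mulr0.
Qed.

Lemma pull30 : pull3 J z3 = z3.
Proof.
apply: fun3_ext => a b c; rewrite /pull3 big1 // => i _; rewrite big1 // => k _.
by rewrite big1 // => l _; rewrite mulr0.
Qed.

(** Invariance of the whole sum; the separate terms are extracted below by setting arguments to
    zero. *)
Lemma structure_transform (B : T4) D E : sym4 B ->
  L (base_point G') + lin L G' (vB (pull4 J B)) + lin L G' (vE (pull4 J E))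
    + quad L G' (vD (pull3 J D)) (vD (pull3 J D))
    + quad L G' (vE (pull4 J E)) (vE (pull4 J E))
  = L (base_point G) + lin L G (vB B) + lin L G (vE E) + quad L G (vD D) (vD D)
    + quad L G (vE E) (vE E).
Proof.
move=> sB.
have H1 := F_structure0 L_smooth L_third L_inv lG D E sB.
have H2 := F_structure0 L_smooth L_third L_inv lG' (pull3 J D) (pull4 J E) (pull4_sym4 sB).
apply: etrans (esym H2) _; apply: etrans _ H1.
exact: (F_linear L_inv D E lG sB uJ).
Qed.

Let vB0 : vB z4 = 0. Proof. by rewrite -[RHS]vec0. Qed.
Let vD0 : vD z3 = 0. Proof. by rewrite -[RHS]vec0. Qed.
Let vE0 : vE z4 = 0. Proof. by rewrite -[RHS]vec0. Qed.
Let lin0 H : lin L H 0 = 0. Proof. by rewrite /lin derive0. Qed.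
Let quad0 H w : quad L H 0 w = 0. Proof. by rewrite /quad derive0 mulr0. Qed.

Lemma base_transform : L (base_point G') = L (base_point G).
Proof.
have := structure_transform z3 z4 sym4z.
by rewrite pull40 pull30 ?vB0 ?vD0 ?vE0 !lin0 !quad0 !addr0.
Qed.

Lemma linB_transform (B : T4) : sym4 B -> lin L G' (vB (pull4 J B)) = lin L G (vB B).
Proof.
move=> sB; have := structure_transform z3 z4 sB.
rewrite pull40 pull30 ?vD0 ?vE0 !lin0 !quad0 !addr0 base_transform.
exact: addrI.
Qed.

Lemma quadD_transform (D : T3) :
  quad L G' (vD (pull3 J D)) (vD (pull3 J D)) = quad L G (vD D) (vD D).
Proof.
have := structure_transform D z4 sym4z.
rewrite pull40 ?vB0 ?vE0 !lin0 !quad0 !addr0 base_transform.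
exact: addrI.
Qed.

(** The sign change [E |-> - E] separates the odd term from the even one. *)
Lemma linE_quadE_transform (E : T4) : lin L G' (vE (pull4 J E)) = lin L G (vE E) /\
  quad L G' (vE (pull4 J E)) (vE (pull4 J E)) = quad L G (vE E) (vE E).
Proof.
have H1 := structure_transform z3 E sym4z.
have H2 := structure_transform z3 (fun a b c d => - E a b c d) sym4z.
have pN : pull4 J (fun a b c d => - E a b c d) = fun a b c d => - pull4 J E a b c d.
  apply: fun4_ext => a b c d; rewrite -[RHS]mulN1r mulr_sumr; apply: eq_bigr => i _.
  rewrite mulr_sumr; apply: eq_bigr => k _; rewrite mulr_sumr; apply: eq_bigr => l _.
  by rewrite mulr_sumr; apply: eq_bigr => m _; ring.
have vN (X : T4) : vE (fun a b c d => - X a b c d) = -1 *: vE X.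
  rewrite -[RHS]addr0 -vE0 -vE_lin; congr vE; apply: fun4_ext => *.
  by rewrite mulN1r /zero4 addr0.
rewrite pN !vN in H2.
rewrite pull40 pull30 in H1 H2.
rewrite base_transform in H1 H2.
have q0 H : quad L H (vD z3) (vD z3) = 0 by rewrite vD0 quad0.
have l0 H : lin L H (vB z4) = 0 by rewrite vB0 lin0.
rewrite !q0 !l0 in H1 H2.
rewrite (linZ L_smooth lG) (linZ L_smooth lG') in H2.
rewrite (quadZl L_smooth lG) (quadZl L_smooth lG') in H2.
rewrite (quadZr L_smooth lG) (quadZr L_smooth lG') in H2.
move: H1 H2.
move: (lin L G' _) (lin L G _) (quad L G' _ _) (quad L G _ _) (L _) => a b c d e H1 H2.
by split; lra.
Qed.

End Transformation.

(** * Invariants of the Lorentz group *)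

Section LorentzGroup.
Variables (R : realType) (n : nat).
Notation T4 := ('I_n -> 'I_n -> 'I_n -> 'I_n -> R).
Notation delta := (@delta R n).
Notation eta := (Defs.minkowski R n).

Definition esign (a : 'I_n) : R := if val a == 0%N then -1 else 1.

Lemma etaE a b : eta a b = esign a * delta a b.
Proof.
by rewrite mxE /esign /delta; case: eqP => _; rewrite ?mulr1 ?mulr0.
Qed.

Lemma esign_sq a : esign a * esign a = 1.
Proof. by rewrite /esign; case: ifP => _; rewrite ?mulrNN mulr1. Qed.

Lemma eta_lorentz : lorentz_mx eta.
Proof.
split; first by apply/matrixP => a b; rewrite !mxE eq_sym; case: eqP => // ->.
by exists 1%:M; rewrite ?unitmx1 // trmx1 mul1mx mulmx1.
Qed.

Lemma delta_sym a b : delta a b = delta b a.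
Proof. by rewrite /delta eq_sym. Qed.

Definition isometry (J : 'M[R]_n) := J^T *m eta *m J = eta.

Lemma isometryP (J : 'M[R]_n) :
  (forall b c, \sum_a esign a * (J a b * J a c) = esign b * delta b c) -> isometry J.
Proof.
move=> H; apply/matrixP => b c; rewrite etaE -H mxE; apply: eq_bigr => a _.
rewrite mxE (bigD1 a) //= big1 ?addr0 => [|k ka]; last first.
  by rewrite etaE /delta (negbTE ka) !mulr0.
rewrite etaE /delta eqxx mulr1 mxE; ring.
Qed.

Lemma isometry_unit J : isometry J -> J \in unitmx.
Proof. by move=> /esym; apply: lorentz_tr_unit; exact: eta_lorentz. Qed.

Definition reflection (i : 'I_n) : 'M[R]_n :=
  \matrix_(a, b) ((-1) ^+ (a == i) * delta a b).

Lemma reflection_isometry i : isometry (reflection i).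
Proof.
apply: isometryP => b c.
under eq_bigr do rewrite !mxE.
transitivity (\sum_a delta a b * (esign a * delta a c)).
  apply: eq_bigr => a _; case: (a == i); rewrite ?expr1 ?expr0; ring.
by rewrite sum_delta.
Qed.

(** A rotation or a boost of the plane of [y] and [y']. Row [y'] is left unspecified: the matrix is
    applied only to basis tensors built from [y] and indices outside the plane. *)
Lemma plane_isometry (y y' : 'I_n) : y != y' -> exists (J : 'M[R]_n) (al be : R),
  [/\ isometry J, be != 0, 1 - al ^+ 2 = esign y * esign y' * be ^+ 2,
      forall b, J y b = al * delta y b + be * delta y' b &
      forall a, a != y -> a != y' -> forall b, J a b = delta a b].
Proof.
move=> yy'; have dyy : delta y y' = 0 by rewrite /delta (negbTE yy').
have dyy' : delta y' y = 0 by rewrite delta_sym.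
pose s := - (esign y * esign y').
(* Rational points of the circle and of the hyperbola: [3, 4, 5] when the two signs agree, [5, 4, 3]
   when they differ. Only [be != 0] and the quadratic relation matter later. *)
have [al [be [be0 alE]]] : exists al be : R,
    be != 0 /\ 1 - al ^+ 2 = esign y * esign y' * be ^+ 2.
  have [ee|ee] := eqVneq (esign y * esign y') 1.
    exists (3 / 5), (4 / 5); split; last by rewrite ee; by field.
    by rewrite mulf_neq0 // invr_neq0 // pnatr_eq0.
  have ee' : esign y * esign y' = -1.
    move: ee; rewrite /esign; case: ifP => _; case: ifP => _;
      by rewrite ?mulrNN ?mulr1 ?mul1r ?eqxx.
  exists (5 / 3), (4 / 3); split; last by rewrite ee'; by field.
  by rewrite mulf_neq0 // invr_neq0 // pnatr_eq0.
pose p b := (al - 1) * delta y b + be * delta y' b.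
pose q b := s * be * delta y b + (al - 1) * delta y' b.
(* [p] and [q] are the deviations of rows [y] and [y'] from the identity; the sign [s] makes the
   resulting matrix preserve the Minkowski form. *)
exists (\matrix_(a, b) (delta a b + delta a y * p b + delta a y' * q b)), al, be.
have dy : delta y y = 1 by rewrite /delta eqxx.
have dy' : delta y' y' = 1 by rewrite /delta eqxx.
split=> //.
- apply: isometryP => b c.
  under eq_bigr do rewrite !mxE.
  transitivity (\sum_a (delta a b * (esign a * delta a c + esign a * delta a y * p c
        + esign a * delta a y' * q c)
    + delta a y * (esign a * p b * (delta a c + delta a y * p c + delta a y' * q c))
    + delta a y' * (esign a * q b * (delta a c + delta a y * p c + delta a y' * q c)))).
    by apply: eq_bigr => a _; ring.
  rewrite !big_split /= !sum_delta dy dy' dyy dyy' /p /q.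
  rewrite (delta_sym b y) (delta_sym b y').
  have ey := esign_sq y; have ey' := esign_sq y'.
  have e1 : esign y' * s = - esign y.
    by rewrite /s mulrN mulrCA ey' mulr1.
  have al2 : al ^+ 2 = 1 + s * be ^+ 2 by rewrite /s mulNr -alE; ring.
  have es : esign b * delta y b = esign y * delta y b.
    by rewrite /delta; case: eqP => [->|_]; rewrite ?mulr0.
  have es' : esign b * delta y' b = esign y' * delta y' b.
    by rewrite /delta; case: eqP => [->|_]; rewrite ?mulr0.
  have s2 : s * s = 1 by rewrite /s mulrNN mulrACA ey ey' mulr1.
  have e2 : esign y * s = - esign y' by rewrite /s mulrN mulrA ey mul1r.
  transitivity (esign b * delta b c
    + (esign b * delta y b) * ((al - 1) * delta y c + be * delta y' c)
    + (esign b * delta y' b) * (s * be * delta y c + (al - 1) * delta y' c)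
    + esign y * ((al - 1) * delta y b + be * delta y' b) *
        (al * delta y c + be * delta y' c)
    + (esign y' * s * be * delta y b + esign y' * (al - 1) * delta y' b) *
        (s * be * delta y c + al * delta y' c)).
    ring.
  rewrite es es' e1.
  have k1 : esign y * (al - 1) + esign y * (al - 1) * al - esign y * be * (s * be) = 0.
    transitivity (esign y * (al ^+ 2 - 1 - s * be ^+ 2)); first by ring.
    by rewrite al2; ring.
  have k2 : esign y' * (al - 1) + esign y * be ^+ 2 + esign y' * (al - 1) * al = 0.
    transitivity (esign y' * (al ^+ 2 - 1) + esign y * be ^+ 2); first by ring.
    rewrite al2; transitivity (esign y' * s * be ^+ 2 + esign y * be ^+ 2); first by ring.
    by rewrite e1; ring.
  have k3 : esign y' * s * be + esign y * be * al + esign y' * (al - 1) * (s * be) = 0.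
    transitivity (esign y' * s * be * al + esign y * be * al); first by ring.
    by rewrite e1; ring.
  transitivity (esign b * delta b c
     + (esign y * (al - 1) + esign y * (al - 1) * al - esign y * be * (s * be))
         * (delta y b * delta y c)
     + (esign y' * (al - 1) + esign y * be ^+ 2 + esign y' * (al - 1) * al)
         * (delta y' b * delta y' c)
     + (esign y' * s * be + esign y * be * al + esign y' * (al - 1) * (s * be))
         * (delta y' b * delta y c)); first by ring.
  by rewrite k1 k2 k3 !mul0r !addr0.
- by move=> b; rewrite mxE dy dyy /p; ring.
- move=> a ay ay' b; rewrite mxE.
  have -> : delta a y = 0 by rewrite /delta (negbTE ay).
  have -> : delta a y' = 0 by rewrite /delta (negbTE ay').
  ring.
Qed.

Lemma pull4_basis (J : 'M[R]_n) a b c d x y u v :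
  pull4 J (fun i k l m => delta a i * delta b k * delta c l * delta d m) x y u v
  = J a x * J b y * J c u * J d v.
Proof.
transitivity (\sum_i \sum_k \sum_l delta i a * delta k b * delta l c
   * (J i x * J k y * J l u * J d v)).
  apply: eq_bigr => i _; apply: eq_bigr => k _; apply: eq_bigr => l _.
  rewrite -(sum_delta (fun m => delta i a * delta k b * delta l c
     * (J i x * J k y * J l u * J m v)) d).
  apply: eq_bigr => m _.
  rewrite (delta_sym a i) (delta_sym b k) (delta_sym c l) (delta_sym d m); ring.
by rewrite sum_delta3.
Qed.

Lemma pull4_lin (J : 'M[R]_n) k B B' :
  pull4 J (fun x y u v => k * B x y u v + B' x y u v) =
  fun x y u v => k * pull4 J B x y u v + pull4 J B' x y u v.
Proof.
apply: fun4_ext => a b c d; rewrite mulr_sumr -big_split; apply: eq_bigr => i _ /=.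
rewrite mulr_sumr -big_split; apply: eq_bigr => j _ /=.
rewrite mulr_sumr -big_split; apply: eq_bigr => l _ /=.
rewrite mulr_sumr -big_split; apply: eq_bigr => m _ /=; ring.
Qed.

Lemma pull4_sym_basis (J : 'M[R]_n) a b c d :
  pull4 J (sym_basis R a b c d) = fun x y u v =>
    (J a x * J b y + J b x * J a y) * (J c u * J d v + J d u * J c v).
Proof.
have -> : sym_basis R a b c d = fun x y u v =>
   1 * (delta a x * delta b y * delta c u * delta d v)
   + (1 * (delta b x * delta a y * delta c u * delta d v)
   + (1 * (delta a x * delta b y * delta d u * delta c v)
     + delta b x * delta a y * delta d u * delta c v)).
  by apply: fun4_ext => x y u v; rewrite /sym_basis; ring.
rewrite !pull4_lin; apply: fun4_ext => x y u v; rewrite !pull4_basis; ring.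
Qed.

(** * Invariant linear forms on second derivatives of the metric *)

Section CurvatureInvariants.
Variable kap : T4 -> R.
Hypothesis kap_lin : linear4 kap.
Hypothesis kap_symT : forall T : T4, (forall a b c d, T a b c d = T b a c d) ->
  (forall a b c d, T a b c d = T a c b d) -> kap (symT T) = 0.
Hypothesis kap_inv : forall J B, isometry J -> sym4 B -> kap (pull4 J B) = kap B.

Let z a b c d := kap (sym_basis R a b c d).

Let z_sym12 a b c d : z a b c d = z b a c d.
Proof. by congr kap; apply: fun4_ext => x y u v; rewrite /sym_basis; ring. Qed.

Let z_sym34 a b c d : z a b c d = z a b d c.
Proof. by congr kap; apply: fun4_ext => x y u v; rewrite /sym_basis; ring. Qed.

Let z_cyclic a b c d : z a b c d + z c b a d + z d b a c = 0.
Proof. exact: kap_cyclic. Qed.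

(** The reflection in coordinate [i] multiplies such a basis tensor by -1. *)
Let z_parity i a b c d : odd ((a == i) + (b == i) + (c == i) + (d == i)) ->
  z a b c d = 0.
Proof.
move=> od; have := kap_inv (reflection_isometry i) (sym_basis_sym4 R a b c d).
have -> : pull4 (reflection i) (sym_basis R a b c d) = fun x y u v =>
    (-1) ^+ ((a == i) + (b == i) + (c == i) + (d == i)) * sym_basis R a b c d x y u v.
  rewrite pull4_sym_basis; apply: fun4_ext => x y u v; rewrite !mxE !exprD /sym_basis.
  ring.
rewrite lin4Z // -signr_odd od expr1 mulN1r -/(z a b c d) => /eqP.
rewrite eq_sym -subr_eq0 opprK -mulr2n mulrn_eq0 /= => /eqP; exact.
Qed.

(** Invariance under [plane_isometry]: the mixed terms vanish by parity, and the relation between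
    [al] and [be] allows division by [be ^+ 2]. *)
Let z_rotate x y y' : x != y -> x != y' -> y != y' ->
  esign x * esign y * z x y x y = esign x * esign y' * z x y' x y'.
Proof.
move=> xy xy' yy'; have [J [al [be [iJ be0 alE Jy Jx]]]] := plane_isometry yy'.
have := kap_inv iJ (sym_basis_sym4 R x y x y).
have -> : pull4 J (sym_basis R x y x y) = fun a b c d =>
   al ^+ 2 * sym_basis R x y x y a b c d + (be ^+ 2 * sym_basis R x y' x y' a b c d
   + (al * be * sym_basis R x y x y' a b c d + al * be * sym_basis R x y' x y a b c d)).
  rewrite pull4_sym_basis; apply: fun4_ext => a b c d; rewrite !Jy !Jx // /sym_basis; ring.
rewrite !kap_lin lin4Z // -!/(z _ _ _ _).
have -> : z x y x y' = 0.
  by apply: (@z_parity y); rewrite eqxx (negbTE xy) eq_sym (negbTE yy').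
have -> : z x y' x y = 0.
  by apply: (@z_parity y); rewrite eqxx (negbTE xy) eq_sym (negbTE yy').
rewrite !mulr0 !addr0 => H.
have {}H : be ^+ 2 * z x y' x y' = esign y * esign y' * be ^+ 2 * z x y x y.
  by rewrite -alE mulrBl mul1r -{1}H; ring.
have be2 : be ^+ 2 != 0 by rewrite expf_neq0.
have -> : z x y' x y' = esign y * esign y' * z x y x y.
  by apply: (mulfI be2); rewrite H; ring.
transitivity (esign x * esign y * (esign y' * esign y') * z x y x y); last by ring.
by rewrite esign_sq mulr1.
Qed.

Let coef x y := esign x * esign y * z x y x y.

Let coef_sym x y : coef x y = coef y x.
Proof. by rewrite /coef z_sym12 z_sym34; ring. Qed.

Let coef_step x y y' : x != y -> x != y' -> coef x y = coef x y'.
Proof. by move=> xy xy'; have [->//|yy'] := eqVneq y y'; exact: z_rotate. Qed.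

(** Any two pairs of distinct indices are joined by changing one index at a time. *)
Let coef_const x y x' y' : x != y -> x' != y' -> coef x y = coef x' y'.
Proof.
move=> xy xy'; have [xE|xy1] := eqVneq x y'.
  rewrite (coef_step xy (y' := x')) ?xE; last by rewrite eq_sym.
  by rewrite coef_sym.
rewrite (coef_step xy xy1) coef_sym (coef_step (y' := x')) 1?eq_sym //.
Qed.

(** By parity only indices matched in pairs contribute; the cyclic relation gives the value at
    [x, x, y, y] from that at [x, y, x, y], and 0 when all four agree. *)
Lemma curvature_coef : exists bb : R, forall a b c d, z a b c d =
  bb * (esign a * esign b * (delta a c * delta b d + delta a d * delta b c)
        - 2 * esign a * esign c * (delta a b * delta c d)).
Proof.
(* With fewer than two indices there is no such coefficient, and 0 serves as default. *)
have [bb Hbb] : exists bb, forall x y, x != y -> coef x y = bb.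
  have [/existsP[x /existsP[y xy]]|H] := boolP [exists x : 'I_n, exists y : 'I_n, x != y].
    by exists (coef x y) => x' y' xy'; exact: coef_const.
  exists 0 => x y xy; exfalso; move/negP: H; apply.
  by apply/existsP; exists x; apply/existsP; exists y.
exists bb.
have zxyxy x y : x != y -> z x y x y = bb * (esign x * esign y).
  move=> /Hbb <-; rewrite /coef.
  transitivity (esign x * esign x * (esign y * esign y) * z x y x y); last by ring.
  by rewrite !esign_sq !mul1r.
have zxxyy x y : x != y -> z x x y y = - 2 * bb * (esign x * esign y).
  move=> xy; have := z_cyclic x x y y.
  have -> : z y x x y = z x y x y by rewrite z_sym12.
  by rewrite zxyxy // => H; lra.
have zx x : z x x x x = 0 by have := z_cyclic x x x x => H; lra.
have d1 (a : 'I_n) : delta a a = 1 by rewrite /delta eqxx.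
have d0 (a b : 'I_n) : a != b -> delta a b = 0 by move=> ab; rewrite /delta (negbTE ab).
move=> a b c d.
have [<-{b}|ab] := eqVneq a b.
  have [<-{c}|ac] := eqVneq a c.
    have [<-{d}|ad] := eqVneq a d.
      by rewrite zx !d1; ring.
    rewrite (@z_parity d) ?(d0 a d) //; first by ring.
    by rewrite (negbTE ad) eqxx.
  have [<-{d}|cd] := eqVneq c d.
    by rewrite zxxyy // !d1 !(d0 a c) //; ring.
  rewrite (@z_parity c) ?(d0 a c) ?(d0 c d) //; first by ring.
  by rewrite (negbTE ac) eqxx eq_sym (negbTE cd).
have [<-{c}|ac] := eqVneq a c.
  have [<-{d}|bd] := eqVneq b d.
    by rewrite zxyxy // !d1 !(d0 a b) //; ring.
  rewrite (@z_parity b) ?(d0 a b) ?(d0 b d) //.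
    by rewrite (d0 b a) 1?eq_sym //; ring.
  by rewrite (negbTE ab) eqxx eq_sym (negbTE bd).
have [<-{d}|ad] := eqVneq a d.
  have [<-{c ac}|bc] := eqVneq b c.
    rewrite z_sym34 zxyxy // !d1 !(d0 a b) // (d0 b a) 1?eq_sym //; ring.
  rewrite (@z_parity b) ?(d0 a b) ?(d0 b c) //.
    by rewrite (d0 a c) //; ring.
  by rewrite (negbTE ab) eqxx eq_sym (negbTE bc).
rewrite (@z_parity a) ?(d0 a b) ?(d0 a c) ?(d0 a d) //; first by ring.
by rewrite eqxx eq_sym (negbTE ab) eq_sym (negbTE ac) eq_sym (negbTE ad).
Qed.

Lemma curvature_invariant : exists b : R, forall B, sym4 B ->
  kap B = b * \sum_x \sum_y esign x * esign y * (B x y x y - B x x y y).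
Proof.
have [bb zE] := curvature_coef; exists (bb / 2) => B sB.
(* Expansion gives [4^-1 * bb] times twice the difference of the two contractions, hence the
   constant [bb / 2]. *)
rewrite (sym4_expand kap_lin sB).
transitivity (4^-1 * bb * (\sum_a \sum_b \sum_c \sum_d
     (delta c a * (delta d b * (esign a * esign b * B a b c d)))
   + \sum_a \sum_b \sum_d \sum_c
     (delta d a * (delta c b * (esign a * esign b * B a b c d)))
   - 2 * \sum_a \sum_c \sum_b \sum_d
     (delta b a * (delta d c * (esign a * esign c * B a b c d))))).
  rewrite -!mulrA; congr (_ * _).
  rewrite [in X in _ - 2 * X](eq_bigr (fun a => \sum_b \sum_c \sum_d
     (delta b a * (delta d c * (esign a * esign c * B a b c d))))); last first.
    by move=> a _; rewrite exchange_big.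
  have -> : \sum_a \sum_b \sum_d \sum_c
     (delta d a * (delta c b * (esign a * esign b * B a b c d)))
    = \sum_a \sum_b \sum_c \sum_d
     (delta d a * (delta c b * (esign a * esign b * B a b c d))).
    by apply: eq_bigr => a _; apply: eq_bigr => b _; exact: exchange_big.
  rewrite mulr_sumr -big_split -sumrB mulr_sumr; apply: eq_bigr => a _ /=.
  rewrite mulr_sumr -big_split -sumrB mulr_sumr; apply: eq_bigr => b _ /=.
  rewrite mulr_sumr -big_split -sumrB mulr_sumr; apply: eq_bigr => c _ /=.
  rewrite mulr_sumr -big_split -sumrB mulr_sumr; apply: eq_bigr => d _ /=.
  rewrite -/(z a b c d) zE (delta_sym c a) (delta_sym d b) (delta_sym d a).
  rewrite (delta_sym c b) (delta_sym b a) (delta_sym d c); ring.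
have E1 : \sum_a \sum_b \sum_c \sum_d
     (delta c a * (delta d b * (esign a * esign b * B a b c d)))
   = \sum_a \sum_b esign a * esign b * B a b a b.
  apply: eq_bigr => a _; apply: eq_bigr => b _.
  by under eq_bigr do rewrite -mulr_sumr sum_delta; rewrite sum_delta.
have E2 : \sum_a \sum_b \sum_d \sum_c
     (delta d a * (delta c b * (esign a * esign b * B a b c d)))
   = \sum_a \sum_b esign a * esign b * B a b a b.
  apply: eq_bigr => a _; apply: eq_bigr => b _.
  by under eq_bigr do rewrite -mulr_sumr sum_delta; rewrite sum_delta sB.2.
have E3 : \sum_a \sum_c \sum_b \sum_d
     (delta b a * (delta d c * (esign a * esign c * B a b c d)))
   = \sum_a \sum_b esign a * esign b * B a a b b.
  apply: eq_bigr => a _; apply: eq_bigr => b _.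
  by under eq_bigr do rewrite -mulr_sumr sum_delta; rewrite sum_delta.
rewrite E1 E2 E3.
have -> : \sum_x \sum_y esign x * esign y * (B x y x y - B x x y y) =
   \sum_a \sum_b esign a * esign b * B a b a b - \sum_a \sum_b esign a * esign b * B a a b b.
  rewrite -sumrB; apply: eq_bigr => a _; rewrite -sumrB; apply: eq_bigr => b _; ring.
by field.
Qed.

End CurvatureInvariants.
End LorentzGroup.

(** * Permutations of multi-indices and alternation *)

Section PermTuples.
Variables (R : realType) (n r : nat).

Definition tperms (K : r.-tuple 'I_n) (p : 'S_r) : r.-tuple 'I_n :=
  [tuple tnth K (p t) | t < r].

Lemma tperms_mul K p q : tperms (tperms K p) q = tperms K (q * p)%g.
Proof. by apply: eq_from_tnth => t; rewrite !tnth_mktuple permM. Qed.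

Lemma tperms1 K : tperms K 1%g = K.
Proof. by apply: eq_from_tnth => t; rewrite tnth_mktuple perm1. Qed.

Lemma tperms_inj p : injective (tperms ^~ p).
Proof.
move=> K K' /(congr1 (tperms ^~ (p^-1)%g)).
by rewrite !tperms_mul mulVg !tperms1.
Qed.

Lemma sum_tperms (A : nmodType) (f : r.-tuple 'I_n -> A) p :
  \sum_K f (tperms K p) = \sum_K f K.
Proof.
rewrite [RHS](reindex (tperms ^~ p)) //=; apply: onW_bij.
exact: injF_bij (@tperms_inj p).
Qed.

(** Unlike [alternation], without the factor [1 / r!]. *)
Definition alt (E : r.-tuple 'I_n -> R) (K : r.-tuple 'I_n) : R :=
  \sum_(p : 'S_r) (-1) ^+ p * E (tperms K p).

Lemma alt_anti E K q : alt E (tperms K q) = (-1) ^+ q * alt E K.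
Proof.
rewrite /alt mulr_sumr (reindex (fun p => p * q^-1)%g) /=; last first.
  by apply: onW_bij; exists (fun p => p * q)%g => p; rewrite ?mulgKV ?mulgK.
apply: eq_bigr => p _; rewrite tperms_mul mulgKV odd_permM odd_permV.
by rewrite signr_addb mulrA [_ ^+ p * _]mulrC.
Qed.

(** The transposition of two equal entries fixes the multi-index and changes the sign. *)
Lemma anti_uniq (E : r.-tuple 'I_n -> R) K :
  (forall q, E (tperms K q) = (-1) ^+ q * E K) -> ~~ uniq K -> E K = 0.
Proof.
move=> H nu.
have [s [t [st Est]]] : exists s t : 'I_r, s != t /\ tnth K s = tnth K t.
  case: r K nu {H E} => [|r'] K nu; first by rewrite [K]tuple0 in nu.
  move: nu => /(uniqPn (thead K)) [s [t [st tr Est]]].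
  rewrite size_tuple in tr; have sr := ltn_trans st tr.
  exists (Ordinal sr), (Ordinal tr); split.
    by rewrite -val_eqE /= ltn_eqF.
  by rewrite !(tnth_nth (thead K)) /=.
have := H (tperm s t).
have -> : tperms K (tperm s t) = K.
  apply: eq_from_tnth => u; rewrite tnth_mktuple.
  by case: tpermP => [->|->|//]; rewrite Est.
rewrite odd_tperm st expr1 mulN1r => /eqP.
rewrite -subr_eq0 opprK -mulr2n mulrn_eq0 /= => /eqP; exact.
Qed.

(** A multi-index without repetition has [r!] distinct rearrangements, which carry all nonzero
    terms. *)
Lemma sum_perm_class (K : r.-tuple 'I_n) (f : r.-tuple 'I_n -> R) : uniq K ->
  (forall K', f K' != 0 -> perm_eq K K') ->
  (forall p, f (tperms K p) = f K) -> \sum_K' f K' = r`!%:R * f K.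
Proof.
move=> uK supp inv.
rewrite (bigID (mem (codom (tperms K)))) /= addrC big1 ?add0r; last first.
  move=> K' nK'; apply/eqP/negPn/negP => /supp; rewrite perm_sym => /tuple_permP[p E].
  move/negP: nK'; apply; apply/codomP.
  by exists p; apply: val_inj; rewrite /= E.
transitivity (\sum_(K' in codom (tperms K)) f K).
  by apply: eq_bigr => K' /codomP[p ->]; exact: inv.
rewrite sumr_const card_codom; last first.
  move=> p q E; apply/permP => t.
  have := congr1 (fun K => tnth K t) E; rewrite !tnth_mktuple => /tuple_uniqP; exact.
by rewrite card_Sn mulr_natl.
Qed.

End PermTuples.

(** Sorts permutations by the image of [i]. In the exterior derivative this image selects the index
    of differentiation. *)
Lemma sum_lift_perm (A : nmodType) m (i : 'I_m.+1) (f : 'S_m.+1 -> A) :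
  \sum_p f p = \sum_(s < m.+1) \sum_(q : 'S_m) f (lift_perm i s q).
Proof.
rewrite pair_big /= (reindex (fun x : 'I_m.+1 * 'S_m => lift_perm i x.1 x.2)) //=.
apply: onW_bij; apply: inj_card_bij => [[s q] [s' q'] /= E|]; last first.
  by rewrite card_prod card_ord !card_Sn factS.
have ss : s = s' by rewrite -(lift_perm_id i s q) E lift_perm_id.
congr pair => //; apply/permP => k; apply: (@lift_inj _ s).
by rewrite -(lift_perm_lift i s q k) E lift_perm_lift ss.
Qed.

(** * Forms that vanish on [star] are antisymmetric *)

Section Antisymmetry.
Variables (R : realType) (n : nat).
Notation T3 := ('I_n -> 'I_n -> 'I_n -> R).
Notation T4 := ('I_n -> 'I_n -> 'I_n -> 'I_n -> R).
Notation delta := (@delta R n).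
Notation eta := (Defs.minkowski R n).

Definition basis (a b c d : 'I_n) : T4 := fun x y u v =>
  delta a x * delta b y * delta c u * delta d v.

Variable zeta : T4 -> R.
Hypothesis zeta_lin : linear4 zeta.
Hypothesis zeta_star : forall A D, (forall a b c, A a b c = A b a c) ->
  zeta (star eta A D) = 0.

Let Z a b c d := zeta (basis a b c d).

(** For the chosen [A], [star] replaces one index of [D] equal to [m] by [p] and differentiates
    along [q], symmetrised in [p] and [q]. *)
Lemma star_equation a b c m p q :
  delta a m * (Z q b c p + Z p b c q) + delta b m * (Z a q c p + Z a p c q)
  + delta c m * (Z a b q p + Z a b p q) = 0.
Proof.
pose h x y := delta p x * delta q y + delta q x * delta p y.
have hS x y : h x y = h y x by rewrite /h; ring.
(* The symbols are prescribed first: raising the last index of [Gam] gives [delta k m * h x y].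
   Metric compatibility then dictates [A]. *)
pose Gam x y l := h x y * eta l m.
pose A : T3 := fun x y l => Gam x l y + Gam y l x.
have AS x y l : A x y l = A y x l by rewrite /A addrC.
have cA x y l : chr A x y l = Gam x y l.
  rewrite /chr /A /Gam (hS y x) (hS l x) (hS l y); by field.
have cU k x y : chrU eta A k x y = delta k m * h x y.
  transitivity ((invmx eta *m eta) k m * h x y).
    by rewrite mxE mulr_suml; apply: eq_bigr => l _; rewrite cA /Gam; ring.
  rewrite mulVmx ?minkowski_unit // mxE.
  by rewrite /delta; case: eqP => _; rewrite ?mulr1n ?mulr0n.
pose D : T3 := fun x y u => delta a x * delta b y * delta c u.
have := zeta_star D AS.
have -> : star eta A D = fun x y u v =>
    delta a m * (1 * basis q b c p x y u v + basis p b c q x y u v)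
    + (delta b m * (1 * basis a q c p x y u v + basis a p c q x y u v)
    + delta c m * (1 * basis a b q p x y u v + basis a b p q x y u v)).
  apply: fun4_ext => x y u v.
  transitivity (\sum_k delta k m * (h v x * D k y u + h v y * D x k u + h v u * D x y k)).
    by apply: eq_bigr => k _; rewrite !cU; ring.
  rewrite sum_delta /h /D /basis; ring.
have L1 k (B1 B2 : T4) : zeta (fun x y u v => k * (1 * B1 x y u v + B2 x y u v))
   = k * (zeta B1 + zeta B2) by rewrite lin4Z // zeta_lin mul1r.
rewrite lin4D // lin4D // !L1 -!/(Z _ _ _ _) => <-; ring.
Qed.

Let deltaE (x y : 'I_n) : delta x y = (x == y)%:R. Proof. by []. Qed.
Let d1 (x : 'I_n) : delta x x = 1. Proof. by rewrite deltaE eqxx. Qed.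
Let d0 (x y : 'I_n) : x != y -> delta x y = 0.
Proof. by move=> xy; rewrite deltaE (negbTE xy). Qed.

(** When [m] occurs exactly once in the multi-index of [D], a single group of [star_equation]
    survives. The next two facts place [m] in the other slots. *)
Let e1 m b c p q : m != b -> m != c -> Z q b c p + Z p b c q = 0.
Proof.
move=> mb mc; have := star_equation m b c m p q.
by rewrite d1 !(d0 (x := b)) 1?eq_sym // !(d0 (x := c)) 1?eq_sym // mul1r !mul0r !addr0.
Qed.

Let e2 m a c p q : m != a -> m != c -> Z a q c p + Z a p c q = 0.
Proof.
move=> ma mc; have := star_equation a m c m p q.
by rewrite d1 !(d0 (x := a)) 1?eq_sym // !(d0 (x := c)) 1?eq_sym // mul1r !mul0r addr0 add0r.
Qed.

Let e3 m a b p q : m != a -> m != b -> Z a b q p + Z a b p q = 0.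
Proof.
move=> ma mb; have := star_equation a b m m p q.
by rewrite d1 !(d0 (x := a)) 1?eq_sym // !(d0 (x := b)) 1?eq_sym // mul1r !mul0r !add0r.
Qed.

(* In dimension at most 2 no index [m] is available for [e1]-[e3]. *)
Let low_dim (x y : 'I_n) : (forall m, m = x \/ m = y) -> forall a b c d, Z a b c d = 0.
Proof.
move=> xy; have [E|nxy] := eqVneq x y.
  have all_x m : m = x by case: (xy m); rewrite E.
  move=> a b c d; rewrite (all_x a) (all_x b) (all_x c) (all_x d).
  have := star_equation x x x x x x; rewrite d1 => H; lra.
have nyx : y != x by rewrite eq_sym.
have H : forall x y : 'I_n, x != y ->
   [/\ Z x x x x = 0, Z x x x y = 0, Z x x y x = 0 & Z x y x x = 0] /\
   [/\ Z y x x x = 0, Z x x y y = 0, Z x y x y = 0 & Z y x x y = 0].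
  move=> {nyx nxy xy} {}x {}y xy; have yx : y != x by rewrite eq_sym.
  have a1 p q := @e1 y x x p q yx yx.
  have a2 p q := @e2 y x x p q yx yx.
  have a3 p q := @e3 y x x p q yx yx.
  have b1 := star_equation x x y x x x.
  rewrite d1 (d0 yx) mul0r addr0 !mul1r in b1.
  have := a1 x x; have := a1 x y; have := a1 y y.
  have := a2 x x; have := a2 x y; have := a2 y y.
  have := a3 x x; have := a3 x y; have := a3 y y.
  move: b1; move: (Z x x x x) (Z x x x y) (Z x x y x) (Z x y x x) (Z y x x x).
  move: (Z x x y y) (Z x y x y) (Z y x x y) => z1 z2 z3 z4 z5 z6 z7 z8.
  move=> H1 H2 H3 H4 H5 H6 H7 H8 H9 H10.
  by split; split; lra.
have [[h1 h2 h3 h4] [h5 h6 h7 h8]] := H x y nxy.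
have [[k1 k2 k3 k4] [k5 k6 k7 k8]] := H y x nyx.
by move=> a b c d; case: (xy a) => ->; case: (xy b) => ->; case: (xy c) => ->;
  case: (xy d) => ->.
Qed.

(** Each exchange with the last slot needs an index different from the two that stay fixed; if there
    is none, [low_dim] makes all values zero. *)
Lemma zeta_anti a b c d : [/\ Z a b c d = - Z d b c a, Z a b c d = - Z a d c b &
  Z a b c d = - Z a b d c].
Proof.
have K x y : (exists2 m : 'I_n, m != x & m != y) \/ forall a b c d, Z a b c d = 0.
  have [/existsP[m /andP[mx my]]|H] := boolP [exists m : 'I_n, (m != x) && (m != y)].
    by left; exists m.
  right; apply: (@low_dim x y) => m.
  have [->|mx] := eqVneq m x; first by left.
  have [->|my] := eqVneq m y; first by right.
  by exfalso; move/negP: H; apply; apply/existsP; exists m; rewrite mx my.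
split.
- have [[m mb mc]|Z0] := K b c; last by rewrite !Z0 oppr0.
  by apply/eqP; rewrite -subr_eq0 opprK; apply/eqP; exact: e1 mb mc.
- have [[m mb mc]|Z0] := K a c; last by rewrite !Z0 oppr0.
  by apply/eqP; rewrite -subr_eq0 opprK; apply/eqP; exact: e2 mb mc.
- have [[m mb mc]|Z0] := K a b; last by rewrite !Z0 oppr0.
  by apply/eqP; rewrite -subr_eq0 opprK; apply/eqP; exact: e3 mb mc.
Qed.

Definition tbasis (K : 4.-tuple 'I_n) : T4 :=
  basis (tnth K 0) (tnth K 1) (tnth K 2) (tnth K 3).

(** The transpositions with the last slot, treated in [zeta_anti], generate the symmetric group. *)
Lemma zeta_tperms K p : zeta (tbasis (tperms K p)) = (-1) ^+ p * zeta (tbasis K).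
Proof.
pose Q (p : 'S_4) := forall K, zeta (tbasis (tperms K p)) = (-1) ^+ p * zeta (tbasis K).
suff : Q p by apply.
have Q1 : Q 1%g by move=> K'; rewrite tperms1 odd_perm1 mul1r.
have QM q q' : Q q -> Q q' -> Q (q * q')%g.
  move=> Hq Hq' K'; rewrite -tperms_mul Hq Hq' odd_permM signr_addb mulrA.
  by [].
have Qt (s : 'I_4) : Q (tperm ord_max s).
  move=> K'; have [<-|ms] := eqVneq ord_max s.
    by rewrite tperm1 tperms1 odd_perm1 mul1r.
  rewrite odd_tperm ms expr1 mulN1r.
  have [A1 A2 A3] := zeta_anti (tnth K' 0) (tnth K' 1) (tnth K' 2) (tnth K' 3).
  have t3 : (3 : 'I_4) = ord_max by apply: val_inj.
  rewrite /tbasis !tnth_mktuple t3 tpermL -t3.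
  case: s ms => [[|[|[|[|//]]]] hs] ms.
  - rewrite (_ : Ordinal hs = 0); last exact: val_inj.
    by rewrite tpermR !tpermD // -[RHS]/(- Z _ _ _ _) A1 opprK.
  - rewrite (_ : Ordinal hs = 1); last exact: val_inj.
    by rewrite tpermR !tpermD // -[RHS]/(- Z _ _ _ _) A2 opprK.
  - rewrite (_ : Ordinal hs = 2); last exact: val_inj.
    by rewrite tpermR !tpermD // -[RHS]/(- Z _ _ _ _) A3 opprK.
  - by move: ms; rewrite (_ : Ordinal hs = ord_max) ?eqxx //; exact: val_inj.
have := finset.in_setT p; rewrite -(gen_tperm (ord_max : 'I_4)) => /gen_prodgP[m [c Hc ->]].
by elim/big_ind: _ => // i _; have /imsetP[s _ ->] := Hc i; exact: Qt.
Qed.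

Lemma zeta_expand E : zeta E = \sum_K uncurry4 E K * zeta (tbasis K).
Proof.
rewrite -(lin4_sum zeta_lin); congr zeta; apply: fun4_ext => x y u v.
rewrite sum_tuple4 -[LHS](sum_delta3 (fun a b c => E a b c v) x y u).
apply: eq_bigr => a _; apply: eq_bigr => b _; apply: eq_bigr => c _.
rewrite -[in LHS](sum_delta (E a b c) v) mulr_sumr; apply: eq_bigr => d _.
rewrite uncurry4E /tbasis /basis !(tnth_nth a) /=; ring.
Qed.

Lemma zeta_alt E : zeta (fun a b c d => alt (uncurry4 E) [tuple a; b; c; d]) = 24 * zeta E.
Proof.
rewrite zeta_expand (uncurry4K (alt (uncurry4 E))).
under eq_bigr do rewrite /alt mulr_suml.
rewrite exchange_big /=.
transitivity (\sum_(p : 'S_4) zeta E); last first.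
  by rewrite sumr_const card_Sn mulr_natl.
apply: eq_bigr => p _.
rewrite zeta_expand -(sum_tperms (fun K => uncurry4 E K * zeta (tbasis K)) p).
by apply: eq_bigr => K _; rewrite zeta_tperms mulrCA mulrA.
Qed.

End Antisymmetry.

(** * Invariant quadratic forms on tensors of order four *)

Section FourForms.
Variables (R : realType) (n : nat).
Notation T4 := ('I_n -> 'I_n -> 'I_n -> 'I_n -> R).
Notation eta := (Defs.minkowski R n).
Notation esign := (@esign R n).

Variable beta : T4 -> T4 -> R.
Hypothesis beta_lin : forall E, linear4 (beta E).
Hypothesis beta_sym : forall E E', beta E E' = beta E' E.
Hypothesis beta_star : forall E A D, (forall a b c, A a b c = A b a c) ->
  beta E (star eta A D) = 0.
Hypothesis beta_inv : forall J E, isometry J -> beta (pull4 J E) (pull4 J E) = beta E E.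

Let betaD E E' : beta (fun x y u v => 1 * E x y u v + E' x y u v)
   (fun x y u v => 1 * E x y u v + E' x y u v) = beta E E + 2 * beta E E' + beta E' E'.
Proof.
rewrite beta_lin !(beta_sym (fun x y u v => 1 * E x y u v + _)) !beta_lin (beta_sym E' E).
ring.
Qed.

Lemma beta_polar J E E' : isometry J -> beta (pull4 J E) (pull4 J E') = beta E E'.
Proof.
move=> iJ; have := beta_inv (fun x y u v => 1 * E x y u v + E' x y u v) iJ.
rewrite pull4_lin !betaD !beta_inv //.
move: (beta E E) (beta E' E') (beta E E') (beta (pull4 J E) _) => a b c d; lra.
Qed.

Let w (K K' : 4.-tuple 'I_n) : R := beta (tbasis R K) (tbasis R K').

Let w_tperms K K' p : w K (tperms K' p) = (-1) ^+ p * w K K'.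
Proof. by apply: zeta_tperms; [exact: beta_lin|exact: beta_star]. Qed.

Let w_sym K K' : w K K' = w K' K. Proof. exact: beta_sym. Qed.

Let w_diag K p : w (tperms K p) (tperms K p) = w K K.
Proof. by rewrite w_tperms w_sym w_tperms mulrA -signr_addb addbb mul1r. Qed.

Lemma pull4_reflection (i : 'I_n) (K : 4.-tuple 'I_n) : pull4 (reflection R i) (tbasis R K) =
  fun x y u v => (-1) ^+ count_mem i K * tbasis R K x y u v.
Proof.
apply: fun4_ext => x y u v; rewrite {2}(tuple4_eta K) /= addn0 !exprD.
rewrite [LHS]pull4_basis !mxE /tbasis /basis; ring.
Qed.

(** The reflection in [i] multiplies the pairing by -1 to the total multiplicity of [i]. *)
Let w_parity K K' : w K K' != 0 -> forall i, ~~ odd (count_mem i K + count_mem i K').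
Proof.
move=> w0 i; apply/negP => od.
have := beta_polar (tbasis R K) (tbasis R K') (reflection_isometry R i).
rewrite !pull4_reflection (lin4Z (beta_lin _)) beta_sym (lin4Z (beta_lin _)) mulrA.
rewrite -exprD addnC -signr_odd od expr1 beta_sym -/(w K K') mulN1r => /eqP.
by rewrite eq_sym -subr_eq0 opprK -mulr2n mulrn_eq0 /= (negbTE w0).
Qed.

(** Antisymmetry excludes repeated entries, and parity then forces the two multi-indices to contain
    the same indices. *)
Let w_supp K K' : w K K' != 0 -> [/\ uniq K, uniq K' & perm_eq K K'].
Proof.
move=> w0.
have uK' : uniq K'.
  by apply/negPn/negP => /(anti_uniq (w_tperms K K')) E; rewrite E eqxx in w0.
have uK : uniq K.
  apply/negPn/negP => /(anti_uniq (w_tperms K' K)) E.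
  by rewrite w_sym E eqxx in w0.
split=> //; apply: uniq_perm => // i.
have := w_parity w0 i; rewrite !count_uniq_mem //.
by case: (i \in K); case: (i \in K').
Qed.

Let esignT (K : 4.-tuple 'I_n) : R := \prod_(s < 4) esign (tnth K s).

Let esignT_sq K : esignT K * esignT K = 1.
Proof. by rewrite -big_split big1 // => s _; exact: esign_sq. Qed.

Let esignT_perm (K K' : 4.-tuple 'I_n) : perm_eq K K' -> esignT K = esignT K'.
Proof.
have E (T : 4.-tuple 'I_n) : esignT T = \prod_(x <- T) esign x.
  by rewrite big_tuple.
by rewrite !E; exact: perm_big.
Qed.

Let coef K := esignT K * w K K.

Let coef_perm (K K' : 4.-tuple 'I_n) : perm_eq K K' -> coef K = coef K'.
Proof.
move=> pKK'; rewrite /coef (esignT_perm pKK').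
move: pKK' => /tuple_permP[p E].
have -> : K = tperms K' p by exact: val_inj.
by rewrite w_diag.
Qed.

(** As for the curvature: a plane isometry replaces one index, the cross pairing vanishes by parity,
    and [be ^+ 2] is divided out. *)
Let coef_rotate y y' b c d : uniq [:: y; b; c; d] -> y' \notin [:: y; b; c; d] ->
  coef [tuple y; b; c; d] = coef [tuple y'; b; c; d].
Proof.
move=> uK; rewrite !inE !negb_or => /and4P[yy' y'b y'c y'd].
move: uK; rewrite /= !inE !negb_or => /and4P[/and3P[yb yc yd] /andP[bc bd] cd _].
rewrite eq_sym in yy'; have [J [al [be [iJ be0 alE Jy Jx]]]] := plane_isometry R yy'.
have tbE (a : 'I_n) : tbasis R [tuple a; b; c; d] = basis R a b c d.
  by rewrite /tbasis !(tnth_nth a).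
have pE : pull4 J (basis R y b c d) = fun x z u v =>
    al * basis R y b c d x z u v + be * basis R y' b c d x z u v.
  apply: fun4_ext => x z u v; rewrite pull4_basis Jy !Jx 1?eq_sym // /basis; ring.
have w0 : w [tuple y; b; c; d] [tuple y'; b; c; d] = 0.
  apply/eqP/negPn/negP => /w_parity /(_ y) /=.
  rewrite eqxx (eq_sym y' y) (negbTE yy') (eq_sym b y) (negbTE yb) (eq_sym c y).
  by rewrite (negbTE yc) (eq_sym d y) (negbTE yd).
have := beta_inv (basis R y b c d) iJ.
rewrite pE; set f := fun x z u v => al * _ + _.
have bf E : beta f E = al * beta (basis R y b c d) E + be * beta (basis R y' b c d) E.
  by rewrite beta_sym beta_lin (lin4Z (beta_lin _)) !(beta_sym E).
rewrite bf !(beta_sym _ f) !bf -!tbE -!/(w _ _) (w_sym [tuple y'; b; c; d] [tuple y; b; c; d]) w0.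
rewrite !mulr0 !addr0 !add0r => H.
have {}H : be ^+ 2 * w [tuple y'; b; c; d] [tuple y'; b; c; d]
   = be ^+ 2 * (esign y * esign y' * w [tuple y; b; c; d] [tuple y; b; c; d]).
  transitivity (esign y * esign y' * be ^+ 2 * w [tuple y; b; c; d] [tuple y; b; c; d]).
    by rewrite -alE mulrBl mul1r -{1}H; ring.
  ring.
have {}H := mulfI (_ : be ^+ 2 != 0) H.
rewrite /coef H ?expf_neq0 //.
have eT (a : 'I_n) : esignT [tuple a; b; c; d] = esign a * esign b * esign c * esign d.
  by rewrite /esignT (prod_tuple4 (fun _ => esign)).
rewrite !eT; transitivity ((esign y' * esign y') * (esign y * esign b * esign c * esign d)
   * w [tuple y; b; c; d] [tuple y; b; c; d]); first by rewrite esign_sq mul1r.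
ring.
Qed.

(** A transposition of the index set either leaves the entries unchanged as a set or replaces one
    entry by a new index, which is [coef_rotate] up to order. *)
Let coef_tperm (K : 4.-tuple 'I_n) y y' : uniq K ->
  coef [tuple of map (tperm y y') K] = coef K.
Proof.
wlog yK : y y' / y \in K => [H uK|uK].
  have [yK|yK] := boolP (y \in K); first exact: H.
  have [y'K|y'K] := boolP (y' \in K); first by rewrite tpermC; exact: H.
  congr coef; apply: val_inj => /=; rewrite -[RHS]map_id; apply/eq_in_map => x xK.
  by rewrite tpermD //; [apply: contraNneq yK => ->|apply: contraNneq y'K => ->].
have [y'K|y'K] := boolP (y' \in K).
  apply: coef_perm; apply: uniq_perm => //.
    by rewrite map_inj_uniq //; exact: perm_inj.
  move=> x; rewrite -[x in x \in map _ _](tpermK y y') mem_map; last exact: perm_inj.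
  by case: tpermP => // ->; rewrite yK y'K.
have pK := perm_to_rem yK; set r := rem y K in pK.
have sr : size r = 3 by rewrite size_rem // size_tuple.
case: r sr pK => [|b [|c [|d [|]]]] //= _ pK.
have uy : uniq [:: y; b; c; d] by rewrite -(perm_uniq pK).
have y'n : y' \notin [:: y; b; c; d] by rewrite -(perm_mem pK).
rewrite (@coef_perm K [tuple y; b; c; d]) // (coef_rotate uy y'n).
apply: coef_perm => /=.
have := perm_map (tperm y y') pK; rewrite /= tpermL.
move: uy y'n; rewrite /= !inE !negb_or.
move=> /and4P[/and3P[yb yc yd] _ _ _] /and4P[_ y'b y'c y'd].
by rewrite !tpermD.
Qed.

(** [K] is transformed into [K'] slot by slot with transpositions; earlier slots stay fixed because
    neither multi-index has repetitions. *)
Let coef_const (K K' : 4.-tuple 'I_n) : uniq K -> uniq K' -> coef K = coef K'.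
Proof.
move=> uK uK'.
suff step j : (j <= 4)%N -> exists K1 : 4.-tuple 'I_n, [/\ uniq K1, coef K1 = coef K &
    forall s : 'I_4, (s < j)%N -> tnth K1 s = tnth K' s].
  have [K1 [_ <- E]] := step 4%N (leqnn 4).
  by congr coef; apply: eq_from_tnth => s; exact: E.
elim: j => [|j IH] j4; first by exists K.
have [K1 [uK1 cK1 E]] := IH (ltnW j4).
pose sj := Ordinal j4.
pose t := tperm (tnth K1 sj) (tnth K' sj).
exists [tuple of map t K1]; split.
- by rewrite map_inj_uniq //; exact: perm_inj.
- by rewrite coef_tperm.
move=> s; rewrite ltnS leq_eqVlt => /predU1P[sE|sj'].
  have -> : s = sj by apply: val_inj.
  by rewrite tnth_map /t tpermL.
have ns : sj != s by rewrite -val_eqE /= gtn_eqF.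
rewrite tnth_map E // /t tpermD //.
  by rewrite -E //; apply: contraNneq ns => /(tuple_uniqP _ uK1) ->.
by apply: contraNneq ns => /(tuple_uniqP _ uK') ->.
Qed.

Lemma four_form_invariant : exists c : R, forall E, beta E E =
  c * \sum_(K : 4.-tuple 'I_n) (\prod_(s < 4) esign (tnth K s)) * alt (uncurry4 E) K ^+ 2.
Proof.
have [c0 Hc] : exists c0, forall K : 4.-tuple 'I_n, uniq K -> coef K = c0.
  have [/existsP[K uK]|H] := boolP [exists K : 4.-tuple 'I_n, uniq K].
    by exists (coef K) => K' uK'; exact: coef_const.
  by exists 0 => K uK; exfalso; move/negP: H; apply; apply/existsP; exists K.
(* Antisymmetrising both arguments costs [24 ^ 2 = 576], while each class of rearrangements
   contributes [4! = 24] equal terms; the quotient is [1 / 24]. *)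
exists (c0 / 24) => E.
pose W := alt (uncurry4 E); pose cW : T4 := fun a b c d => W [tuple a; b; c; d].
have bW X : beta X cW = 24 * beta X E.
  by apply: zeta_alt; [exact: beta_lin|exact: beta_star].
have -> : beta E E = 576^-1 * beta cW cW.
  by rewrite bW beta_sym bW; field.
have WE : uncurry4 cW = W by exact: uncurry4K.
have -> : beta cW cW = \sum_K W K * \sum_K' W K' * w K K'.
  rewrite (zeta_expand (beta_lin cW)) WE; apply: eq_bigr => K _; congr (_ * _).
  by rewrite beta_sym (zeta_expand (beta_lin _)) WE.
rewrite !mulr_sumr; apply: eq_bigr => K _.
rewrite -/(W K) -/(esignT K).
have [uK|nuK] := boolP (uniq K); last first.
  have -> : W K = 0 by apply: (anti_uniq _ nuK) => q; exact: alt_anti.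
  by rewrite mul0r expr0n !mulr0.
rewrite (@sum_perm_class R n 4 K (fun K' => W K' * w K K') uK); first last.
- by move=> p; rewrite w_tperms /W alt_anti mulrACA -signr_addb addbb mul1r.
- move=> K'; rewrite mulf_eq0 negb_or => /andP[_ /w_supp[]//].
have -> : w K K = c0 * esignT K.
  by rewrite -(Hc K uK) /coef mulrAC esignT_sq mul1r.
have -> : (4`!)%:R = 24 :> R by [].
by field.
Qed.

End FourForms.

(** * Arbitrary Lorentz matrices *)

Section Slices.
Variables (R : realType) (V W : normedModType R).

Let slice (v : V) : V * W := (v, 0).

Lemma slice_is_linear : linear slice.
Proof.
by move=> k u v; apply: injective_projections; rewrite /= ?scaler0 ?addr0.
Qed.

HB.instance Definition _ := GRing.isLinear.Build R V (V * W)%type *:%R slice slice_is_linear.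

Lemma slice_continuous : continuous slice.
Proof. by move=> w; apply: cvg_pair; [exact: cvg_id|exact: cvg_cst]. Qed.

(** Applied once for each of the four derivative slots of [jet_space], this restricts smooth
    functions of jets to [base_point]. *)
Lemma smooth_slice (U : set (V * W)%type) (f : V * W -> R^o) : open U -> smooth_on U f ->
  open [set v | U (v, 0)] /\ smooth_on [set v | U (v, 0)] (fun v => f (v, 0)).
Proof.
move=> oU sf.
have oS : open [set v : V | U (v, 0)].
  by apply: (@open_comp _ _ slice) => // w _; exact: slice_continuous.
have dS v : differentiable slice v.
  by apply: linear_differentiable; exact: slice_continuous.
split=> // k; apply: (@Ck_comp_affine R _ _ k _ U slice slice f) => // u v _.
by rewrite deriveE // diff_lin //; exact: slice_continuous.
Qed.

End Slices.

Section GeneralMetric.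
Variables (R : realType) (n : nat) (L : jet_space R n -> R^o).
Hypothesis L_smooth : smooth_on (@Y3 R n) L.
Hypothesis L_third : forall u v w : jet_space R n,
   jet_base u = 0 -> jet_base v = 0 -> jet_base w = 0 ->
   forall y, Y3 y -> 'D_u ('D_v ('D_w L)) y = 0.
Hypothesis L_inv : forall (M : manifold R n) (g : lorentz_metric M)
   (nabla : connection M), exists f : M -> R, represents L g nabla f.
Notation T3 := ('I_n -> 'I_n -> 'I_n -> R).
Notation T4 := ('I_n -> 'I_n -> 'I_n -> 'I_n -> R).
Notation eta := (Defs.minkowski R n).
Notation esign := (@esign R n).
Notation lin := (lin L).
Notation quad := (quad L).

(* The scalar curvature as a function of [g] and of its second derivatives [B]
   at the centre of normal coordinates. *)
Definition scalS (G : 'M[R]_n) (B : T4) : R :=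
  \sum_i \sum_j \sum_k \sum_l invmx G i j * invmx G k l * (B i k j l - B i j k l).

(** The pointwise form of [sqnorm], with the metric entering only through its matrix. *)
Definition normS (G : 'M[R]_n) r (T : r.-tuple 'I_n -> R) : R :=
  \sum_(I : r.-tuple 'I_n) \sum_(J : r.-tuple 'I_n)
    (\prod_(s < r) invmx G (tnth I s) (tnth J s)) * T I * T J.

Lemma lorentz_frame (G : 'M[R]_n) : lorentz_mx G ->
  exists2 J : 'M[R]_n, J \in unitmx & J^T *m G *m J = eta.
Proof. by move=> [_ [P uP PG]]; exists P^T; rewrite ?unitmx_tr ?trmxK. Qed.

(** The columns of [J] form an orthonormal frame, in which the inverse metric is diagonal with
    entries [esign]. *)
Lemma frame_inverse (G J : 'M[R]_n) i j : G \in unitmx -> J \in unitmx ->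
  J^T *m G *m J = eta -> invmx G i j = \sum_x esign x * (J i x * J j x).
Proof.
move=> uG uJ E; rewrite -(pullback_invmx uG uJ (esym E)).
have -> : invmx eta = eta.
  apply: (@row_free_inj _ _ _ n eta).
    by rewrite row_free_unit minkowski_unit.
  by rewrite mulVmx ?minkowski_unit // minkowski_sq.
rewrite mxE; apply: eq_bigr => x _; rewrite [J^T _ _]mxE mxE (bigD1 x) //=.
rewrite big1 ?addr0; first by rewrite etaE /delta eqxx mulr1; ring.
by move=> k kx; rewrite etaE /delta (negbTE kx) !mulr0.
Qed.

(** The constant is found at the Minkowski matrix; a frame carries the identity to [G], where the
    contraction over frame indices becomes one with the inverse metric. *)
Lemma linB_invariant : exists b : R, forall G B, lorentz_mx G -> sym4 B ->
  lin G (vB B) = b * scalS G B.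
Proof.
have leta := eta_lorentz R n.
have [|T T1 T2|J B iJ sB|b Hb] := @curvature_invariant R n (fun B => lin eta (vB B)).
- by move=> c B B'; rewrite vB_lin (linD L_smooth leta) (linZ L_smooth leta).
- exact: (lin_symT L_smooth L_third L_inv leta T1 T2).
- have := linB_transform L_smooth L_third L_inv leta (isometry_unit iJ) sB.
  by rewrite iJ.
exists b => G B lG sB; have [J uJ JG] := lorentz_frame lG.
have := linB_transform L_smooth L_third L_inv lG uJ sB; rewrite JG => <-.
rewrite (Hb _ (pull4_sym4 J sB)); congr (_ * _).
have uG := lorentz_unit lG.
have inv i j := frame_inverse i j uG uJ JG.
transitivity (\sum_x \sum_y \sum_i \sum_j \sum_k \sum_l
    esign x * (J i x * J j x) * (esign y * (J k y * J l y)) * (B i k j l - B i j k l)).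
  apply: eq_bigr => x _; apply: eq_bigr => y _.
  have E1 : pull4 J B x y x y =
      \sum_i \sum_j \sum_k \sum_l J i x * J k y * J j x * J l y * B i k j l.
    apply: eq_bigr => i _; rewrite exchange_big /=; apply: eq_bigr => j _.
    by apply: eq_bigr => k _.
  have E2 : pull4 J B x x y y =
      \sum_i \sum_j \sum_k \sum_l J i x * J j x * J k y * J l y * B i j k l by [].
  rewrite E1 E2 -sumrB mulr_sumr; apply: eq_bigr => i _.
  rewrite -sumrB mulr_sumr; apply: eq_bigr => j _.
  rewrite -sumrB mulr_sumr; apply: eq_bigr => k _.
  rewrite -sumrB mulr_sumr; apply: eq_bigr => l _; ring.
rewrite /scalS.
(* From here the sums over the frame indices [x] and [y] are moved innermost, where they assemble
   the two inverse metrics. *)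
transitivity (\sum_i \sum_x \sum_y \sum_j \sum_k \sum_l
    esign x * (J i x * J j x) * (esign y * (J k y * J l y)) * (B i k j l - B i j k l)).
  rewrite [RHS]exchange_big /=; apply: eq_bigr => x _; exact: exchange_big.
apply: eq_bigr => i _.
transitivity (\sum_j \sum_x \sum_y \sum_k \sum_l
    esign x * (J i x * J j x) * (esign y * (J k y * J l y)) * (B i k j l - B i j k l)).
  rewrite [RHS]exchange_big /=; apply: eq_bigr => x _; exact: exchange_big.
apply: eq_bigr => j _.
transitivity (\sum_k \sum_x \sum_y \sum_l
    esign x * (J i x * J j x) * (esign y * (J k y * J l y)) * (B i k j l - B i j k l)).
  rewrite [RHS]exchange_big /=; apply: eq_bigr => x _; exact: exchange_big.
apply: eq_bigr => k _.
transitivity (\sum_l \sum_x \sum_y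
    esign x * (J i x * J j x) * (esign y * (J k y * J l y)) * (B i k j l - B i j k l)).
  rewrite [RHS]exchange_big /=; apply: eq_bigr => x _; exact: exchange_big.
apply: eq_bigr => l _; rewrite !inv mulr_suml mulr_suml; apply: eq_bigr => x _.
by rewrite mulr_sumr mulr_suml; apply: eq_bigr => y _.
Qed.

Definition pullT (J : 'M[R]_n) r (T : r.-tuple 'I_n -> R) (K : r.-tuple 'I_n) : R :=
  \sum_(I : r.-tuple 'I_n) (\prod_(s < r) J (tnth I s) (tnth K s)) * T I.

Lemma pull4_pullT J E : uncurry4 (pull4 J E) = pullT J (uncurry4 E).
Proof.
rewrite -[RHS]uncurry4K; congr uncurry4; apply: fun4_ext => a b c d.
rewrite /pullT sum_tuple4; apply: eq_bigr => i _; apply: eq_bigr => j _.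
apply: eq_bigr => k _; apply: eq_bigr => l _; rewrite uncurry4E.
by rewrite 3!big_ord_recl big_ord1 !(tnth_nth i) /= !mulrA.
Qed.

Lemma alt_pullT J r (T : r.-tuple 'I_n -> R) K :
  alt (pullT J T) K = pullT J (alt T) K.
Proof.
rewrite /alt /pullT; under [RHS]eq_bigr do rewrite mulr_sumr.
rewrite [RHS]exchange_big /=; apply: eq_bigr => p _; rewrite mulr_sumr.
rewrite -[LHS](sum_tperms _ p); apply: eq_bigr => I _.
have -> : \prod_(s < r) J (tnth (tperms I p) s) (tnth (tperms K p) s)
    = \prod_(s < r) J (tnth I s) (tnth K s).
  rewrite [RHS](reindex_inj (@perm_inj _ p)) /=.
  by apply: eq_bigr => s _; rewrite !tnth_mktuple.
by rewrite mulrCA.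
Qed.

Lemma normS_frame (G J : 'M[R]_n) r (T : r.-tuple 'I_n -> R) :
  G \in unitmx -> J \in unitmx -> J^T *m G *m J = eta ->
  normS G T = \sum_(K : r.-tuple 'I_n) (\prod_(s < r) esign (tnth K s)) * pullT J T K ^+ 2.
Proof.
move=> uG uJ JG; rewrite /normS.
transitivity (\sum_I \sum_J' \sum_(K : r.-tuple 'I_n)
    (\prod_(s < r) esign (tnth K s)) * ((\prod_(s < r) J (tnth I s) (tnth K s)) * T I)
     * ((\prod_(s < r) J (tnth J' s) (tnth K s)) * T J')).
  apply: eq_bigr => I _; apply: eq_bigr => J' _.
  have -> : \prod_(s < r) invmx G (tnth I s) (tnth J' s) =
      \sum_(K : r.-tuple 'I_n) \prod_(s < r)
        (esign (tnth K s) * (J (tnth I s) (tnth K s) * J (tnth J' s) (tnth K s))).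
    rewrite -(prod_sum_tuple (fun s x => esign x * (J (tnth I s) x * J (tnth J' s) x))).
    by apply: eq_bigr => s _; exact: frame_inverse.
  rewrite !mulr_suml; apply: eq_bigr => K _.
  rewrite big_split big_split /=; ring.
under eq_bigr do rewrite exchange_big /=.
rewrite exchange_big /=; apply: eq_bigr => K _.
rewrite /pullT expr2 mulrA [X in _ = X * _]mulr_sumr mulr_suml; apply: eq_bigr => I _.
by rewrite mulr_sumr.
Qed.

(** Same transport along a frame; alternation commutes with the pullback by [alt_pullT]. *)
Lemma quadE_invariant : exists c : R, forall G E, lorentz_mx G ->
  quad G (vE E) (vE E) = c * normS G (alt (uncurry4 E)).
Proof.
have leta := eta_lorentz R n.
have det_eta : \det eta != 0 by have := lorentz_unit leta; rewrite unitmxE unitfE.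
have [|E E'|E A D AS|J E iJ|c Hc] :=
  @four_form_invariant R n (fun E E' => quad eta (vE E) (vE E')).
- by move=> E c B B'; rewrite vE_lin (quadDr L_smooth leta) (quadZr L_smooth leta).
- exact: (quad_sym L_smooth det_eta).
- exact: (quad_star L_smooth L_third L_inv leta E D AS).
- have [_] := linE_quadE_transform L_smooth L_third L_inv leta (isometry_unit iJ) E.
  by rewrite iJ.
exists c => G E lG; have [J uJ JG] := lorentz_frame lG.
have [_] := linE_quadE_transform L_smooth L_third L_inv lG uJ E; rewrite JG => <-.
rewrite Hc (normS_frame _ (lorentz_unit lG) uJ JG); congr (_ * _).
by apply: eq_bigr => K _; rewrite pull4_pullT alt_pullT.
Qed.

Lemma base_invariant G : lorentz_mx G -> L (base_point G) = L (base_point eta).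
Proof.
move=> lG; have [J uJ JG] := lorentz_frame lG.
by have := base_transform L_smooth L_third L_inv lG uJ; rewrite JG.
Qed.

Definition tbasis3 (I : 3.-tuple 'I_n) : T3 := fun x y u =>
  delta R (tnth I 0) x * delta R (tnth I 1) y * delta R (tnth I 2) u.

Definition linear3 (k : T3 -> R) := forall c B B',
  k (fun x y u => c * B x y u + B' x y u) = c * k B + k B'.

Lemma linear3_expand (k : T3 -> R) D : linear3 k ->
  k D = \sum_I uncurry3 D I * k (tbasis3 I).
Proof.
move=> kl.
have k0 : k (@zero3 R n) = 0.
  have H := kl 1 (@zero3 R n) (@zero3 R n).
  have E : (fun x y u => 1 * zero3 R x y u + zero3 R x y u) = @zero3 R n.
    by apply: fun3_ext => x y u; rewrite /zero3 mulr0 addr0.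
  move: H; rewrite E mul1r => /eqP; rewrite -subr_eq0 opprD addrA subrr add0r oppr_eq0.
  by move=> /eqP.
have ks (r : seq (3.-tuple 'I_n)) :
    k (fun x y u => \sum_(I <- r) uncurry3 D I * tbasis3 I x y u)
    = \sum_(I <- r) uncurry3 D I * k (tbasis3 I).
  elim: r => [|I r IH].
    by rewrite big_nil -[RHS]k0; congr k; apply: fun3_ext => x y u; rewrite big_nil.
  by rewrite big_cons -IH -kl; congr k; apply: fun3_ext => x y u; rewrite big_cons.
rewrite -ks; congr k; apply: fun3_ext => x y u.
rewrite sum_tuple3 -[LHS](sum_delta3 D x y u).
apply: eq_bigr => a _; apply: eq_bigr => b _; apply: eq_bigr => c _.
rewrite uncurry3E /tbasis3 !(tnth_nth a) /=; ring.
Qed.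

(** Second and first derivatives of [L] at [base_point w] in fixed directions, here and in
    [beta_coef]; they make sense and are smooth for every invertible [w]. *)
Definition mu_coef : quad_coef R n := fun I J w => quad w (vD (tbasis3 I)) (vD (tbasis3 J)).

Definition beta_coef : div_coef R n := fun K w => lin w (vE (tbasis R K)).

Lemma quadD_expand G (D : 3.-tuple 'I_n -> R) : lorentz_mx G ->
  \sum_I \sum_J mu_coef I J G * D I * D J =
  quad G (vD (fun a b c => D [tuple a; b; c])) (vD (fun a b c => D [tuple a; b; c])).
Proof.
move=> lG; set cD : T3 := fun a b c => _.
have uD : uncurry3 cD = D by exact: uncurry3K.
rewrite (linear3_expand (k := fun X => quad G (vD X) (vD cD)) cD); last first.
  by move=> c B B'; rewrite vD_lin (quadDl L_smooth lG) (quadZl L_smooth lG).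
rewrite uD; apply: eq_bigr => I _.
rewrite (linear3_expand (k := fun X => quad G (vD (tbasis3 I)) (vD X)) cD); last first.
  by move=> c B B'; rewrite vD_lin (quadDr L_smooth lG) (quadZr L_smooth lG).
rewrite uD mulr_sumr; apply: eq_bigr => J _; rewrite /mu_coef; ring.
Qed.

Lemma linE_linear G : lorentz_mx G -> linear4 (fun E => lin G (vE E)).
Proof.
by move=> lG c B B'; rewrite vE_lin (linD L_smooth lG) (linZ L_smooth lG).
Qed.

Lemma linE_expand G (E : 4.-tuple 'I_n -> R) : lorentz_mx G ->
  \sum_K beta_coef K G * E K = lin G (vE (fun a b c d => E [tuple a; b; c; d])).
Proof.
move=> lG; rewrite (zeta_expand (linE_linear lG)) uncurry4K.
by apply: eq_bigr => K _; rewrite mulrC.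
Qed.

Lemma smooth_base_point (f : jet_space R n -> R^o) : smooth_on (@Y3 R n) f ->
  smooth_on [set w | \det w != 0] (fun w => f (base_point w)).
Proof.
move=> sf; have oY := @Y3_open R n.
have [ p4 s4] := smooth_slice oY sf; have [ p3 s3] := smooth_slice p4 s4.
have [ p2 s2] := smooth_slice p3 s3; have [ p1 s1] := smooth_slice p2 s2.
exact: s1.
Qed.

Lemma mu_coef_smooth I J : smooth_on [set w | \det w != 0] (mu_coef I J).
Proof.
apply: smoothM; [exact: det_nonzero_open|exact: smooth_cst|].
exact: (smooth_base_point (smooth_derive (vD (tbasis3 I))
  (smooth_derive (vD (tbasis3 J)) L_smooth))).
Qed.

Lemma beta_coef_smooth K : smooth_on [set w | \det w != 0] (beta_coef K).
Proof. exact: (smooth_base_point (smooth_derive _ L_smooth)). Qed.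

End GeneralMetric.

(** * Curvature and exterior derivative *)

(** Splits a fourfold contraction into four second-derivative terms and a remainder; both sides of
    the scalar curvature formula are brought to this shape. *)
Lemma weighted_sum_linear (R : realType) (n : nat)
    (w f1 f2 f3 f4 x y : 'I_n -> 'I_n -> 'I_n -> 'I_n -> R) :
  (forall i j k l, y i j k l = 2^-1 * f1 i j k l + 2^-1 * f2 i j k l
     + - 2^-1 * f3 i j k l + - 2^-1 * f4 i j k l + x i j k l) ->
  let S f := \sum_i \sum_j \sum_k \sum_l w i j k l * f i j k l in
  S y = 2^-1 * S f1 + 2^-1 * S f2 + - 2^-1 * S f3 + - 2^-1 * S f4 + S x.
Proof.
move=> yE /=.
rewrite 4!mulr_sumr -4!big_split /=; apply: eq_bigr => i _.
rewrite 4!mulr_sumr -4!big_split /=; apply: eq_bigr => j _.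
rewrite 4!mulr_sumr -4!big_split /=; apply: eq_bigr => k _.
rewrite 4!mulr_sumr -4!big_split /=; apply: eq_bigr => l _.
rewrite yE; ring.
Qed.

Section PointwiseGeometry.
Variables (R : realType) (n : nat) (g : cfield R n 2) (U : set 'rV[R]_n).
Hypothesis oU : open U.
Hypothesis g_smooth : forall I, smooth_on U (fun v => g v I).
Hypothesis g_sym : forall v i j, U v -> g v [tuple i; j] = g v [tuple j; i].
Hypothesis g_unit : forall v, U v -> mx_of g v \in unitmx.
Notation T3 := ('I_n -> 'I_n -> 'I_n -> R).
Notation T4 := ('I_n -> 'I_n -> 'I_n -> 'I_n -> R).
Notation dd a f := ('D_(evec R a) f).

Definition metric_d1 u : T3 := fun a b c => dd c (fun v => g v [tuple a; b]) u.
Definition metric_d2 u : T4 := fun a b c d =>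
  dd d (dd c (fun v => g v [tuple a; b])) u.

Variable u : 'rV[R]_n.
Hypothesis Uu : U u.
Let G := mx_of g u.
Let A := metric_d1 u.
Let B := metric_d2 u.

Lemma near_domain (P : 'rV[R]_n -> Prop) : (forall v, U v -> P v) -> \forall v \near u, P v.
Proof.
move=> UP; apply: filterS UP _; exact: open_nbhs_nbhs (conj oU Uu).
Qed.

Lemma near_near_domain (P : 'rV[R]_n -> Prop) : (forall v, U v -> P v) ->
  \forall v \near u, \forall w \near v, P w.
Proof.
move=> UP; apply: near_domain => v Uv.
by apply: filterS UP _; exact: open_nbhs_nbhs (conj oU Uv).
Qed.

Lemma metric_d1_sym a b c : A a b c = A b a c.
Proof. by apply: near_eq_derive; apply: near_domain => v /g_sym. Qed.

Lemma metric_d2_sym4 : sym4 B.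
Proof.
split=> a b c d; last exact: Ck2_Schwarz oU Uu (g_smooth [tuple a; b] 2%N).
apply: near_eq_derive; apply: filterS (near_near_domain (fun v => @g_sym v a b)).
by move=> v vE; apply: near_eq_derive; exact: vE.
Qed.

Lemma metric_tr : G^T = G.
Proof. by apply/matrixP => i j; rewrite !mxE g_sym. Qed.

Lemma invmx_sym i j : invmx G i j = invmx G j i.
Proof. by rewrite -{1}metric_tr -trmx_inv mxE. Qed.

Lemma lc_lowE v i j k : lc_low g v i j k = chr (metric_d1 v) i j k.
Proof. by rewrite /lc_low !partial3E. Qed.

Lemma lcE m i j : lc g u m i j = chrU G A m i j.
Proof. by rewrite /lc /chrU; under eq_bigr do rewrite lc_lowE. Qed.

Lemma chr_symmetric a b c : chr A a b c = chr A b a c.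
Proof. by rewrite /chr (metric_d1_sym b a c) [X in _ * (X - _)]addrC. Qed.

Lemma cov_derivE (D : cfield R n 3) a b c d :
  cov_deriv g D u [tuple a; b; c; d] =
  dd d (fun v => D v [tuple a; b; c]) u
  - star G A (fun a b c => D u [tuple a; b; c]) a b c d.
Proof.
rewrite /cov_deriv partial4E init_idx4 last_idx4; congr (_ - _).
rewrite /star 2!big_ord_recl big_ord1 addrA -!big_split /=.
apply: eq_bigr => m _; rewrite !lcE !(tnth_nth a) /=.
congr (_ * D u _ + _ * D u _ + _ * D u _); rewrite [RHS]tuple3_eta;
  rewrite [LHS]tuple3_eta !tnth_mktuple !(tnth_nth a) /=; by [].
Qed.

Let partial_smooth a b c : smooth_on U (dd c (fun v => g v [tuple a; b])).
Proof. exact: smooth_derive (g_smooth _). Qed.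

Lemma lc_smooth m i j : smooth_on U (fun v => lc g v m i j).
Proof.
apply: smooth_sum => // l _; apply: smoothM => //.
  apply: smooth_invmx => // a b; apply: smooth_eq (g_smooth [tuple a; b]) => // v _.
  by rewrite mxE.
have sp a b c : smooth_on U (fun v => partial g v [tuple a; b; c]).
  by apply: smooth_eq (partial_smooth a b c) => // v _; rewrite partial3E.
apply: smoothM => //; first exact: smooth_cst.
by apply: smoothB => //; apply: smoothD.
Qed.

Lemma lc_lowered v i j l : U v ->
  \sum_m g v [tuple l; m] * lc g v m i j = lc_low g v i j l.
Proof.
move=> Uv; rewrite /lc.
transitivity (\sum_k (1%:M : 'M[R]_n) l k * lc_low g v i j k).
  under eq_bigr do rewrite mulr_sumr.
  rewrite exchange_big /=; apply: eq_bigr => k _.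
  rewrite -(mulmxV (g_unit Uv)) mxE mulr_suml; apply: eq_bigr => m _.
  by rewrite mulrA [mx_of _ _ _ _]mxE.
rewrite (bigD1 l) //= mxE eqxx mul1r big1 ?addr0 // => k kl.
by rewrite mxE eq_sym (negbTE kl) mul0r.
Qed.

(** Differentiates the lowered identity [lc_lowered], so that the inverse metric is applied
    afterwards and never differentiated. *)
Lemma derive_lc k i j e : dd e (fun v => lc g v k i j) u =
  \sum_l invmx G k l * (dchr B i j l e - \sum_m A l m e * chrU G A m i j).
Proof.
pose d m : R := dd e (fun v => lc g v m i j) u.
have H l : \sum_m G l m * d m = dchr B i j l e - \sum_m A l m e * chrU G A m i j.
  apply/eqP; rewrite eq_sym subr_eq eq_sym; apply/eqP.
  have g1 a b c : is_derive u (evec R e) (dd c (fun v => g v [tuple a; b])) (B a b c e).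
    by apply: is_derive_of_derivable; exact: smooth_derivable (partial_smooth a b c) Uu.
  have D1 : is_derive u (evec R e) (fun v => lc_low g v i j l : R^o) (dchr B i j l e).
    apply: is_derive_congr (is_derive_mul (is_derive_cst (2^-1 : R^o) u (evec R e))
      (is_deriveB (is_deriveD (g1 j l i) (g1 i l j)) (g1 i j l))).
      by move=> v; rewrite lc_lowE.
    by rewrite mul0r add0r.
  have D2 : is_derive u (evec R e) (fun v => \sum_m g v [tuple l; m] * lc g v m i j : R^o)
      (\sum_m (A l m e * chrU G A m i j + G l m * d m)).
    apply: is_derive_fsum => m.
    rewrite -lcE [G l m]mxE; apply: is_derive_mul; apply: is_derive_of_derivable.
      exact: smooth_derivable (g_smooth _) Uu.
    exact: smooth_derivable (lc_smooth _ _ _) Uu.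
  have D3 := is_derive_near (near_domain (fun v => @lc_lowered v i j l)) D2.
  by rewrite -(is_derive_val D1) (is_derive_val D3) big_split addrC.
transitivity (d k) => //.
under eq_bigr do rewrite -H mulr_sumr.
rewrite exchange_big /=.
transitivity (\sum_m (1%:M : 'M[R]_n) k m * d m).
  rewrite (bigD1 k) //= mxE eqxx mul1r big1 ?addr0 // => m mk.
  by rewrite mxE eq_sym (negbTE mk) mul0r.
apply: eq_bigr => m _; rewrite -(mulVmx (g_unit Uu)) mxE mulr_suml.
by apply: eq_bigr => l _; rewrite mulrA.
Qed.

(** Second derivatives agree after renaming contracted indices; the terms quadratic in Christoffel
    symbols agree once the derivatives of the metric are written through them. *)
Lemma scalar_curvE : scalar_curv g u = scalS G (fun a b c d => B a b c d - qchr G A a b c d).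
Proof.
pose S (f : T4) := \sum_i \sum_j \sum_k \sum_l invmx G i j * invmx G k l * f i j k l.
have Sext f h : (forall i j k l, f i j k l = h i j k l) -> S f = S h.
  by move=> fh; do 4 (apply: eq_bigr => ? _); rewrite fh.
(* Symmetries of the contraction: [S1] transposes both inverse metrics, [S2] exchanges them. *)
have S1 f : S (fun i j k l => f j i l k) = S f.
  rewrite /S exchange_big; apply: eq_bigr => i _; apply: eq_bigr => j _.
  rewrite exchange_big; apply: eq_bigr => k _; apply: eq_bigr => l _ /=.
  by rewrite (invmx_sym j i) (invmx_sym l k).
have S2 f : S (fun i j k l => f k l i j) = S f.
  rewrite /S.
  transitivity (\sum_i \sum_k \sum_j \sum_l invmx G i j * invmx G k l * f k l i j).
    by apply: eq_bigr => i _; exact: exchange_big.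
  rewrite exchange_big; apply: eq_bigr => k _ /=.
  transitivity (\sum_i \sum_l \sum_j invmx G i j * invmx G k l * f k l i j).
    by apply: eq_bigr => i _; exact: exchange_big.
  rewrite exchange_big; apply: eq_bigr => l _ /=.
  by apply: eq_bigr => i _; apply: eq_bigr => j _; rewrite [invmx G i j * _]mulrC.
have [B1 B2] := metric_d2_sym4.
have US m i j : chrU G A m i j = chrU G A m j i.
  by apply: eq_bigr => l _; rewrite chr_symmetric.
have AE a b c : A a b c = chr A c a b + chr A c b a.
  rewrite /chr (metric_d1_sym b a c).
  by move: (A a b c) (A c b a) (A c a b) => *; field.
(* The part quadratic in Christoffel symbols, common to both sides. *)
pose X : T4 := fun i j k l =>
  \sum_m (chr A j l m * chrU G A m k i - chr A k l m * chrU G A m j i).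
have LHSE : scalar_curv g u =
    S (fun i j k l => dchr B j i l k - dchr B k i l j + X i j k l).
  rewrite /scalar_curv /S; apply: eq_bigr => i _; apply: eq_bigr => j _.
  rewrite /ricci mulr_sumr; apply: eq_bigr => k _.
  rewrite !derive_lc -sumrB.
  have -> : \sum_m (lc g u m j i * lc g u k k m - lc g u m k i * lc g u k j m) =
      \sum_l invmx G k l * \sum_m (chrU G A m j i * chr A k m l - chrU G A m k i * chr A j m l).
    under [RHS]eq_bigr do rewrite mulr_sumr.
    rewrite exchange_big /=; apply: eq_bigr => m _; rewrite !lcE.
    rewrite /(chrU G A k k m) /(chrU G A k j m) !mulr_sumr -sumrB.
    by apply: eq_bigr => l _; ring.
  rewrite -big_split mulr_sumr; apply: eq_bigr => l _ /=.
  rewrite -mulrBr -mulrDr -mulrA; congr (_ * (_ * _)).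
  have shuffle (x p y q r : R) : x - p - (y - q) + r = x - y + (q - p + r) by ring.
  rewrite shuffle /X; congr (_ + _); rewrite -sumrB -big_split; apply: eq_bigr => m _ /=.
  rewrite !AE; move: (chr A k l m) (chr A k m l) (chr A j l m) (chr A j m l).
  by move: (chrU G A m k i) (chrU G A m j i) => *; ring.
rewrite LHSE -[scalS _ _]/(S _).
pose b1 : T4 := fun i j k l => B i k j l.
have E1 : S (fun i j k l => B j l i k) = S b1 by exact: (S1 b1).
have E2 : S (fun i j k l => B k i l j) = S b1.
  by apply: Sext => i j k l; rewrite /b1 (B1 k i) (B2 i k l).
have E3 : S (fun i j k l => B j i l k) = S B by exact: (S1 B).
have E4 : S (fun i j k l => B k l i j) = S B by exact: (S2 B).
etransitivity.
  apply: (weighted_sum_linear (fun i j k l => invmx G i j * invmx G k l)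
    (f1 := fun i j k l => B j l i k) (f2 := fun i j k l => B k i l j)
    (f3 := fun i j k l => B j i l k) (f4 := fun i j k l => B k l i j) (x := X)).
  move=> i j k l; rewrite /dchr (B2 i l k j); congr (_ + _).
  by move: (B j l i k) (B i l j k) (B k i l j) (B j i l k) (B k l i j) => *; ring.
etransitivity; last first.
  apply/esym/(weighted_sum_linear (fun i j k l => invmx G i j * invmx G k l)
    (f1 := b1) (f2 := b1) (f3 := B) (f4 := B) (x := X)) => i j k l.
  rewrite /b1 /X /qchr [in RHS](eq_bigr (fun m =>
    (chrU G A m i k * chr A j l m + chrU G A m i l * chr A j k m)
    - (chrU G A m i j * chr A k l m + chrU G A m i l * chr A k j m))); last first.
    move=> m _; rewrite (US m i k) (US m i j) (chr_symmetric j k m).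
    move: (chr A k l m) (chr A k j m) (chr A j l m) => *.
    by move: (chrU G A m k i) (chrU G A m j i) (chrU G A m i l) => *; ring.
  rewrite sumrB; move: (\sum_m _) (\sum_m _) (B i k j l) (B i j k l) => *; by field.
exact: (congr2 +%R (congr2 +%R (congr2 +%R (congr2 +%R (congr1 ( *%R 2^-1) E1)
  (congr1 ( *%R 2^-1) E2)) (congr1 ( *%R (- 2^-1)) E3)) (congr1 ( *%R (- 2^-1)) E4)) erefl).
Qed.

End PointwiseGeometry.

(** * Exterior derivative of an alternation *)

Section ExteriorDerivative.
Variables (R : realType) (n r : nat) (T : cfield R n r) (u : 'rV[R]_n).
Hypothesis dT : forall I v, derivable (fun w => T w I) u v.

Lemma lift_perm_max (I : r.+1.-tuple 'I_n) s (q : 'S_r) :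
  partial T u (tperms I (lift_perm ord_max s q)) =
  'D_(evec R (tnth I s)) (fun v => T v [tuple tnth I (lift s (q t)) | t < r]) u.
Proof.
rewrite /partial /last_idx tnth_mktuple lift_perm_id.
congr ('D_ _ _ _); apply/funext => v; congr (T v _).
apply: eq_from_tnth => t; rewrite !tnth_mktuple.
rewrite -(lift_perm_lift ord_max s q t); congr (tnth I (lift_perm _ _ _ _)).
by apply: val_inj; rewrite /= /bump leqNgt ltn_ord.
Qed.

(** Permutations of all [r + 1] slots are sorted by the index sent to the last slot, where [partial]
    differentiates. Bringing that slot to the front accounts for the sign [(-1) ^+ r]. *)
Lemma ext_deriv_alternation I :
  ext_deriv (alternation T) u I = (-1) ^+ r / r`!%:R * alt (partial T u) I.
Proof.
rewrite /alt (sum_lift_perm ord_max) mulr_sumr; apply: eq_bigr => s _.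
pose J (q : 'S_r) := [tuple tnth I (lift s (q t)) | t < r].
have D : is_derive u (evec R (tnth I s))
    (fun v => alternation T v [tuple tnth I (lift s t) | t < r] : R^o)
    (r`!%:R^-1 * \sum_(q : 'S_r) (-1) ^+ q * 'D_(evec R (tnth I s)) (fun v => T v (J q)) u).
  apply: is_derive_congr (is_derive_mul (is_derive_cst (r`!%:R^-1 : R^o) u _)
    (is_derive_fsum (index_enum _) (fun q : 'S_r => is_derive_mul
       (is_derive_cst ((-1) ^+ q : R^o) u _) (is_derive_of_derivable (@dT (J q) _))))).
    move=> v; congr (_ * _); apply: eq_bigr => q _; congr (_ * T v _).
    by apply: eq_from_tnth => t; rewrite !tnth_mktuple.
  by rewrite mul0r add0r; congr (_ * _); apply: eq_bigr => q _; rewrite mul0r add0r.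
rewrite (is_derive_val D) !mulr_sumr; apply: eq_bigr => q _.
rewrite lift_perm_max odd_lift_perm -/(J q); move: (odd_perm q) => b.
rewrite !signr_addb /= !signr_odd.
have e : (-1) ^+ r * (-1) ^+ r = 1 :> R by rewrite -expr2 sqrr_sign.
move: ('D_(evec R (tnth I s)) _ u) (r`!%:R^-1) ((-1) ^+ s) ((-1) ^+ b) ((-1) ^+ r) e.
by move=> d c a y x e; rewrite -[LHS]mul1r -e; ring.
Qed.

Lemma sqnorm_ext_deriv g : sqnorm g (ext_deriv (alternation T)) u =
  (r`!%:R ^- 2) * normS (mx_of g u) (alt (partial T u)).
Proof.
rewrite /sqnorm /normS /inv_metric mulr_sumr; apply: eq_bigr => I _.
rewrite mulr_sumr; apply: eq_bigr => J _; rewrite !ext_deriv_alternation.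
have e : (-1) ^+ r * (-1) ^+ r = 1 :> R by rewrite -expr2 sqrr_sign.
rewrite -exprVn expr2; move: (alt _ I) (alt _ J) (\prod_(s < r.+1) _) (r`!%:R^-1) ((-1) ^+ r) e.
by move=> d c a b x e; rewrite -[RHS]mul1r -e; ring.
Qed.

End ExteriorDerivative.

(** * Invariance of the coefficients *)

Section Invariance.
Variables (R : realType) (n : nat) (L : jet_space R n -> R^o).
Hypothesis L_smooth : smooth_on (@Y3 R n) L.
Hypothesis L_third : forall u v w : jet_space R n,
   jet_base u = 0 -> jet_base v = 0 -> jet_base w = 0 ->
   forall y, Y3 y -> 'D_u ('D_v ('D_w L)) y = 0.
Hypothesis L_inv : forall (M : manifold R n) (g : lorentz_metric M)
   (nabla : connection M), exists f : M -> R, represents L g nabla f.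
Notation eta := (Defs.minkowski R n).
Notation mu := (mu_coef L).
Notation beta := (beta_coef L).

Lemma mu_coef_invariant : quadratic_invariant mu.
Proof.
split=> [I J|M g D x y p xyp]; first exact: mu_coef_smooth.
have [ax ay px py] := xyp.
have lx : lorentz_mx (mx_of (g x) (cmap x p)) by apply: metric_lorentz => //; exists p.
have ly : lorentz_mx (mx_of (g y) (cmap y p)) by apply: metric_lorentz => //; exists p.
apply: etrans (quadD_expand L_smooth (D x (cmap x p)) lx) _.
apply: etrans _ (esym (quadD_expand L_smooth (D y (cmap y p)) ly)).
rewrite (metric_pullback g xyp).
have -> : (fun a b c => D x (cmap x p) [tuple a; b; c]) =
    pull3 (\matrix_(i, a) jac x y p i a) (fun a b c => D y (cmap y p) [tuple a; b; c]).
  apply: fun3_ext => a b c; rewrite (tcomp_change D _ xyp) sum_tuple3.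
  apply: eq_bigr => i _; apply: eq_bigr => j _; apply: eq_bigr => k _.
  by rewrite 2!big_ord_recl big_ord1 !(tnth_nth i) /= !mxE mulrA.
exact: (quadD_transform L_smooth L_third L_inv ly (jac_unit g xyp)).
Qed.

(** The pullback of a basis tensor has products of Jacobian entries as components; expanding the
    invariant linear form on it gives the contravariant law. *)
Lemma beta_coef_tensor (M : manifold R n) (g : lorentz_metric M) x y p K :
  overlap x y p ->
  beta K (mx_of (g y) (cmap y p)) =
    \sum_(J : 4.-tuple 'I_n) (\prod_(s < 4) jac x y p (tnth K s) (tnth J s))
      * beta J (mx_of (g x) (cmap x p)).
Proof.
move=> xyp; have [ax ay px py] := xyp.
have lx : lorentz_mx (mx_of (g x) (cmap x p)) by apply: metric_lorentz => //; exists p.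
have ly : lorentz_mx (mx_of (g y) (cmap y p)) by apply: metric_lorentz => //; exists p.
have [H _] := linE_quadE_transform L_smooth L_third L_inv ly (jac_unit g xyp) (tbasis R K).
rewrite -(metric_pullback g xyp) in H.
apply: etrans (esym H) _.
under eq_bigr do rewrite mulrC.
apply: etrans _ (esym (linE_expand L_smooth
  (fun J : 4.-tuple 'I_n => \prod_(s < 4) jac x y p (tnth K s) (tnth J s)) lx)).
congr (lin _ _ (vE _)); apply: fun4_ext => a b c d.
rewrite (prod_tuple4 (fun s t => jac x y p (tnth K s) t)).
by rewrite /tbasis /basis pull4_basis !mxE.
Qed.

Section Formula.
Variables (b c : R).
Hypothesis Hb : forall G B, lorentz_mx G -> sym4 B -> lin L G (vB B) = b * scalS G B.
Hypothesis Hc : forall G E, lorentz_mx G ->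
  quad L G (vE E) (vE E) = c * normS G (alt (uncurry4 E)).
Variables (M : manifold R n) (g : lorentz_metric M) (x : chart R n M).
Hypothesis ax : atlas x.
Let U := cimg x.
Let oU : open U. Proof. exact: cimg_open. Qed.

(** Stated for component functions on one chart, so that it applies both to a given connection and
    to [lcD_low]. *)
Lemma lagrangian_formula (D Gam : cfield R n 3) u : U u ->
  (forall I, smooth_on U (fun v => D v I)) ->
  (forall v, U v -> forall I,
     Gam v I = lc_low (g x) v (tnth I 0) (tnth I 1) (tnth I 2) + D v I) ->
  L (jet (g x) Gam u) = L (base_point eta) + b * scalar_curv (g x) u
    + c * normS (mx_of (g x) u) (alt (partial D u))
    + quad_expr mu (g x) D u + div_expr beta (g x) D u.
Proof.
move=> Uu sD GamE.
have sg I : smooth_on U (fun v => g x v I) by exact: tcomp_smooth.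
have gS v i j : U v -> g x v [tuple i; j] = g x v [tuple j; i].
  exact: metric_symmetric.
have gU v : U v -> mx_of (g x) v \in unitmx by exact: metric_unit.
have lG : lorentz_mx (mx_of (g x) u) by exact: metric_lorentz.
pose E a b c d := 'D_(evec R d) (fun v => D v [tuple a; b; c]) u : R.
have -> : jet (g x) Gam u = jetF (mx_of (g x) u) (metric_d1 (g x) u)
    (metric_d2 (g x) u) (fun a b c => D u [tuple a; b; c]) E.
  apply: jetFE.
  - exact: GamE.
  - move=> I k; apply: near_eq_derive; apply: (near_domain oU Uu) => v Uv.
    exact: GamE.
  - by move=> *; exact: smooth_derivable (smooth_derive _ (sg _)) Uu.
  - by move=> *; exact: smooth_derivable (sD _) Uu.
have pE : uncurry4 E = partial D u.
  rewrite -[RHS]uncurry4K; congr uncurry4; apply: fun4_ext => i j k l.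
  by rewrite partial4E.
have AS := metric_d1_sym oU gS Uu.
have sB := metric_d2_sym4 oU sg gS Uu.
have [q1 q2] := qchr_sym4 lG (metric_d1 (g x) u).
apply: etrans (F_structure L_smooth L_third L_inv lG
  (fun a b c => D u [tuple a; b; c]) E AS sB) _.
rewrite (base_invariant L_smooth L_third L_inv lG) (Hc _ lG) pE.
rewrite Hb //; last by split=> i j k l; [rewrite sB.1 q1|rewrite sB.2 q2].
rewrite (scalar_curvE oU sg gS gU Uu).
have -> : quad_expr mu (g x) D u = quad L (mx_of (g x) u)
    (vD (fun a b c => D u [tuple a; b; c])) (vD (fun a b c => D u [tuple a; b; c])).
  exact: (quadD_expand L_smooth (D u) lG).
have -> : div_expr beta (g x) D u = lin L (mx_of (g x) u) (vE (fun i j k l => E i j k l -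
    star (mx_of (g x) u) (metric_d1 (g x) u) (fun a b c => D u [tuple a; b; c]) i j k l)).
  apply: etrans (linE_expand L_smooth (cov_deriv (g x) D u) lG) _.
  congr (lin _ _ (vE _)); apply: fun4_ext => i j k l.
  exact: cov_derivE.
move: (L _) (b * _) (lin _ _ _) (quad _ _ _ _) (c * _) => *; ring.
Qed.

End Formula.

Section Opposite.
Variables (M : manifold R n) (D : tensor_field 3 M).

(** The field [- D], used to separate the parts of [L] that are even and odd in [D]. *)
Definition opp_comp (x : chart R n M) : cfield R n 3 := fun u I => - D x u I.

Lemma opp_comp_smooth x I : atlas x -> smooth_on (cimg x) (fun u => opp_comp x u I).
Proof. by move=> ax; apply: smoothN; [exact: cimg_open|exact: tcomp_smooth]. Qed.

Lemma opp_comp_change x y p J : overlap x y p -> opp_comp x (cmap x p) J =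
  \sum_(I : 3.-tuple 'I_n) (\prod_(s < 3) jac x y p (tnth I s) (tnth J s))
    * opp_comp y (cmap y p) I.
Proof.
move=> xyp; rewrite /opp_comp (tcomp_change D _ xyp) -sumrN.
by apply: eq_bigr => I _; rewrite mulrN.
Qed.

Definition opp_tensor : tensor_field 3 M := TensorField opp_comp_smooth opp_comp_change.

End Opposite.

Lemma beta_coef_invariant : invariant_divergence beta.
Proof.
have [b Hb] := linB_invariant L_smooth L_third L_inv.
have [c Hc] := quadE_invariant L_smooth L_third L_inv.
split=> [K|M g x y p K xyp|M g D x y p xyp].
- exact: beta_coef_smooth.
- exact: beta_coef_tensor.
have [ax ay px py] := xyp.
(* The divergence term is the part of [f] that is odd in [D]. *)
have odd_part z : atlas z -> cdom z p -> div_expr beta (g z) (D z) (cmap z p) =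
    2^-1 * (L (jet (g z) (lcD_low g D z) (cmap z p))
      - L (jet (g z) (lcD_low g (opp_tensor D) z) (cmap z p))).
  move=> az pz; have zu : cimg z (cmap z p) by exists p.
  have H (T : tensor_field 3 M) := lagrangian_formula Hb Hc az (D := T z)
    (Gam := lcD_low g T z) zu (fun I => tcomp_smooth T I az) (fun _ _ _ => erefl).
  rewrite !H.
  have dN : forall I v, 'D_v (fun w => opp_tensor D z w I) (cmap z p) =
      - 'D_v (fun w => D z w I) (cmap z p).
    move=> I v; apply: is_derive_val; apply: is_deriveN.
    by apply: is_derive_of_derivable; exact: smooth_derivable (tcomp_smooth D I az) zu.
  have -> : normS (mx_of (g z) (cmap z p)) (alt (partial (opp_tensor D z) (cmap z p))) =
      normS (mx_of (g z) (cmap z p)) (alt (partial (D z) (cmap z p))).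
    have aN I : alt (partial (opp_tensor D z) (cmap z p)) I =
        - alt (partial (D z) (cmap z p)) I.
      by rewrite /alt -sumrN; apply: eq_bigr => q _; rewrite /partial dN mulrN.
    by apply: eq_bigr => I _; apply: eq_bigr => J _; rewrite !aN mulrN mulrN mulNr opprK.
  have -> : quad_expr mu (g z) (opp_tensor D z) (cmap z p) =
      quad_expr mu (g z) (D z) (cmap z p).
    apply: eq_bigr => I _; apply: eq_bigr => J _.
    by rewrite [opp_tensor D z _ I]/(- _) [opp_tensor D z _ J]/(- _) mulrN mulrN mulNr opprK.
  have -> : div_expr beta (g z) (opp_tensor D z) (cmap z p) =
      - div_expr beta (g z) (D z) (cmap z p).
    rewrite /div_expr -sumrN; apply: eq_bigr => K _; rewrite -mulrN; congr (_ * _).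
    rewrite /cov_deriv /partial dN opprB [RHS]addrC; congr (_ + _).
    rewrite -sumrN; apply: eq_bigr => s _.
    by rewrite -sumrN; apply: eq_bigr => m _; rewrite /= /opp_comp mulrN opprK.
  move: (L _) (b * _) (c * _) (quad_expr _ _ _ _) (div_expr _ _ _ _) => *; by field.
apply: etrans (odd_part x ax px) _; apply: etrans _ (esym (odd_part y ay py)).
exact: (congr2 (fun s t => 2^-1 * (s - t)) (jet_invariance L_inv g D xyp)
  (jet_invariance L_inv g (opp_tensor D) xyp)).
Qed.

End Invariance.

Section DifferenceTensor.
Variables (R : realType) (n : nat) (M : manifold R n) (g : lorentz_metric M).
Variables (nabla : connection M) (x : chart R n M).
Hypothesis ax : atlas x.

Lemma diff_tensor_smooth I : smooth_on (cimg x) (fun u => diff_tensor g nabla x u I).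
Proof.
have ox : open (cimg x) by exact: cimg_open.
apply: smoothB => //; last exact: lc_low_smooth.
apply: smooth_sum => // m _; apply: smoothM => //; first exact: coef_smooth.
exact: tcomp_smooth.
Qed.

End DifferenceTensor.

Theorem corollary6 (R : realType) (n : nat) (n_ge1 : (1 <= n)%N)
    (L : jet_space R n -> R^o)
    (L_smooth : smooth_on (@Y3 R n) L)
    (L_third : forall u v w : jet_space R n,
       jet_base u = 0 -> jet_base v = 0 -> jet_base w = 0 ->
       forall y, Y3 y -> 'D_u ('D_v ('D_w L)) y = 0)
    (L_inv : forall (M : manifold R n) (g : lorentz_metric M)
       (nabla : connection M), exists f : M -> R, represents L g nabla f) :
  exists (a b c : R) (mu : quad_coef R n) (beta : div_coef R n),
    [/\ quadratic_invariant mu, invariant_divergence beta &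
      forall (M : manifold R n) (g : lorentz_metric M) (nabla : connection M)
        (f : M -> R), represents L g nabla f ->
      forall x p, atlas x -> cdom x p ->
        let u := cmap x p in
        let D := diff_tensor g nabla x in
        let gamma := gamma_form g nabla x in
        f p = a + b * scalar_curv (g x) u
              + c * sqnorm (g x) (ext_deriv gamma) u
              + quad_expr mu (g x) D u + div_expr beta (g x) D u].
Proof.
have [b Hb] := linB_invariant L_smooth L_third L_inv.
have [c Hc] := quadE_invariant L_smooth L_third L_inv.
(* The constant term is the value at the flat jet. The factor 36 is [(3!) ^ 2]: [gamma] carries the
   normalisation [1 / 3!], while the invariant norm was computed with the unnormalised [alt]. *)
exists (L (base_point (Defs.minkowski R n))), b, (36 * c), (mu_coef L), (beta_coef L).
split; [exact: mu_coef_invariant|exact: beta_coef_invariant|].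
move=> M g nabla f [_ Lf] x p ax px u D gamma.
have xu : cimg x u by exists p.
have sD I : smooth_on (cimg x) (fun v => D v I) by exact: diff_tensor_smooth.
apply: etrans (esym (Lf x p ax px)) _.
have GamE v : cimg x v -> forall I : 3.-tuple 'I_n, conn_low g nabla x v I =
    lc_low (g x) v (tnth I 0) (tnth I 1) (tnth I 2) + D v I.
  by move=> _ I; rewrite addrC subrK.
apply: etrans (lagrangian_formula L_smooth L_third L_inv Hb Hc ax xu sD GamE) _.
have -> : sqnorm (g x) (ext_deriv gamma) u =
    3`!%:R ^- 2 * normS (mx_of (g x) u) (alt (partial D u)).
  by apply: sqnorm_ext_deriv => I v; exact: smooth_derivable (sD I) xu.
congr (_ + _ + _ + _ + _).
have -> : 3`!%:R = 6 :> R by [].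
by move: (normS _ _) => N; field.
Qed.
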